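(* Let $M$ be a finite $R$-module all of whose deficiency modules have finite injective dimension, i.e. $\operatorname{id}_R K^i(M)<\infty$ for all $i$ with $0\le i\le\dim_R M$. Then the Auslander-Reiten conjecture holds for $M$: if $\operatorname{Ext}^j_R(M,M\oplus R)=0$ for all $j>0$, then $M$ is free.
   Context: $R$ is a commutative Noetherian local ring, and $R$ is a factor of a Gorenstein local ring $S$ of dimension $s$, i.e. there is a surjective ring homomorphism $S\to R$; $R$-modules are regarded as $S$-modules through it. ''Finite'' means finitely generated. For a finite $R$-module $M$, the $j$-th deficiency module of $M$ is $K^j(M)=\operatorname{Ext}^{s-j}_S(M,S)$. $\operatorname{id}_R$ denotes injective dimension (the zero module counts as having finite injective dimension). *)

(* Defs.v *)
From HB Require Import structures.
From mathcomp Require Import all_boot all_algebra.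
From mathcomp Require Import boolp functions.
From mathcomp Require Import freeg.

Set Implicit Arguments.
Unset Strict Implicit.
Unset Printing Implicit Defensive.

Import GRing.Theory.
Local Open Scope ring_scope.
Local Open Scope quotient_scope.

(* Terms of [idealr R] are proper ideals.  The unit ideal is generated by 1,  *)
(* so it does not have to be considered here.                                 *)
Definition noetherian_ring (R : comNzRingType) : Prop :=
  forall I : idealr R, exists2 s : seq R, {subset s <= I} &
    forall x, x \in I ->
      exists c : 'I_(size s) -> R, x = \sum_(i < size s) c i * s`_i.

Definition maximal_ideal (R : comNzRingType) (m : idealr R) : Prop :=
  forall J : idealr R, {subset m <= J} -> {subset J <= m}.

Definition local_ring (R : comNzRingType) : Prop :=
  exists2 m : idealr R, maximal_ideal m &
    forall m' : idealr R, maximal_ideal m' -> m' =i m.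

(* There is a chain p_0 < p_1 < ... < p_n of primes with a contained in p_0.  *)
(* Only p 0, ..., p n matter.                                                 *)
Definition prime_chain (R : comNzRingType) (a : {pred R}) (n : nat) : Prop :=
  exists p : nat -> prime_idealr R,
    {subset a <= p 0%N} /\
    forall i, (i < n)%N -> {subset p i <= p i.+1} /\
                           exists2 x, x \in p i.+1 & x \notin p i.

Definition krull_dim (R : comNzRingType) (s : nat) : Prop :=
  prime_chain (pred1 (0 : R)) s /\
  forall n, prime_chain (pred1 (0 : R)) n -> (n <= s)%N.

Definition annihilator (R : comNzRingType) (M : lmodType R) : {pred R} :=
  fun a => `[< forall x : M, a *: x = 0 >].

(* i <= dim M, where dim M = dim (R / Ann M) is the supremum of the lengths   *)
(* of the chains of primes containing Ann M (-oo when M = 0, in which case    *)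
(* there is no such chain).                                                   *)
Definition le_dim (R : comNzRingType) (i : nat) (M : lmodType R) : Prop :=
  prime_chain (annihilator M) i.

Definition finite_module (R : comNzRingType) (M : lmodType R) : Prop :=
  exists s : seq M, forall x,
    exists c : 'I_(size s) -> R, x = \sum_(i < size s) c i *: s`_i.

Definition free_module (R : comNzRingType) (M : lmodType R) : Prop :=
  exists (K : choiceType) (f : {linear {freeg K / R} -> M}), bijective f.

Definition injective_module (R : comNzRingType) (I : lmodType R) : Prop :=
  forall (A B : lmodType R) (i : {linear A -> B}) (g : {linear A -> I}),
    injective i -> exists h : {linear B -> I}, forall a, h (i a) = g a.

(* There is a finite injective resolution                                     *)
(*   0 -> E -> I 0 -> I 1 -> ... -> I n -> 0.                                 *)
Definition finite_injdim (R : comNzRingType) (E : lmodType R) : Prop :=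
  exists (n : nat) (I : nat -> lmodType R) (e : {linear E -> I 0%N})
         (d : forall k, {linear I k -> I k.+1}),
    [/\ forall k, injective_module (I k),
        injective e,
        forall x, d 0%N x = 0 <-> exists y, e y = x,
        forall k x, d k.+1 x = 0 <-> exists y, d k y = x
      & forall k, (n < k)%N -> forall x : I k, x = 0].

Definition gorenstein_local_ring (S : comNzRingType) : Prop :=
  [/\ noetherian_ring S, local_ring S & finite_injdim S^o].

Section Kernel.
Variables (R : comNzRingType) (U V : lmodType R) (f : {linear U -> V}).

Definition in_ker : {pred U} := fun x => f x == 0.

Lemma in_ker_submod : submod_closed in_ker.
Proof.
split=> [|a x y]; rewrite /in_ker !unfold_in ?linear0 // => /eqP fx /eqP fy.
by rewrite linearP fx fy scaler0 addr0.
Qed.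
HB.instance Definition _ := GRing.isSubmodClosed.Build R U in_ker
  (GRing.submod_closed_semi in_ker_submod).

Definition ker_mod : Type := {x : U | in_ker x}.
HB.instance Definition _ := SubChoice.on ker_mod.
HB.instance Definition _ := [SubChoice_isSubLmodule of ker_mod by <:].

Lemma kerP (x : ker_mod) : f (val x) = 0. Proof. exact/eqP/(valP x). Qed.
End Kernel.

Section QuotientModule.
Variables (R : comNzRingType) (V : lmodType R) (I : {pred V}).
Variable I_submod : submod_closed I.

Definition submod_zmod : zmodClosed V :=
  HB.pack I (GRing.isZmodClosed.Build V I (GRing.submod_closedB I_submod)).

Definition quot_mod : Type := {ideal_quot submod_zmod}.
HB.instance Definition _ := GRing.Zmodule.on quot_mod.

Definition quot_pi (x : V) : quot_mod := \pi_{ideal_quot submod_zmod} x.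
Definition quot_scale (a : R) (x : quot_mod) : quot_mod :=
  quot_pi (a *: repr (x : {ideal_quot submod_zmod})).

Lemma quot_piP (x y : V) : quot_pi x = quot_pi y <-> x - y \in I.
Proof.
rewrite -[_ \in I]/(x - y \in (submod_zmod : {pred V})) Quotient.idealrBE.
by split=> [/eqP | /eqP].
Qed.

Lemma quot_pi_surj (q : quot_mod) : exists x, q = quot_pi x.
Proof. by exists (repr (q : {ideal_quot submod_zmod})); rewrite /quot_pi reprK. Qed.

Lemma quot_piD x y : quot_pi (x + y) = quot_pi x + quot_pi y.
Proof. exact: (raddfD (\pi_{ideal_quot submod_zmod})). Qed.

Lemma quot_piZ a x : quot_pi (a *: x) = quot_scale a (quot_pi x).
Proof.
apply/quot_piP; rewrite -scalerBr -[_ *: _]addr0.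
by apply: I_submod.2; [apply/quot_piP; rewrite /quot_pi reprK | exact: I_submod.1].
Qed.

Fact quot_scaleA a b x : quot_scale a (quot_scale b x) = quot_scale (a * b) x.
Proof. by have [y ->] := quot_pi_surj x; rewrite -!quot_piZ scalerA. Qed.
Fact quot_scale1 : left_id 1 quot_scale.
Proof. by move=> x; have [y ->] := quot_pi_surj x; rewrite -!quot_piZ scale1r. Qed.
Fact quot_scaleDr : right_distributive quot_scale +%R.
Proof.
move=> a x y; have [x' ->] := quot_pi_surj x; have [y' ->] := quot_pi_surj y.
by rewrite -quot_piD -!quot_piZ -quot_piD scalerDr.
Qed.
Fact quot_scaleDl x : {morph quot_scale^~ x : a b / a + b}.
Proof.
move=> a b; have [x' ->] := quot_pi_surj x.
by rewrite -!quot_piZ -quot_piD scalerDl.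
Qed.
HB.instance Definition _ := GRing.Zmodule_isLmodule.Build R quot_mod
  quot_scaleA quot_scale1 quot_scaleDr quot_scaleDl.

Fact quot_pi_linear : linear quot_pi.
Proof. by move=> a x y; rewrite quot_piD quot_piZ. Qed.
HB.instance Definition _ :=
  GRing.isLinear.Build R V quot_mod *:%R quot_pi quot_pi_linear.
End QuotientModule.

(* ker g / (im f :&: ker g), i.e. ker g / im f for a complex A -f-> B -g-> C. *)
Section Cohomology.
Variables (R : comNzRingType) (A B C : lmodType R).
Variables (f : {linear A -> B}) (g : {linear B -> C}).

Definition in_im : {pred ker_mod g} := fun z => `[< exists x, f x = val z >].

Lemma in_im_submod : submod_closed in_im.
Proof.
split=> [|a x y]; rewrite !unfold_in; first by apply/asboolP; exists 0; rewrite !linear0.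
move=> /asboolP[x' xE] /asboolP[y' yE]; apply/asboolP; exists (a *: x' + y').
by rewrite !linearP xE yE.
Qed.

Definition cohomology : lmodType R := quot_mod in_im_submod.
End Cohomology.

Section Hom.
Variables (R : comNzRingType) (U V : lmodType R).

Definition is_linear : {pred U -> V} := fun f => `[< linear f >].

Lemma is_linear_submod : submod_closed is_linear.
Proof.
split=> [|a f g]; rewrite !unfold_in.
  by apply/asboolP => b x y /=; rewrite scaler0 addr0.
move=> /asboolP lf /asboolP lg; apply/asboolP => b x y.
rewrite -[LHS]/(a *: f (b *: x + y) + g (b *: x + y)).
rewrite -[RHS]/(b *: (a *: f x + g x) + (a *: f y + g y)).
by rewrite lf lg !scalerDr !scalerA mulrC addrACA.
Qed.
HB.instance Definition _ := GRing.isSubmodClosed.Build R (U -> V) is_linear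
  (GRing.submod_closed_semi is_linear_submod).

Definition lin_hom : Type := {f : U -> V | is_linear f}.
HB.instance Definition _ := SubChoice.on lin_hom.
HB.instance Definition _ := [SubChoice_isSubLmodule of lin_hom by <:].

Definition hom_fun (f : lin_hom) : U -> V := val f.
Lemma hom_linear (f : lin_hom) : linear (hom_fun f).
Proof. exact/asboolP/(valP f). Qed.
HB.instance Definition _ (f : lin_hom) :=
  GRing.isLinear.Build R U V *:%R (hom_fun f) (hom_linear f).

Lemma is_linearT (f : {linear U -> V}) : is_linear f.
Proof. by apply/asboolP => a x y; rewrite linearP. Qed.
Definition to_hom (f : {linear U -> V}) : lin_hom := exist _ (f : U -> V) (is_linearT f).
End Hom.

Section Precomposition.
Variables (R : comNzRingType) (U U' V : lmodType R) (d : {linear U' -> U}).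

Definition precomp (f : lin_hom U V) : lin_hom U' V := to_hom (hom_fun f \o d).

Fact precomp_linear : linear precomp.
Proof. by move=> a f g; apply/val_inj/funext. Qed.
HB.instance Definition _ :=
  GRing.isLinear.Build R (lin_hom U V) (lin_hom U' V) *:%R precomp precomp_linear.
End Precomposition.

Section Ext.
Variable R : comNzRingType.

Section FreeModule.
Variables (K : choiceType) (V : lmodType R) (f : K -> V).

Fact fglift_linear : linear (@fglift R V K f).
Proof.
have add: {morph @fglift R V K f : x y / x - y} := lift_is_additive f.
pose fA : {additive {freeg K / R} -> V} :=
  HB.pack (@fglift R V K f) (GRing.isZmodMorphism.Build _ _ (@fglift R V K f) add).
have fE D : fglift f D = \sum_(x <- dom D) coeff x D *: f x.
  rewrite -{1}[D]freeg_sumE -[fglift f _]/(fA _) raddf_sum.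
  by apply: eq_bigr => x _; apply: liftU.
have fZ a D : fglift f (a *: D) = a *: fglift f D.
  rewrite [in RHS]fE scaler_sumr -[a *: D]/(fgscale a D) /fgscale.
  rewrite -[fglift f _]/(fA _) raddf_sum.
  by apply: eq_bigr => x _; rewrite scalerA; apply: liftU.
move=> a x y; rewrite -fZ.
by rewrite -[fglift f (_ + _)]/(fA _) raddfD.
Qed.
HB.instance Definition _ :=
  GRing.isLinear.Build R {freeg K / R} V *:%R (@fglift R V K f) fglift_linear.
End FreeModule.

Definition free_cover (M : lmodType R) : {linear {freeg M / R} -> M} :=
  @fglift R M M id.

(* The standard free resolution: the n-th term is the free module on the set  *)
(* of elements of the n-th syzygy, mapped onto that syzygy.                   *)
Fixpoint syzygy (n : nat) (M : lmodType R) : lmodType R :=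
  if n is n'.+1 then ker_mod (free_cover (syzygy n' M)) else M.

Definition res_mod (M : lmodType R) (n : nat) : lmodType R :=
  {freeg (syzygy n M) / R}.

Definition res_d (M : lmodType R) (n : nat) :
    {linear res_mod M n.+1 -> res_mod M n} :=
  (val : ker_mod (free_cover (syzygy n M)) -> _) \o free_cover (syzygy n.+1 M).

Definition Ext (n : nat) (M N : lmodType R) : lmodType R :=
  if n is n'.+1
  then cohomology (precomp (V := N) (res_d M n')) (precomp (V := N) (res_d M n'.+1))
  else cohomology (\0 : lin_hom (res_mod M 0) N -> lin_hom (res_mod M 0) N)
                  (precomp (V := N) (res_d M 0)).

Section Annihilator.
Variables (M : lmodType R).

Lemma free_cover_surj (V : lmodType R) (x : V) : free_cover V << x >> = x.
Proof. by rewrite /free_cover /= liftU scale1r. Qed.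

Lemma freeg_linear_eq (K : choiceType) (V : lmodType R)
    (f g : {linear {freeg K / R} -> V}) :
  (forall k, f << k >> = g << k >>) -> f =1 g.
Proof.
move=> fg x; rewrite -[x]freeg_sumE !linear_sum; apply: eq_bigr => k _.
have -> : << coeff k x *g k >> = coeff k x *: (<< k >> : {freeg K / R}).
  by apply/eqP/freeg_eqP => y; rewrite coeffZ !coeffU mul1r.
by rewrite !linearZ fg.
Qed.

Lemma res_dK n (x : res_mod M n.+1) : free_cover (syzygy n M) (res_d M n x) = 0.
Proof. exact: kerP. Qed.

Lemma res_dd n (x : res_mod M n.+2) : res_d M n (res_d M n.+1 x) = 0.
Proof.
rewrite -[LHS]/(val (free_cover (syzygy n.+1 M) (res_d M n.+1 x))).
by rewrite res_dK linear0.
Qed.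

Lemma res_lift n (K : choiceType) (g : {linear {freeg K / R} -> res_mod M n}) :
  (forall x, free_cover (syzygy n M) (g x) = 0) ->
  exists h : {linear {freeg K / R} -> res_mod M n.+1},
    forall x, res_d M n (h x) = g x.
Proof.
move=> g0.
have g0' x : in_ker (free_cover (syzygy n M)) (g x) by apply/eqP.
pose u k : syzygy n.+1 M := exist _ (g << k >>) (g0' << k >>).
exists (fglift (fun k => << u k >> : res_mod M n.+1)).
apply: (@freeg_linear_eq _ _ (res_d M n \o fglift _) g) => k /=.
by rewrite liftU scale1r free_cover_surj.
Qed.

Variable a : R.
Hypothesis aM : forall x : M, a *: x = 0.

Lemma res_homotopy0 : exists h : {linear res_mod M 0 -> res_mod M 1},
  forall x, res_d M 0 (h x) = a *: x.
Proof.
have [|h hE] := @res_lift 0 M ( *:%R a : {linear res_mod M 0 -> _}).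
  by move=> x; rewrite linearZ /= aM.
by exists h.
Qed.

Lemma res_homotopy n :
  exists (h : {linear res_mod M n -> res_mod M n.+1})
         (h' : {linear res_mod M n.+1 -> res_mod M n.+2}),
    forall x, a *: x = res_d M n.+1 (h' x) + h (res_d M n x).
Proof.
suff step m (h : {linear res_mod M m -> res_mod M m.+1}) :
    (forall x, res_d M m (h (res_d M m x)) = a *: res_d M m x) ->
    exists h' : {linear res_mod M m.+1 -> res_mod M m.+2},
      forall x, a *: x = res_d M m.+1 (h' x) + h (res_d M m x).
  suff [h hE] : exists h : {linear res_mod M n -> res_mod M n.+1},
      forall x, res_d M n (h (res_d M n x)) = a *: res_d M n x.
    by have [h' h'E] := step _ _ hE; exists h, h'.
  elim: n => [|n [h /step[h' h'E]]]; first by have [h hE] := res_homotopy0; exists h.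
  exists h' => x; have := h'E (res_d M n.+1 x).
  by rewrite res_dd linear0 addr0.
move=> hE.
have [|h' h'E] := @res_lift m.+1 _
    (( *:%R a : {linear res_mod M m.+1 -> _}) \- (h \o res_d M m)).
  move=> x; apply: val_inj => /=.
  rewrite -[LHS]/(res_d M m (a *: x - h (res_d M m x))).
  apply: etrans (linearB (res_d M m) _ _) _.
  by apply/eqP; rewrite subr_eq0 linearZ; apply/eqP/esym/hE.
by exists h' => x; rewrite h'E /= subrK.
Qed.

Lemma Ext_annihilator n (N : lmodType R) (e : Ext n M N) : a *: e = 0.
Proof.
case: n e => [|n] e; have [z ->] := quot_pi_surj e.
- rewrite -linearZ -(linear0 (quot_pi _)); apply/quot_piP; rewrite subr0.
  apply/asboolP; exists 0; rewrite linear0; apply/val_inj/funext => x /=.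
  have [h hE] := res_homotopy0.
  have /(congr1 (fun u => hom_fun u (h x))) /= zd := kerP z.
  rewrite -[RHS]/(a *: hom_fun (val z) x) -linearZ -hE; exact/esym.
- rewrite -linearZ -(linear0 (quot_pi _)); apply/quot_piP; rewrite subr0.
  have [h [h' hE]] := res_homotopy n.
  apply/asboolP; exists (to_hom (hom_fun (val z) \o h)).
  apply/val_inj/funext => x /=.
  have /(congr1 (fun u => hom_fun u (h' x))) /= zd := kerP z.
  rewrite -[RHS]/(a *: hom_fun (val z) x) -linearZ hE linearD.
  by rewrite [X in X + _]zd add0r.
Qed.
End Annihilator.
End Ext.

(* M regarded as an S-module through f. *)
Definition restrict_scalars (S R : comNzRingType) (f : {rmorphism S -> R})
  (M : lmodType R) : Type := M.

Section Restrict.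
Variables (S R : comNzRingType) (f : {rmorphism S -> R}) (M : lmodType R).
HB.instance Definition _ := GRing.Zmodule.on (restrict_scalars f M).

Definition restrict_scale (a : S) (x : restrict_scalars f M) : restrict_scalars f M :=
  f a *: (x : M).

Fact restrict_scaleA a b x :
  restrict_scale a (restrict_scale b x) = restrict_scale (a * b) x.
Proof. by rewrite /restrict_scale scalerA rmorphM. Qed.
Fact restrict_scale1 : left_id 1 restrict_scale.
Proof. by move=> x; rewrite /restrict_scale rmorph1 scale1r. Qed.
Fact restrict_scaleDr : right_distributive restrict_scale +%R.
Proof. by move=> a x y; apply: scalerDr. Qed.
Fact restrict_scaleDl x : {morph restrict_scale^~ x : a b / a + b}.
Proof. by move=> a b; rewrite /restrict_scale rmorphD scalerDl. Qed.
HB.instance Definition _ := GRing.Zmodule_isLmodule.Build S (restrict_scalars f M)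
  restrict_scaleA restrict_scale1 restrict_scaleDr restrict_scaleDl.
End Restrict.

(* E regarded as an R-module, when f is onto and ker f annihilates E. *)
Definition descend (S R : comNzRingType) (f : {rmorphism S -> R})
  (f_surj : forall r, exists a, f a = r) (E : lmodType S)
  (E_ker : forall a, f a = 0 -> forall x : E, a *: x = 0) : Type := E.

Section Descend.
Variables (S R : comNzRingType) (f : {rmorphism S -> R}).
Variable f_surj : forall r, exists a, f a = r.
Variable E : lmodType S.
Variable E_ker : forall a, f a = 0 -> forall x : E, a *: x = 0.
Local Notation Ed := (descend f_surj E_ker).
HB.instance Definition _ := GRing.Zmodule.on Ed.

Definition preim_of (r : R) : S := sval (cid (f_surj r)).
Lemma preim_ofK r : f (preim_of r) = r.
Proof. exact: svalP (cid (f_surj r)). Qed.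

Definition descend_scale (r : R) (x : Ed) : Ed := preim_of r *: (x : E).

Lemma descend_scaleE (a : S) (x : E) : descend_scale (f a) x = a *: x.
Proof.
apply/eqP; rewrite -subr_eq0 -scalerBl; apply/eqP/E_ker.
by rewrite rmorphB /= preim_ofK subrr.
Qed.

Fact descend_scaleA a b x :
  descend_scale a (descend_scale b x) = descend_scale (a * b) x.
Proof.
by rewrite -(preim_ofK a) -(preim_ofK b) -rmorphM !descend_scaleE scalerA.
Qed.
Fact descend_scale1 : left_id 1 descend_scale.
Proof. by move=> x; rewrite -(rmorph1 f) descend_scaleE scale1r. Qed.
Fact descend_scaleDr : right_distributive descend_scale +%R.
Proof. by move=> a x y; apply: scalerDr. Qed.
Fact descend_scaleDl x : {morph descend_scale^~ x : a b / a + b}.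
Proof.
move=> a b; rewrite -(preim_ofK a) -(preim_ofK b) -rmorphD !descend_scaleE.
exact: scalerDl.
Qed.
HB.instance Definition _ := GRing.Zmodule_isLmodule.Build R Ed
  descend_scaleA descend_scale1 descend_scaleDr descend_scaleDl.
End Descend.

Section Deficiency.
Variables (S R : comNzRingType) (f : {rmorphism S -> R}).

Fact Ext_restrict_ker n (M : lmodType R) (N : lmodType S) (a : S) :
  f a = 0 -> forall e : Ext n (restrict_scalars f M) N, a *: e = 0.
Proof.
move=> fa0; apply: Ext_annihilator => x.
by rewrite -[LHS]/(f a *: (x : M)) fa0 scale0r.
Qed.

Variable f_surj : forall r, exists a, f a = r.

(* K^j(M) = Ext_S^(s - j)(M, S), where Ext^i = 0 for i < 0. *)
Definition deficiency (s j : nat) (M : lmodType R) : lmodType R :=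
  if (j <= s)%N
  then (descend f_surj (@Ext_restrict_ker (s - j) M S^o) : lmodType R)
  else ('rV[R]_0 : lmodType R).
End Deficiency.

(* Main.v *)
Require Import Defs.
From HB Require Import structures.
From mathcomp Require Import all_boot all_algebra.
From mathcomp Require Import boolp functions.
From mathcomp Require Import freeg.
From mathcomp Require Import ring.

Set Implicit Arguments.
Unset Strict Implicit.
Unset Printing Implicit Defensive.

Import GRing.Theory.
Local Open Scope ring_scope.

(** Let k denote the residue field of a local ring, and let I be a finite
    injective resolution of S. The modules J^q = Hom_S(R, I^q) form a bounded
    complex of injective R-modules, and Hom_R(M, J) computes Ext_S(M, S): its
    cohomology modules are the deficiency modules of M
    ([deficiency_represents]).

    Finite projective dimension. Let F -> M be the minimal free resolution
    over R, and D the total complex of the double complex Hom_R(F, J). Its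
    terms are injective R-modules, and it has the cohomology of Hom_R(M, J)
    ([edgeM_onto], [edgeM_boundary]). This cohomology has finite injective
    dimension in each degree, hence so have the cycles and the boundaries of D
    ([cycles_vanish]). Above degree s the complex D is exact, so from there on
    it is an injective resolution of a module of finite injective dimension,
    and Hom_R(k, D) is exact in high degrees ([cycles_vanish_high],
    [socle_lift]). Now F is minimal, so that the part of the differential of
    Hom_R(k, D) coming from F is zero: Hom_R(k, D) is a direct sum of shifted
    copies of Hom_S(k, I), one for each basis element of F. Since Ext_S^s(k, S)
    is not zero, F has no basis elements in high degrees ([rank_zero],
    [betti_zero]).

    Freeness. As Ext_R^j(M, R) = 0 for j > 0, the dual of F is exact in positive
    degrees, and a finite minimal resolution with this property has length 0
    ([Ext0_resolution], [resolution_trivial]).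

    The range of the hypothesis. Finite injective dimension is assumed for
    K^i(M) with 0 <= i <= dim M, that is, for Ext_S^j(M, S) with
    s - dim M <= j <= s. The other modules Ext_S^j(M, S) vanish because
    Ext_S^i(k, S) = 0 for i <> s: devissage turns this into a vanishing theorem
    for all finite modules ([Ext_killed_above], [Ext_killed_below]).
    That Ext_S^s(k, S) is not zero is Bass's argument along a chain of primes of
    length s ([Ext_residue_neq0]). That only one degree occurs is the equality
    of depth and injective dimension ([Ext_residue_single]): let t and n be the
    least and the largest i with Ext_S^i(k, S) <> 0. Dualising a free resolution
    of k yields a module X of projective dimension at most t that contains a
    copy of k. The functor Ext_S^n(-, S) is right exact, so Ext_S^n(X, S) maps
    onto Ext_S^n(k, S) <> 0, and n <= t follows.

    Cohomology classes are represented by elements and linear maps throughout;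
    for instance, a class in Ext_S^i(S/a, S) is an element of I^i that is killed
    by the ideal a and by the differential. *)

(** * Linear relations, injective and projective modules *)

Section LinearRelations.
Variable A : comNzRingType.

Definition linear_of (U V : lmodType A) (f : U -> V) (f_lin : linear f) :
  {linear U -> V} := HB.pack f (GRing.isLinear.Build A U V *:%R f f_lin).

Definition submodule (V : lmodType A) (P : V -> Prop) : Prop :=
  P 0 /\ forall a x y, P x -> P y -> P (a *: x + y).

Definition linear_rel (V W : lmodType A) (r : V -> W -> Prop) : Prop :=
  r 0 0 /\ forall a v w v' w', r v w -> r v' w' -> r (a *: v + v') (a *: w + w').

(** The kernel of the projection onto [V/P] is such a module. *)
Lemma submodule_exists (V : lmodType A) (P : V -> Prop) : submodule P ->
  exists (U : lmodType A) (i : {linear U -> V}),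
    injective i /\ forall x, P x <-> exists u, i u = x.
Proof.
move=> [P0 PD].
have cP : submod_closed (fun x => `[<P x>] : bool).
  split=> [|a x y]; rewrite !unfold_in; first exact/asboolP.
  by move=> /asboolP Px /asboolP Py; apply/asboolP/PD.
exists (ker_mod (quot_pi cP)), (val : ker_mod (quot_pi cP) -> V).
split; first exact: val_inj.
have quot0 x : quot_pi cP x = 0 <-> P x.
  rewrite -[0](linear0 (quot_pi cP)) quot_piP subr0.
  by split=> [/asboolP|Px]; last exact/asboolP.
move=> x; split=> [/quot0 Px | [u <-]]; last exact/quot0/kerP.
have kx : in_ker (quot_pi cP) x by apply/eqP.
by exists (exist _ x kx).
Qed.

Lemma linear_rel_submodule (V W : lmodType A) (r : V -> W -> Prop) :
  linear_rel r -> submodule (fun x : (V * W)%type => r x.1 x.2).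
Proof. by move=> [r0 rD]; split=> // a x y; apply: rD. Qed.

(** A functional linear relation is a linear map on a submodule of [V]. Its graph
    is a module that embeds into [V], and injectivity applies to that embedding. *)
Lemma inj_rel (V I : lmodType A) (r : V -> I -> Prop) :
  injective_module I -> linear_rel r -> (forall y, r 0 y -> y = 0) ->
  exists h : {linear V -> I}, forall v y, r v y -> h v = y.
Proof.
move=> injI rl r_fun.
have [U [i [i_inj iP]]] := submodule_exists (linear_rel_submodule rl).
have iU u : r (i u).1 (i u).2 by apply/(iP (i u)); exists u.
have fst_inj : injective (fst \o i).
  move=> u u' /= e; apply: i_inj.
  have := iU (u - u'); rewrite linearB /= e subrr => /r_fun e2.
  by rewrite [LHS]surjective_pairing [RHS]surjective_pairing e; congr pair; apply/eqP;
      rewrite -subr_eq0 e2.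
have [h hE] := injI _ _ (fst \o i) (snd \o i) fst_inj.
exists h => v y rvy.
have [u uE] : exists u, i u = (v, y) by apply/iP.
by have := hE u; rewrite /= uE.
Qed.

Definition projective (P : lmodType A) : Prop :=
  forall (V W : lmodType A) (g : {linear V -> W}) (x : {linear P -> W}),
    (forall p, exists v, g v = x p) ->
    exists y : {linear P -> V}, forall p, g (y p) = x p.

(** Lift [x] along the projection of the graph of [r]. *)
Lemma proj_rel (P V W : lmodType A) (r : W -> V -> Prop) (x : {linear P -> W}) :
  projective P -> linear_rel r -> (forall p, exists v, r (x p) v) ->
  exists y : {linear P -> V}, forall p, r (x p) (y p).
Proof.
move=> projP rl xr.
have [U [i [i_inj iP]]] := submodule_exists (linear_rel_submodule rl).
have [|y yE] := projP _ _ (fst \o i) x.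
  by move=> p; have [v /(iP (_, _))[u uE]] := xr p; exists u; rewrite /= uE.
exists (snd \o i \o y) => p.
by rewrite -yE /=; apply/(iP (i (y p))); exists (y p).
Qed.

(** Extension to [V] of the map that [phi] induces on the image of [p]. *)
Lemma factor_through (U V I : lmodType A) (p : {linear U -> V}) (phi : {linear U -> I}) :
  injective_module I -> (forall u, p u = 0 -> phi u = 0) ->
  exists psi : {linear V -> I}, forall u, psi (p u) = phi u.
Proof.
move=> injI kerp.
have [||psi psiE] := @inj_rel V I (fun v y => exists u, p u = v /\ phi u = y) injI.
- split; first by exists 0; rewrite !linear0.
  by move=> a v w v' w' [u [<- <-]] [u' [<- <-]]; exists (a *: u + u'); rewrite !linearP.
- by move=> y [u [pu <-]]; apply: kerp.
by exists psi => u; apply: psiE; exists u.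
Qed.

Lemma row_hom_linear (n : nat) (V : lmodType A) (v : 'I_n -> V) :
  linear (fun x : 'rV[A]_n => \sum_i x 0 i *: v i).
Proof.
move=> a x y; rewrite scaler_sumr -big_split /=; apply: eq_bigr => i _.
by rewrite !mxE scalerDl scalerA.
Qed.
Definition row_hom n (V : lmodType A) (v : 'I_n -> V) : {linear 'rV[A]_n -> V} :=
  linear_of (row_hom_linear v).

Lemma row_hom_delta n (V : lmodType A) (v : 'I_n -> V) i :
  row_hom v (delta_mx 0 i) = v i.
Proof.
rewrite /= (bigD1 i) //= mxE !eqxx scale1r big1 ?addr0 // => j /negbTE ji.
by rewrite mxE eqxx ji scale0r.
Qed.

Lemma row_homE n (V : lmodType A) (h : {linear 'rV[A]_n -> V}) x :
  h x = \sum_i x 0 i *: h (delta_mx 0 i).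
Proof. by rewrite {1}[x]row_sum_delta linear_sum; apply: eq_bigr => i _;
    rewrite linearZ. Qed.

Lemma projective_row n : projective 'rV[A]_n.
Proof.
move=> V W g x gx.
have [c cE] := choice (fun i => gx (delta_mx 0 i)).
exists (row_hom c) => p; rewrite [RHS]row_homE linear_sum /=.
by apply: eq_bigr => i _; rewrite linearZ cE.
Qed.

Lemma projective_freeg (K : choiceType) : projective ({freeg K / A} : lmodType A).
Proof.
move=> V W g x gx.
have [c cE] := choice (fun k => gx << k >>).
exists (fglift c : {freeg K / A} -> V).
by apply: (@freeg_linear_eq _ _ _ (g \o fglift c) x) => k /=; rewrite liftU scale1r cE.
Qed.

Lemma injective_zero : injective_module ('rV[A]_0 : lmodType A).
Proof. by move=> U V i g _; exists (\0 : V -> 'rV[A]_0) => a;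
    rewrite [LHS]thinmx0 [RHS]thinmx0. Qed.

End LinearRelations.

(** * Noetherian modules and local rings *)

Lemma dependent_choice (T : Type) (P : T -> Prop) (r : T -> T -> Prop) (x0 : T) :
  P x0 -> (forall x, P x -> exists2 y, P y & r x y) ->
  exists f : nat -> T, [/\ f 0%N = x0, forall n, P (f n) & forall n, r (f n) (f n.+1)].
Proof.
move=> Px0 step.
have step' (x : {x | P x}) : exists y : {x | P x}, r (sval x) (sval y).
  by case: x => x Px; have [y Py rxy] := step x Px; exists (exist _ y Py).
have [g gr] := choice step'.
exists (fun n => sval (iter n g (exist _ x0 Px0))).
split=> [//|n|n]; first exact: svalP (iter n g _).
exact: gr.
Qed.

Section Submodules.
Variables (A : comNzRingType) (V : lmodType A) (P : V -> Prop).
Hypothesis subP : submodule P.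
Lemma submod0 : P 0. Proof. exact: subP.1. Qed.
Lemma submodP a x y : P x -> P y -> P (a *: x + y). Proof. exact: subP.2. Qed.
Lemma submodD x y : P x -> P y -> P (x + y).
Proof. by move=> Px Py; rewrite -[x]scale1r; apply: submodP. Qed.
Lemma submodZ a x : P x -> P (a *: x).
Proof. by move=> Px; rewrite -[_ *: _]addr0; apply/submodP/submod0. Qed.
Lemma submodN x : P x -> P (- x).
Proof. by move=> Px; rewrite -scaleN1r; apply: submodZ. Qed.
Lemma submodB x y : P x -> P y -> P (x - y).
Proof. by move=> Px Py; apply/submodD/submodN. Qed.
Lemma submod_sum (I : finType) (f : I -> V) : (forall i, P (f i)) -> P (\sum_i f i).
Proof. by move=> Pf; apply: big_ind => //; [apply: submod0 | apply: submodD]. Qed.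
End Submodules.

Lemma submoduleI (A : comNzRingType) (V : lmodType A) (P Q : V -> Prop) :
  submodule P -> submodule Q -> submodule (fun x => P x /\ Q x).
Proof.
move=> sP sQ; split; first by split; apply: submod0.
by move=> a x y [Px Qx] [Py Qy]; split; apply: submodP.
Qed.

Section Spans.
Variables (A : comNzRingType) (V : lmodType A).
Implicit Types (s : seq V).

Fixpoint lspan s : V -> Prop :=
  if s is e :: s' then fun x => exists c, exists2 y, lspan s' y & x = c *: e + y
  else fun x => x = 0.

Lemma lspan_sub s : submodule (lspan s).
Proof.
elim: s => [|e s [s0 sD]]; first by split=> // a x y -> ->; rewrite scaler0 addr0.
split; first by exists 0, 0 => //; rewrite scale0r addr0.
move=> a x y [c [x' sx' ->]] [c' [y' sy' ->]].
exists (a * c + c'), (a *: x' + y'); first exact: sD.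
by rewrite scalerDr scalerA scalerDl addrACA.
Qed.

Lemma lspan_tail e s x : lspan s x -> lspan (e :: s) x.
Proof. by move=> sx; exists 0, x; rewrite // scale0r add0r. Qed.

Lemma lspan_head e s : lspan (e :: s) e.
Proof. by exists 1, 0; [apply: submod0 (lspan_sub s) | rewrite scale1r addr0]. Qed.

Lemma lspan_mem s x : x \in s -> lspan s x.
Proof.
elim: s => // e s IH; rewrite inE => /predU1P[-> | /IH]; first exact: lspan_head.
exact: lspan_tail.
Qed.

Lemma lspan_min s (P : V -> Prop) : submodule P ->
  (forall x, x \in s -> P x) -> forall x, lspan s x -> P x.
Proof.
move=> subP; elim: s => [|e s IH] sP x; first by move=> ->; apply: submod0.
move=> [c [y sy ->]]; apply: submodP => //; first by apply: sP; rewrite mem_head.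
by apply: IH => // z zs; apply: sP; rewrite inE zs orbT.
Qed.

Lemma lspan_sum s x : (exists c : 'I_(size s) -> A, x = \sum_(i < size s) c i *: s`_i) ->
  lspan s x.
Proof.
move=> [c ->]; apply: (submod_sum (lspan_sub s)) => i.
exact/(submodZ (lspan_sub s))/lspan_mem/mem_nth.
Qed.

Lemma lspan_row s : exists n (p : {linear 'rV[A]_n -> V}),
  forall x, lspan s x <-> exists w, p w = x.
Proof.
exists (size s), (row_hom (fun i : 'I_(size s) => s`_i)) => x; split.
  elim: s x => [|e s IH] x /=; first by move=> ->; exists 0; rewrite big_ord0.
  move=> [c [_ /IH[w <-] ->]]; exists (row_mx (c%:M : 'rV_1) w).
  rewrite (big_ord_recl (size s)) /=; congr (_ *: _ + _).
    transitivity (row_mx (c%:M : 'rV_1) w 0 (lshift (size s) (ord0 : 'I_1))).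
      by congr (_ 0 _); apply: val_inj.
    by rewrite row_mxEl mxE eqxx mulr1n.
  apply: eq_bigr => i _ /=; congr (_ *: _).
  transitivity (row_mx (c%:M : 'rV_1) w 0 (rshift 1 i)); last exact: row_mxEr.
  by congr (_ 0 _); apply: val_inj.
by move=> [w <-]; apply: lspan_sum; exists (w 0).
Qed.
End Spans.

Section Ideals.
Variable R : comNzRingType.
Implicit Types (a p q : R -> Prop).

Definition ideal a : Prop := submodule (a : R^o -> Prop).
Definition is_prime a : Prop :=
  [/\ ideal a, ~ a 1 & forall x y, a (x * y) -> a x \/ a y].

Lemma ideal_mulr a x y : ideal a -> a x -> a (x * y).
Proof. by move=> ia ax; rewrite mulrC; apply: (submodZ ia). Qed.
Lemma ideal_mull a x y : ideal a -> a y -> a (x * y).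
Proof. by move=> ia ax; apply: (submodZ ia). Qed.

Lemma idealr_of a : ideal a -> ~ a 1 -> exists I : idealr R, forall x, x \in I <-> a x.
Proof.
move=> ia a1.
have aE x : x \in (fun x => `[<a x>] : bool) <-> a x by rewrite unfold_in; split=> /asboolP.
have cl : idealr_closed (fun x => `[<a x>] : bool).
  split; first by apply/aE; apply: submod0 ia.
  - by apply/negP => /aE.
  - by move=> c u v /aE au /aE av; apply/aE/(submodP ia).
pose I : idealr R := HB.pack (fun x => `[<a x>] : bool) (isIdealr.Build R _ cl).
by exists I.
Qed.

Lemma prime_idealr_of a : is_prime a ->
  exists I : prime_idealr R, forall x, x \in I <-> a x.
Proof.
move=> [ia a1 aM].
have aE x : x \in (fun x => `[<a x>] : bool) <-> a x by rewrite unfold_in; split=> /asboolP.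
have cl : idealr_closed (fun x => `[<a x>] : bool).
  split; first by apply/aE; apply: submod0 ia.
  - by apply/negP => /aE.
  - by move=> c u v /aE au /aE av; apply/aE/(submodP ia).
have pcl : prime_idealr_closed (fun x => `[<a x>] : bool).
  by move=> u v /aE /aM[] /aE ->; rewrite ?orbT.
pose I : prime_idealr R := HB.pack (fun x => `[<a x>] : bool)
  (isIdealr.Build R _ cl) (isPrimeIdealrClosed.Build R _ pcl).
by exists I.
Qed.

Lemma ideal_mem (I : idealr R) : ideal (fun x => x \in I).
Proof.
split; first exact: rpred0.
by move=> c x y xI yI; rewrite rpredD // -[_ *: _]/(c * x) idealMr.
Qed.

Lemma prime_mem (I : prime_idealr R) : is_prime (fun x => x \in I).
Proof.
split; first exact: ideal_mem; first by rewrite idealr1.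
by move=> x y; rewrite prime_idealrM => /orP.
Qed.

Hypothesis noeth : noetherian_ring R.

Lemma ideal_fg a : ideal a -> exists s : seq R^o, forall x, a x <-> lspan s x.
Proof.
move=> ia; have [a1|a1] := pselect (a 1).
  exists [:: (1 : R^o)] => x; split=> [_|[c [_ -> ->]]].
    by exists x, 0; rewrite // addr0 -[_ *: _]/(x * 1) mulr1.
  by rewrite addr0; apply: (submodZ ia).
have [I IE] := idealr_of ia a1.
have [s sI sE] := noeth I; exists s => x; split.
  by move=> /IE /sE[c xE]; apply: lspan_sum; exists c.
by apply: lspan_min => // y ys; apply/IE/sI.
Qed.

(** Otherwise there is an infinite strictly increasing sequence of
    counterexamples; but their union is a finitely generated ideal. *)
Lemma noeth_ind (Phi : (R -> Prop) -> Prop) :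
  (forall a, ideal a ->
     (forall b, ideal b -> (forall x, a x -> b x) -> (exists2 x, b x & ~ a x) -> Phi b) ->
     Phi a) ->
  forall a, ideal a -> Phi a.
Proof.
move=> step a0 ia0; apply: contrapT => nPhi.
have [||f [f0 fP fr]] := @dependent_choice _ (fun a => ideal a /\ ~ Phi a)
  (fun a b => (forall x, a x -> b x) /\ exists2 x, b x & ~ a x) a0.
- by split.
- move=> a [ia na]; apply: contrapT => H; apply/na/step => // b ib ab ba.
  by apply: contrapT => nb; apply: H; exists b.
have mono m n : (m <= n)%N -> forall x, f m x -> f n x.
  move=> /subnKC <-; elim: (n - m)%N => [|k IH] x; rewrite ?addn0 // addnS.
  by move=> /IH; apply: (fr _).1.
pose u x := exists n, f n x.
have iu : ideal u.
  split; first by exists 0%N; apply: submod0 (fP 0%N).1.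
  move=> c x y [n fx] [n' fy]; exists (maxn n n').
  apply: submodP (fP _).1 _ _ _ _ _; first exact: mono (leq_maxl _ _) _ fx.
  exact: mono (leq_maxr _ _) _ fy.
have [s sE] := ideal_fg iu.
have [N fN] : exists N, forall x, x \in s -> f N x.
  have: forall x, x \in s -> u x by move=> x /lspan_mem /sE.
  elim: s {sE} => [|e s IH] H; first by exists 0%N.
  have [x xs|N NE] := IH; first by apply: H; rewrite inE xs orbT.
  have [N' N'E] := H e (mem_head _ _).
  exists (maxn N N') => x; rewrite inE => /predU1P[->|/NE fx].
    exact: mono (leq_maxr _ _) _ N'E.
  exact: mono (leq_maxl _ _) _ fx.
have [x fx] := (fr N).2; apply.
have /sE : u x by exists N.+1.
by apply: lspan_min => //; apply: (fP N).1.
Qed.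

(** Induction on the generators: the coefficients at [e] of the elements of [U]
    form an ideal, and finitely many elements of [U] realise all of them up to
    the span of the remaining generators. *)
Lemma fg_submodule (V : lmodType R) (s : seq V) (U : V -> Prop) :
  submodule U -> (forall x, U x -> lspan s x) ->
  exists t : seq V, forall x, U x <-> lspan t x.
Proof.
elim: s U => [|e s IH] U subU Us.
  by exists [::] => x; split=> [/Us|->] //; apply: submod0.
pose a c := exists2 y, lspan s y & U (c *: e + y).
have ia : ideal a.
  split; first by exists 0; rewrite ?scale0r ?addr0;
      [apply: submod0 (lspan_sub s) | apply: submod0].
  move=> c x y [x' sx' Ux] [y' sy' Uy]; exists (c *: x' + y').
    exact: (submodP (lspan_sub s)).
  rewrite -[c *: x + y]/(c * x + y) scalerDl addrACA -scalerA -scalerDr.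
  exact: submodP.
have [cs csE] := ideal_fg ia.
have [us usU usE] : exists2 us : seq V, forall x, lspan us x -> U x &
    forall c, lspan cs c -> exists2 y, lspan s y & lspan us (c *: e + y).
  have: forall c, lspan cs c -> a c by move=> c /csE.
  elim: cs {csE} => [|c0 cs IHc] csa.
    exists [::]; first by move=> x ->; apply: submod0.
    by move=> c ->; exists 0; rewrite ?scale0r ?addr0; [apply: submod0 (lspan_sub s)|].
  have [|us usU usE] := IHc; first by move=> c /(lspan_tail c0) /csa.
  have [y0 sy0 Uy0] := csa _ (lspan_head c0 cs).
  exists (c0 *: e + y0 :: us).
    by move=> _ [d [y /usU Uy ->]]; apply: submodP.
  move=> _ [d [c /usE[y sy uy] ->]]; exists (d *: y0 + y).
    exact: (submodP (lspan_sub s)).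
  exists d, (c *: e + y) => //.
  by rewrite -[d *: c0 + c]/(d * c0 + c) scalerDl -scalerA scalerDr addrACA.
have [t tE] := IH _ (submoduleI subU (lspan_sub s)) (fun x => @proj2 _ _).
exists (us ++ t) => x.
have lspan_catE z : lspan (us ++ t) z <-> exists y y', [/\ lspan us y, lspan t y' & z = y + y'].
  elim: us {usU usE} z => [|u us IHu] z /=.
    split=> [tz|[_ [y' [-> ty' ->]]]]; last by rewrite add0r.
    by exists 0, z; rewrite add0r.
  split=> [[c [_ /IHu[y [y' [uy ty' ->]]] ->]]|[_ [y' [[c [y uy ->]] ty' ->]]]].
    by exists (c *: u + y), y'; split=> //; [exists c, y | rewrite addrA].
  by exists c, (y + y'); [apply/IHu; exists y, y' | rewrite addrA].
rewrite lspan_catE; split=> [Ux|[y [y' [/usU Uy /tE[Uy' _] ->]]]]; last exact: submodD.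
have [c [y sy xE]] := Us x Ux.
have [|y' sy' uy'] := usE c; first by apply/csE; exists y; rewrite -?xE.
exists (c *: e + y'), (y - y'); split=> //; last by rewrite xE -addrA [y' + _]addrC subrK.
have -> : y - y' = x - (c *: e + y') by rewrite xE opprD addrACA subrr add0r.
apply/tE; split; first by apply: (submodB subU) => //; apply: usU.
by rewrite xE opprD addrACA subrr add0r; apply: (submodB (lspan_sub s)).
Qed.

End Ideals.

Section LocalRings.
Variable R : comNzRingType.

(** Such an [m] exists only in a local ring, and is its maximal ideal. *)
Definition nonunits (m : R -> Prop) : Prop :=
  [/\ ideal m, ~ m 1 & forall x, ~ m x -> exists y, y * x = 1].

(** By noetherian induction a proper ideal lies in a maximal ideal, so a non-unit
    lies in the only one. *)
Lemma local_nonunits : noetherian_ring R -> local_ring R -> exists m : R ->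
    Prop, nonunits m.
Proof.
move=> noeth [m0 max0 uniq0].
exists (fun x => x \in m0); split; first exact: ideal_mem; first by rewrite idealr1.
move=> x mx; pose a z := exists y, y * x = z.
have ia : ideal a.
  split; first by exists 0; rewrite mul0r.
  by move=> c _ _ [y <-] [y' <-]; exists (c * y + y'); rewrite mulrDl -mulrA.
apply: contrapT => a1.
have proper_sub b : ideal b -> ~ b 1 -> forall z, b z -> z \in m0.
  move: b; apply: (noeth_ind noeth) => b ib IH b1 z bz.
  have [[c [ic c1 bc [y cy nby]]]|H] := pselect (exists c, [/\ ideal c, ~ c 1,
      forall x, b x -> c x & exists2 y, c y & ~ b y]).
    by apply: (IH c) => //; [exists y | apply: bc].
  have [I IE] := idealr_of ib b1.
  rewrite -(uniq0 I); first exact/IE.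
  move=> J IJ y yJ; apply/IE; apply: contrapT => nby; apply: H.
  exists (fun z => z \in J); split; [exact: ideal_mem|by rewrite idealr1| |by exists y].
  by move=> w /IE; apply: IJ.
by apply/mx/(proper_sub a) => //; exists 1; rewrite mul1r.
Qed.

Variable m : R -> Prop.
Hypothesis m_loc : nonunits m.
Lemma nonunits_ideal : ideal m. Proof. by case: m_loc. Qed.

Lemma proper_nonunits (a : R -> Prop) : ideal a -> ~ a 1 -> forall x, a x -> m x.
Proof.
move=> ia a1 x ax; apply: contrapT => mx; have [_ _ m_unit] := m_loc.
by have [y yx] := m_unit x mx; apply: a1; rewrite -yx; apply: ideal_mull.
Qed.

Lemma nonunits_prime : is_prime m.
Proof.
have [im m1 m_unit] := m_loc; split=> // x y mxy.
have [mx|/m_unit[z zx]] := pselect (m x); first by left.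
by right; rewrite -[y]mul1r -zx -mulrA; apply: ideal_mull.
Qed.

(** With as few generators as possible no relation has a unit coefficient, as it
    would express one generator by the others. *)
Lemma minimal_cover (V : lmodType R) (s : seq V) :
  exists n (p : {linear 'rV[R]_n -> V}),
    (forall x, lspan s x <-> exists w, p w = x) /\
    forall w, p w = 0 -> forall j, m (w 0 j).
Proof.
have ex : exists n, `[<exists p : {linear 'rV[R]_n -> V},
    forall x, lspan s x <-> exists w, p w = x>].
  by have [n [p pE]] := lspan_row s; exists n; apply/asboolP; exists p.
case: (ex_minnP ex) => n /asboolP[p pE] n_min.
exists n, p; split=> // w pw0 j; have [_ _ m_unit] := m_loc.
apply: contrapT => /m_unit[u uw].
case: n p pE n_min w j u pw0 uw => [|n] p pE n_min w j u pw0 uw; first by case: j uw.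
suff /n_min : `[<exists q : {linear 'rV[R]_n -> V},
    forall x, lspan s x <-> exists w, q w = x>] by rewrite ltnn.
apply/asboolP; pose q := row_hom (fun i : 'I_n => p (delta_mx 0 (fintype.lift j i)));
    exists q.
have qp v : q v = p (\row_i (if unlift j i is Some i' then v 0 i' else 0)).
  rewrite [RHS]row_homE (bigD1_ord j) //= mxE unlift_none scale0r add0r.
  by apply: eq_bigr => i _; rewrite mxE liftK.
move=> x; rewrite pE; split=> [[v <-]|[v <-]]; last by rewrite qp; eexists.
exists (\row_i (v - (v 0 j * u) *: w) 0 (fintype.lift j i)); rewrite qp.
rewrite -[p v]subr0 -(scaler0 _ (v 0 j * u)) -pw0 -linearZ -linearB; congr (p _).
apply/rowP => i; rewrite !mxE; case: unliftP => [i' ->|->]; first by rewrite !mxE.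
by rewrite -mulrA uw mulr1 subrr.
Qed.

Hypothesis noeth : noetherian_ring R.

(** The ranks of a resolution with prescribed rank [g] in degree 0; the first map
    then lands in row vectors of length [g] by computation. *)
Definition extend_rank (g : nat) (b : nat -> nat) (i : nat) : nat :=
  if i is i'.+1 then b i' else g.

Lemma minimal_resolution (g : nat) (U : 'rV[R]_g -> Prop) : submodule U ->
  exists (b : nat -> nat) (d : forall i, {linear 'rV[R]_(extend_rank g b i.+1) ->
                                           'rV[R]_(extend_rank g b i)}),
  [/\ forall x, U x <-> exists w, d 0%N w = x,
      forall i x, d i x = 0 <-> exists y, d i.+1 y = x
    & forall i x, d i x = 0 -> forall j, m (x 0 j)].
Proof.
move=> subU.
pose T := {g : nat & 'rV[R]_g -> Prop}.
pose good (x : T) (y : {h : nat & {linear 'rV[R]_h -> 'rV[R]_(projT1 x)}}) :=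
  submodule (projT2 x) -> (forall v, projT2 x v <-> exists w, projT2 y w = v) /\
    forall w, projT2 y w = 0 -> forall j, m (w 0 j).
have cov_ex x : exists y, good x y.
  case: x => h W; rewrite /good /=.
  have [sW|nW] := pselect (submodule W); last first.
    by exists (existT _ 0%N (\0 : {linear 'rV[R]_0 -> 'rV[R]_h})) => /nW.
  have [t tE] : exists t, forall x, W x <-> lspan t x.
    apply: (fg_submodule noeth (s := [seq delta_mx 0 i | i <- enum 'I_h])) => // x _.
    rewrite [x]row_sum_delta; apply: (submod_sum (lspan_sub _)) => i.
    by apply/(submodZ (lspan_sub _))/lspan_mem/map_f; rewrite mem_enum.
  have [n [p [pE p_min]]] := minimal_cover t.
  by exists (existT _ n p) => _; split=> //= v; rewrite tE pE.
pose cov x := sval (cid (cov_ex x)).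
have covE x : good x (cov x) := svalP (cid (cov_ex x)).
pose next (x : T) : T := existT _ (projT1 (cov x)) (fun w => projT2 (cov x) w = 0).
pose st i := iter i next (existT _ g U).
have st_sub i : submodule (projT2 (st i)).
  case: i => [|i] //=; split; first by rewrite linear0.
  by move=> a x y; rewrite linearP => -> ->; rewrite scaler0 addr0.
pose b i := projT1 (st i.+1).
pose d i : {linear 'rV[R]_(extend_rank g b i.+1) -> 'rV[R]_(extend_rank g b i)} :=
  match i with
  | 0 => projT2 (cov (st 0%N))
  | i'.+1 => projT2 (cov (st i'.+1))
  end.
exists b, d; split.
- exact: (covE (st 0%N) (st_sub 0%N)).1.
- case=> [|i]; first exact: (covE (st 1%N) (st_sub 1%N)).1.
  exact: (covE (st i.+2) (st_sub i.+2)).1.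
- case=> [|i]; first exact: (covE (st 0%N) (st_sub 0%N)).2.
  exact: (covE (st i.+1) (st_sub i.+1)).2.
Qed.
End LocalRings.

(** * Devissage and Nakayama's lemma *)

Section IdealOperations.
Variable S : comNzRingType.
Implicit Types (a p q : S -> Prop).

Definition colon a (x : S) : S -> Prop := fun c => a (c * x).
Definition adjoin a (x : S) : S -> Prop :=
    fun z => exists c, exists2 y, a y & z = y + c * x.

Lemma colon_ideal a x : ideal a -> ideal (colon a x).
Proof.
move=> ia; split; first by rewrite /colon mul0r; apply: submod0 ia.
move=> c y z ay az; rewrite /colon -[c *: y]/(c * y) mulrDl -mulrA.
exact: (submodP ia).
Qed.

Lemma adjoin_ideal a x : ideal a -> ideal (adjoin a x).
Proof.
move=> ia; split; first by exists 0, 0; rewrite ?mul0r ?addr0 //; apply: submod0 ia.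
move=> e _ _ [c [y ay ->]] [c' [y' ay' ->]].
exists (e * c + c'), (e * y + y'); first exact: (submodP ia).
by rewrite -[e *: _]/(e * _) mulrDr mulrA mulrDl addrACA.
Qed.

Lemma sub_colon a x z : ideal a -> a z -> colon a x z.
Proof. by move=> ia az; apply: ideal_mulr. Qed.

Lemma sub_adjoin a x z : a z -> adjoin a x z.
Proof. by move=> az; exists 0, z; rewrite ?mul0r ?addr0. Qed.

Lemma mem_adjoin a x : ideal a -> adjoin a x x.
Proof. by move=> ia; exists 1, 0; rewrite ?mul1r ?add0r //; apply: submod0 ia. Qed.

(** Noetherian induction along 0 -> S/(a : x) -> S/a -> S/(a + x) -> 0: if [x y] is
    in [a] but [x] and [y] are not, both outer ideals are larger than [a]. *)
Lemma devissage (Phi : (S -> Prop) -> Prop) : noetherian_ring S ->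
  (forall a, ideal a -> a 1 -> Phi a) ->
  (forall a x, ideal a -> Phi (colon a x) -> Phi (adjoin a x) -> Phi a) ->
  (forall p, is_prime p ->
    (forall x, ~ p x -> Phi (adjoin p x)) -> Phi p) ->
  forall a, ideal a -> Phi a.
Proof.
move=> noeth unit_ mid_ prime_; apply: (noeth_ind noeth) => a ia IH.
have adj x : ~ a x -> Phi (adjoin a x).
  move=> ax; apply: IH; [exact: adjoin_ideal | exact: sub_adjoin |].
  by exists x => //; apply: mem_adjoin.
have [a1|a1] := pselect (a 1); first exact: unit_.
have [aP|H] := pselect (forall x y, a (x * y) -> a x \/ a y); first exact: prime_.
have [x [y [axy ax ay]]] : exists x y, [/\ a (x * y), ~ a x & ~ a y].
  apply: contrapT => N; apply: H => x y axy; apply: contrapT => H.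
  by apply: N; exists x, y; split=> // ?; apply: H; [left|right].
apply: (mid_ a x) => //; last exact: adj.
apply: IH; [exact: colon_ideal | by move=> z; apply: sub_colon |].
by exists y; rewrite // /colon mulrC.
Qed.

(** Nakayama's lemma localised at [q], for a module given by generators modulo
    [B]. The generators are eliminated one at a time: [v e = x (c e + z)] becomes
    [(v - x c) e = x z], where [v - x c] is again outside [q]. *)
Lemma nakayama (V : lmodType S) (B : V -> Prop) q x : is_prime q -> q x -> submodule B ->
  forall (s : seq V) (v : S), ~ q v ->
  (forall y, y \in s -> exists2 z, lspan s z & B (v *: y - x *: z)) ->
  exists2 v', ~ q v' & forall y, lspan s y -> B (v' *: y).
Proof.
move=> [iq q1 qM] qx sB; elim=> [|e s IH] v qv H.
  by exists 1 => // y ->; rewrite scaler0; apply: submod0.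
have [_ [c [z sz ->]] Be] := H e (mem_head _ _).
pose w := v - x * c.
have qw : ~ q w.
  by move=> qw; apply: qv; rewrite -[v](subrK (x * c)); apply: (submodD iq qw); apply:
      ideal_mulr.
have {}Be : B (w *: e - x *: z).
  by move: Be; rewrite /w scalerBl -scalerA scalerDr opprD addrA.
have qwv : ~ q (w * v) by move=> /qM[].
have [|v' qv' v'E] := IH _ qwv.
  move=> y ys; have [|_ [c' [z' sz' ->]] By] := H y; first by rewrite inE ys orbT.
  exists ((c' * x) *: z + w *: z').
    by apply: (submodP (lspan_sub s)) => //; apply: (submodZ (lspan_sub s)).
  have -> : (w * v) *: y - x *: ((c' * x) *: z + w *: z') =
      w *: (v *: y - x *: (c' *: e + z')) + (x * c') *: (w *: e - x *: z).
    have shuffle (a b c0 d : V) : a - (b + c0) = (a - (d + c0)) + (d - b).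
      by rewrite [RHS]addrACA -opprD -[d + _ + _]addrA [- (d + _)]opprD addrA addrK [c0 + b]addrC.
    rewrite !scalerBr !scalerDr !scalerA (shuffle _ _ _ ((w * (x * c')) *: e)).
    by congr (_ - (_ *: _ + _ *: _) + (_ *: _ - _ *: _)); ring.
  by apply: (submodD sB); apply: (submodZ sB).
exists (v' * w); first by move=> /qM[].
move=> y [d [t st ->]]; rewrite scalerDr; apply: (submodD sB); last first.
  by rewrite mulrC -scalerA; apply: (submodZ sB); apply: v'E.
rewrite scalerA mulrC -scalerA; apply: (submodZ sB).
rewrite -scalerA -[w *: e](subrK (x *: z)) scalerDr; apply: (submodD sB).
  exact: (submodZ sB).
by rewrite scalerA mulrC -scalerA; apply: (submodZ sB); apply: v'E.
Qed.
End IdealOperations.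

(** * Ext in a complex of injective modules *)

Section InjectiveComplex.
Variables (S : comNzRingType) (I : nat -> lmodType S).
Variable delta : forall k, {linear I k -> I k.+1}.
Hypothesis injI : forall k, injective_module (I k).
Hypothesis deltaK : forall k x, delta k.+1 (delta k x) = 0.
Implicit Types (a p q : S -> Prop).

(** The zero module stands before degree 0, so that coboundaries of degree 0 need
    no separate treatment. *)
Definition prev k : lmodType S := if k is k'.+1 then I k' else ('rV[S]_0 : lmodType S).
Definition dprev k : {linear prev k -> I k} :=
  match k with 0 => \0 | k'.+1 => delta k' end.

Lemma injective_prev k : injective_module (prev k).
Proof. by case: k => [|k]; [exact: injective_zero | exact: injI]. Qed.

Lemma delta_dprev k x : delta k (dprev k x) = 0.
Proof. by case: k x => [|k] x; [exact: linear0 | exact: deltaK]. Qed.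

Definition kills (V : lmodType S) a (y : V) : Prop := forall c, a c -> c *: y = 0.

Lemma kills_submodule (V : lmodType S) a : submodule (@kills V a).
Proof.
split=> [c _|c x y ax ay e ae]; first by rewrite scaler0.
by rewrite scalerDr scalerA mulrC -scalerA ax // ay // scaler0 addr0.
Qed.

Definition cocycle a k (y : I k) : Prop := kills a y /\ delta k y = 0.
Definition coboundary a k (y : I k) : Prop :=
  exists2 w : prev k, kills a w & dprev k w = y.

(** If [I] is an injective resolution of [S], then [v] annihilates
    [Ext^k(S/a, S)], represented by the elements of [I k] killed by [a]. *)
Definition Ext_killed v a k : Prop := forall y : I k, cocycle a y -> coboundary a (v *: y).

Lemma coboundary_submodule a k : submodule (@coboundary a k).
Proof.
have sk := @kills_submodule (prev k) a.
split; first by exists 0; [apply: submod0 sk | rewrite linear0].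
move=> c _ _ [w aw <-] [w' aw' <-]; exists (c *: w + w'); first exact: (submodP sk).
by rewrite linearP.
Qed.

Lemma kills_sub (V : lmodType S) a b (y : V) :
  (forall x, b x -> a x) -> kills a y -> kills b y.
Proof. by move=> ba ay c /ba /ay. Qed.

Lemma Ext_killed_ext v a b k :
  (forall x, a x <-> b x) -> Ext_killed v a k -> Ext_killed v b k.
Proof.
move=> ab kv y [by_ dy]; have [|w aw wE] := kv y.
  by split=> // c /ab /by_.
by exists w => // c /ab /aw.
Qed.

Lemma Ext_killed_mem v a k : a v -> Ext_killed v a k.
Proof.
by move=> av y [ay _]; rewrite ay //; apply: submod0 (coboundary_submodule a k).
Qed.

(** [y] defines a map on the ideal [a + x S] that is zero on [a] and sends [x] to
    [y]; [z] is the value at 1 of an extension to [S]. *)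
Lemma kills_divide (V : lmodType S) a x (y : V) : injective_module V -> ideal a ->
  kills (colon a x) y -> exists2 z, kills a z & x *: z = y.
Proof.
move=> injV ia ky.
have [||h hE] := @inj_rel S S^o V
    (fun u t => exists c e, [/\ a e, u = e + c * x & t = c *: y]) injV.
- split; first by exists 0, 0; rewrite mul0r scale0r addr0; split=> //; apply: submod0 ia.
  move=> b _ _ _ _ [c [e [ae -> ->]]] [c' [e' [ae' -> ->]]].
  exists (b * c + c'), (b * e + e'); split; first exact: (submodP ia).
    by rewrite -[b *: (_ : S^o)]/(b * _) mulrDr mulrDl mulrA addrACA.
  by rewrite scalerA scalerDl.
- move=> t [c [e [ae /esym/eqP]]]; rewrite addr_eq0 => /eqP eE ->; apply: ky.
  by rewrite /colon -[c * x]opprK -eE; apply: (submodN ia).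
have h1 u : h u = u *: h 1 by rewrite -linearZ -[_ *: _]/(u * 1) mulr1.
exists (h 1) => [e ae|]; rewrite -h1; apply: hE.
  by exists 0, e; rewrite mul0r addr0 scale0r.
by exists 1, 0; rewrite mul1r add0r scale1r; split=> //; apply: submod0 ia.
Qed.

(** Exactness of [Ext^k] in the middle of
    0 -> S/(a : x) -> S/a -> S/(a + x) -> 0. *)
Lemma Ext_killed_mid v v' a x k : ideal a ->
  Ext_killed v (colon a x) k -> Ext_killed v' (adjoin a x) k -> Ext_killed (v' * v) a k.
Proof.
move=> ia kv kv' y [ay dy].
have [|w kw wE] := kv (x *: y).
  by split; [move=> c ac; rewrite scalerA ay | rewrite linearZ /= dy scaler0].
have [z az xz] := kills_divide (@injective_prev k) ia kw.
have [|w' kw' w'E] := kv' (v *: y - dprev k z).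
  split; last by rewrite linearB linearZ /= dy scaler0 delta_dprev subrr.
  have adz : kills a (dprev k z) by move=> e ae; rewrite -linearZ /= az // linear0.
  have sa := @kills_submodule (I k) a.
  move=> _ [c [e ae ->]]; rewrite scalerDl (submodB sa (submodZ sa v ay) adz) // add0r.
  rewrite -scalerA scalerBr -[x *: dprev k z]linearZ /= xz wE.
  by rewrite !scalerA [x * v]mulrC subrr scaler0.
exists (w' + v' *: z).
  apply: (submodD (kills_submodule _ _)); last exact: (submodZ (kills_submodule _ _)).
  by apply: kills_sub kw' => c; apply: sub_adjoin.
by rewrite linearD linearZ /= w'E scalerBr subrK scalerA.
Qed.

(** Part of the long exact sequence of multiplication by [x] on [S/p]: dividing [y]
    by [x] in the injective module [I k] gives an element whose differential is a
    cocycle for [p + x], to which the hypothesis on [u] applies. *)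
Lemma Ext_killed_divide u p x k (y : I k) : is_prime p -> ~ p x ->
  Ext_killed u (adjoin p x) k.+1 -> cocycle p y ->
  exists2 z, cocycle p z & u *: y = x *: z.
Proof.
move=> [ip _ pM] px ku [py dy].
have [|z pz xz] := kills_divide (@injI k) ip (y := y) (x := x).
  by move=> c /pM[/py|].
have [|w kw wE] := ku (delta k z).
  split; last exact: deltaK.
  move=> _ [c [e pe ->]]; rewrite -linearZ /= scalerDl pz // add0r -scalerA xz.
  by rewrite linearZ /= dy scaler0.
exists (u *: z - w).
  split; last by rewrite linearB linearZ /= wE subrr.
  apply: (submodB (kills_submodule _ _)); first exact: (submodZ (kills_submodule _ _)).
  by apply: kills_sub kw => c; apply: sub_adjoin.
rewrite scalerBr [x *: w]kw ?subr0; last exact: mem_adjoin.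
by rewrite scalerA mulrC -scalerA xz.
Qed.

(** Finite generation of [Ext^k(S/a, S)]. *)
Definition fg_ext a k : Prop := exists2 s : seq (I k), (forall y, y \in s -> cocycle a y) &
  forall y : I k, cocycle a y -> exists2 z, lspan s z & coboundary a (y - z).

(** For [E = Ext^k(S/p, S)] the previous lemma gives that [u E] lies in [x E], and
    Nakayama's lemma at [q] applies. *)
Lemma Ext_killed_prime_step u p q x k : is_prime p -> is_prime q -> q x -> ~ p x -> ~ q u ->
  fg_ext p k -> Ext_killed u (adjoin p x) k.+1 -> exists2 v, ~ q v & Ext_killed v p k.
Proof.
move=> pp pq qx px qu [s sZ sE] ku.
have sB := coboundary_submodule p k.
have [y ys|v qv vE] := nakayama pq qx sB (s := s) qu.
  have [z zZ uyz] := Ext_killed_divide pp px ku (sZ y ys).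
  have [t st Bt] := sE z zZ; exists t => //.
  by rewrite uyz -scalerBr; apply: (submodZ sB).
exists v => // y yZ; have [z sz Bz] := sE y yZ.
rewrite -[y](subrK z) scalerDr; apply: (submodD sB); last exact: vE.
exact: (submodZ sB).
Qed.

(** ** Modules given as quotients *)
Section Relative.
Variables (P : lmodType S) (U : P -> Prop).

Definition rel_closed k (phi : {linear P -> I k}) : Prop :=
  (forall x, delta k (phi x) = 0) /\ forall u, U u -> phi u = 0.
Definition rel_boundary k (phi : {linear P -> I k}) : Prop :=
  exists2 chi : {linear P -> prev k}, (forall u, U u -> chi u = 0) &
    forall x, dprev k (chi x) = phi x.

(** [Ext^k(P/U, S) = 0]. *)
Definition rel_vanish k : Prop := forall phi : {linear P -> I k},
  rel_closed phi -> rel_boundary phi.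

(** Adding one generator at a time filters [P/U] with cyclic quotients; [chi] is
    corrected on each new generator. *)
Lemma rel_vanish_fg (s : seq P) k : submodule U -> (forall x, lspan s x) ->
  (forall a, ideal a -> (forall c, (forall x, U (c *: x)) -> a c) -> Ext_killed 1 a k) ->
  rel_vanish k.
Proof.
move=> sU sP Hk phi [dphi Uphi].
suff [chi Uchi chiE] : exists2 chi : {linear P -> prev k}, (forall u, U u -> chi u = 0) &
    forall x, lspan s x -> dprev k (chi x) = phi x.
  by exists chi => // x; apply: chiE.
elim: s {sP} => [|e s [chi Uchi chiE]].
  by exists (\0 : {linear P -> prev k}) => // x ->; rewrite !linear0.
pose N x := exists u, exists2 t, U u & lspan s t /\ x = u + t.
have sN : submodule N.
  split; first by exists 0, 0;
      [apply: submod0 sU|split; [apply: submod0 (lspan_sub s)|rewrite addr0]].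
  move=> c _ _ [u [t Uu [st ->]]] [u' [t' Uu' [st' ->]]].
  exists (c *: u + u'), (c *: t + t'); first exact: (submodP sU).
  by split; [exact: (submodP (lspan_sub s)) | rewrite scalerDr addrACA].
pose phi' : {linear P -> I k} := phi \- (dprev k \o chi).
have phi'N x : N x -> phi' x = 0.
  move=> [u [t Uu [st ->]]]; rewrite linearD /= Uphi // Uchi // linear0 chiE //.
  by rewrite !subrr addr0.
pose a c := N (c *: e).
have ia : ideal a.
  split; first by rewrite /a scale0r; apply: submod0 sN.
  by move=> c x y ax ay; rewrite /a scalerDl -scalerA; apply: (submodP sN).
have [||w aw wE] := Hk a ia _ (phi' e).
- move=> c cU; exists (c *: e), 0; first exact: cU.
  by split; [apply: submod0 (lspan_sub s) | rewrite addr0].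
- split; first by move=> c /phi'N; rewrite linearZ.
  by rewrite /= linearB /= dphi delta_dprev subrr.
rewrite scale1r in wE.
have [||chi' chi'E] := @inj_rel S P (prev k)
   (fun v t => exists c z, [/\ N z, v = z + c *: e & t = c *: w]) (@injective_prev k).
- split; first by exists 0, 0; rewrite !scale0r addr0; split=> //; apply: submod0 sN.
  move=> b _ _ _ _ [c [z [Nz -> ->]]] [c' [z' [Nz' -> ->]]].
  exists (b * c + c'), (b *: z + z'); split; first exact: (submodP sN).
    by rewrite scalerDr scalerA scalerDl addrACA.
  by rewrite scalerA scalerDl.
- move=> t [c [z [Nz /esym/eqP]]]; rewrite addr_eq0 => /eqP zE ->; apply: aw.
  by rewrite /a -[c *: e]opprK -zE; apply: (submodN sN).
have chi'N z : N z -> chi' z = 0.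
  by move=> Nz; apply: chi'E; exists 0, z; rewrite !scale0r addr0.
exists (chi \+ chi') => [u Uu|x [c [y sy ->]]] /=.
  rewrite Uchi // chi'N ?addr0 //; exists u, 0 => //.
  by split; [apply: submod0 (lspan_sub s) | rewrite addr0].
have Ny : N y by exists 0, y; [apply: submod0 sU | rewrite add0r].
have chi'e : chi' e = w.
  by apply: chi'E; exists 1, 0; rewrite add0r !scale1r; split=> //; apply: submod0 sN.
have chi'x : chi' (c *: e + y) = c *: w by rewrite linearD linearZ /= chi'e chi'N ?addr0.
rewrite /= linearD /= chi'x linearZ /= wE /= scalerBr !linearP /= (chiE y sy).
by rewrite [LHS]addrC subrKA.
Qed.
End Relative.

(** ** Vanishing over a noetherian local ring *)
Hypothesis noeth : noetherian_ring S.
Variable m : S -> Prop.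
Hypothesis m_loc : nonunits m.
Hypothesis fgI : forall a k, ideal a -> fg_ext a k.

Lemma Ext_killed_unit u a k : ~ m u -> Ext_killed u a k -> Ext_killed 1 a k.
Proof.
have [_ _ m_unit] := m_loc; move=> /m_unit[v vu] ku y /ku.
rewrite -vu -scalerA; exact: (submodZ (coboundary_submodule a k)).
Qed.

Lemma not_mem_nonunits p : is_prime p -> ~ (forall x, p x <-> m x) ->
  exists2 x, m x & ~ p x.
Proof.
move=> [ip p1 _] pm; apply: contrapT => H; apply: pm => x; split.
  exact: (proper_nonunits m_loc ip p1).
by move=> mx; apply: contrapT => px; apply: H; exists x.
Qed.

(** At a prime [p] other than [m], multiplication by an element of [m] outside [p]
    is onto on [Ext^i(S/p, S)] since [Ext^(i+1)] vanishes for larger ideals. *)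
Lemma Ext_killed_above n : (forall i, (n < i)%N -> Ext_killed 1 m i) ->
  forall a, ideal a -> forall i, (n < i)%N -> Ext_killed 1 a i.
Proof.
move=> Hm; apply: (devissage noeth) => [a ia a1 i _|a x ia H1 H2 i ni|p pp IH i ni].
- exact: Ext_killed_mem.
- by rewrite -[1]mulr1; apply: (Ext_killed_mid (x := x) ia); [exact: H1 | exact: H2].
have [pm|/(not_mem_nonunits pp)[x mx px]] := pselect (forall x, p x <-> m x).
  by apply: Ext_killed_ext (Hm i ni) => x; split=> /pm.
have pm := nonunits_prime m_loc; have [_ m1 _] := pm.
have [ip _ _] := pp.
have [v mv kv] := Ext_killed_prime_step pp pm mx px m1 (fgI i ip) (IH x px _ (leqW ni)).
exact: Ext_killed_unit kv.
Qed.

(** Ischebeck's inequality. Passing from [p] to [p + x] lowers the dimension by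
    one and raises the degree of Ext by one. *)
Lemma Ext_killed_below s : (forall i, (i < s)%N -> Ext_killed 1 m i) ->
  forall a, ideal a -> forall i j, (i + j <= s)%N -> ~ prime_chain (fun x => `[<a x>]) i ->
  Ext_killed 1 a j.
Proof.
move=> Hm; apply: (devissage noeth) => [a ia a1 i j _ _|a x ia H1 H2 i j ij ch|p pp IH i j ij ch].
- exact: Ext_killed_mem.
- have sub b : (forall z, a z -> b z) -> ~ prime_chain (fun x => `[<b x>]) i.
    move=> ab [c [c0 cS]]; apply: ch; exists c; split=> // z /asboolP az.
    exact/c0/asboolP/ab.
  rewrite -[1]mulr1; apply: (Ext_killed_mid (x := x) ia).
    by apply: (H1 i j ij); apply: sub => z; apply: sub_colon.
  by apply: (H2 i j ij); apply: sub => z; apply: sub_adjoin.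
have [ip p1 pM] := pp; have [P PE] := prime_idealr_of pp.
case: i ij ch => [|i] ij ch.
  by case: ch; exists (fun=> P); split=> // x /asboolP px; apply/PE.
have [pm|/(not_mem_nonunits pp)[x mx px]] := pselect (forall x, p x <-> m x).
  apply: (@Ext_killed_ext 1 m) => [x|]; first by split=> /pm.
  by apply: Hm; apply: leq_trans ij; rewrite addSn ltnS leq_addl.
have pm := nonunits_prime m_loc; have [_ m1 _] := pm.
have [|v mv kv] := Ext_killed_prime_step pp pm mx px m1 (fgI j ip).
  apply: (IH x px i); first by rewrite addnS -addSn.
  move=> [c [c0 cS]]; apply: ch; exists (fun k => if k is k'.+1 then c k' else P).
  split=> [z /asboolP pz|]; first exact/PE.
  case=> [|k] ki; last exact: cS.
  split=> [z /PE pz|]; first by apply/c0/asboolP/sub_adjoin.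
  by exists x; [apply/c0/asboolP/mem_adjoin | apply/negP => /PE].
exact: Ext_killed_unit kv.
Qed.

End InjectiveComplex.

(** * Duals of free resolutions *)

Section Dual.
Variable S : comNzRingType.

Lemma dot_linear n (r : 'rV[S]_n) : linear (fun x : 'rV[S]_n => (x *m r^T) 0 0 : S^o).
Proof. by move=> a x y; rewrite mulmxDl -scalemxAl !mxE. Qed.
Definition dot n (r : 'rV[S]_n) : {linear 'rV[S]_n -> S^o} := linear_of (dot_linear r).
Lemma dotE n (r x : 'rV[S]_n) : dot r x = (x *m r^T) 0 0. Proof. by []. Qed.

Lemma dot_delta n (r : 'rV[S]_n) k : dot r (delta_mx 0 k) = r 0 k.
Proof. by rewrite dotE -rowE !mxE. Qed.

Lemma functionalE n (u : {linear 'rV[S]_n -> S^o}) :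
  exists r, forall x, u x = dot r x.
Proof.
exists (\row_k u (delta_mx 0 k)) => x.
by rewrite row_homE (row_homE (dot _) x); apply: eq_bigr => k _; rewrite dot_delta mxE.
Qed.

Lemma dot_mul n p (M : 'M[S]_(n, p)) (r : 'rV_p) x : dot (r *m M^T) x = dot r (x *m M).
Proof. by rewrite !dotE trmx_mul trmxK mulmxA. Qed.

Lemma dot_inj n (r r' : 'rV[S]_n) : (forall x, dot r x = dot r' x) -> r = r'.
Proof. by move=> H; apply/rowP => k; rewrite -!dot_delta H. Qed.
End Dual.

Section Homotopy.
Variables (A : comNzRingType) (F : nat -> lmodType A) (d : forall j, {linear F j.+1 -> F j}).
Hypothesis projF : forall j, projective (F j).
Hypothesis exact_d : forall j x, d j x = 0 <-> exists y, d j.+1 y = x.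
Variable gam : forall j, {linear F j -> F j}.
Hypothesis gamd : forall j x, gam j (d j x) = d j (gam j.+1 x).
Hypothesis gam0 : forall x, exists y, d 0%N y = gam 0%N x.

Lemma d_d j y : d j (d j.+1 y) = 0.
Proof. by apply/exact_d; exists y. Qed.

Lemma homotopy0 : exists h : {linear F 0%N -> F 1%N}, forall x, d 0%N (h x) = gam 0%N x.
Proof. by have [h hE] := projF gam0; exists h. Qed.

(** A chain map of a projective resolution that induces zero on the resolved
    module is null homotopic. *)
Lemma homotopyS j : exists (h : {linear F j -> F j.+1}) (h' : {linear F j.+1 -> F j.+2}),
  forall x, gam j.+1 x = d j.+1 (h' x) + h (d j x).
Proof.
have step i (h : {linear F i -> F i.+1}) : (forall x, d i (h (d i x)) = gam i (d i x)) ->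
    exists h' : {linear F i.+1 -> F i.+2}, forall x, gam i.+1 x = d i.+1 (h' x) + h (d i x).
  move=> hE; have [|h' h'E] := @projF i.+1 _ _ (d i.+1) (gam i.+1 \- (h \o d i)).
    by move=> x; apply/exact_d; rewrite linearB /= hE -gamd subrr.
  by exists h' => x; rewrite h'E /= subrK.
suff [h hE] : exists h : {linear F j -> F j.+1},
    forall x, d j (h (d j x)) = gam j (d j x).
  by have [h' h'E] := step _ _ hE; exists h, h'.
elim: j => [|j [h /step[h' h'E]]]; first by have [h hE] := homotopy0; exists h.
by exists h' => x; rewrite h'E d_d linear0 addr0.
Qed.
End Homotopy.

Section ExactComplex.
Variables (S : comNzRingType) (I : nat -> lmodType S).
Variable delta : forall k, {linear I k -> I k.+1}.
Hypothesis injI : forall k, injective_module (I k).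
Variable iota : {linear S^o -> I 0%N}.
Hypothesis iota_inj : injective iota.
Hypothesis ker0 : forall x, delta 0%N x = 0 <-> exists y, iota y = x.
Hypothesis kerS : forall k x, delta k.+1 x = 0 <-> exists y, delta k y = x.

Lemma exact_deltaK k x : delta k.+1 (delta k x) = 0.
Proof. by apply/kerS; exists x. Qed.

Lemma rel_boundary_ext (P : lmodType S) (U : P -> Prop) k (phi psi : {linear P -> I k}) :
  (forall x, phi x = psi x) -> rel_boundary delta U phi -> rel_boundary delta U psi.
Proof. by move=> e [chi Uchi chiE]; exists chi => // x; rewrite chiE. Qed.

Lemma rel_boundary_eq0 (P : lmodType S) (U : P -> Prop) k (phi : {linear P -> I k}) :
  (forall x, phi x = 0) -> rel_boundary delta U phi.
Proof. by move=> e; exists (\0 : {linear P -> prev I k}) => // x; rewrite linear0. Qed.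

Lemma proj_lift (P : lmodType S) i (phi : {linear P -> I i.+1}) : projective P ->
  (forall x, delta i.+1 (phi x) = 0) ->
  exists psi : {linear P -> I i}, forall x, delta i (psi x) = phi x.
Proof. by move=> projP dphi; apply: projP => x; apply/kerS. Qed.

Lemma proj_lift0 (P : lmodType S) (phi : {linear P -> I 0%N}) : projective P ->
  (forall x, delta 0%N (phi x) = 0) ->
  exists u : {linear P -> S^o}, forall x, iota (u x) = phi x.
Proof. by move=> projP dphi; apply: projP => x; apply/ker0. Qed.

Section FreeComplex.
Variables (g : nat -> nat) (d : forall j, {linear 'rV[S]_(g j.+1) -> 'rV[S]_(g j)}).
Hypothesis exact_d : forall j x, d j x = 0 <-> exists y, d j.+1 y = x.

Definition im_d j : 'rV[S]_(g j) -> Prop := fun x => exists y, d j y = x.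

Lemma free_dd j y : d j (d j.+1 y) = 0.
Proof. by apply/exact_d; exists y. Qed.

Lemma syzygy_closed j i (phi : {linear 'rV[S]_(g j) -> I i.+1})
    (psi : {linear 'rV[S]_(g j) -> I i}) :
  rel_closed delta (@im_d j) phi -> (forall x, delta i (psi x) = phi x) ->
  rel_closed delta (@im_d j.+1) (psi \o d j).
Proof.
move=> [dphi Uphi] psiE; split=> [x|u [y <-]] /=; last by rewrite free_dd linear0.
by rewrite psiE Uphi //; exists x.
Qed.

(** Together with [syzygy_closed] this is dimension shifting: [Ext^(i+1)] of the
    cokernel of [d j] is [Ext^i] of the next syzygy. *)
Lemma syzygy_boundary j i (psi : {linear 'rV[S]_(g j) -> I i}) :
  rel_boundary delta (@im_d j.+1) (psi \o d j) ->
  rel_boundary delta (@im_d j) (delta i \o psi).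
Proof.
move=> [chi Uchi chiE].
have [|chi' chi'E] := factor_through (p := d j) (phi := chi) (injective_prev injI (k := i)).
  by move=> u /exact_d[y <-]; apply: Uchi; exists y.
exists (psi \- (dprev delta i \o chi')).
  by move=> _ [y <-] /=; rewrite chi'E chiE subrr.
by move=> x; rewrite /= linearB /= delta_dprev ?subr0 //; apply: exact_deltaK.
Qed.

Definition dual_im j : 'rV[S]_(g j) -> Prop :=
  match j with
  | 0 => fun u => u = 0
  | j'.+1 => fun u => exists w, u = w *m (lin1_mx (d j'))^T
  end.
(** [Ext^j = 0], computed by the free resolution. *)
Definition dual_exact j : Prop :=
  forall u, u *m (lin1_mx (d j))^T = 0 -> @dual_im j u.

Lemma dual_dd j (w : 'rV[S]_(g j)) : w *m (lin1_mx (d j))^T *m (lin1_mx (d j.+1))^T = 0.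
Proof.
apply: dot_inj => x; rewrite !dot_mul !mul_rV_lin1 free_dd !dotE.
by rewrite trmx0 mulmx0 mul0mx !mxE.
Qed.

Lemma dual_functional j (u : {linear 'rV[S]_(g j) -> S^o}) :
  (forall x, u (d j x) = 0) -> dual_exact j ->
  exists2 r, dual_im r & forall x, u x = dot r x.
Proof.
move=> ud0 Dj; have [r rE] := functionalE u; exists r => //; apply: Dj.
apply: dot_inj => x; rewrite dot_mul mul_rV_lin1 -rE ud0.
by rewrite dotE trmx0 mulmx0 mxE.
Qed.

Lemma dual_exact_vanish0 : dual_exact 0 -> rel_vanish delta (@im_d 0) 0.
Proof.
move=> D0 phi [dphi Uphi]; have [u uE] := proj_lift0 (@projective_row _ _) dphi.
have [x|_ -> rE] := dual_functional (u := u) _ D0.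
  by apply: iota_inj; rewrite uE linear0 Uphi //; exists x.
apply: rel_boundary_eq0 => x; rewrite -uE rE dotE trmx0 mulmx0 mxE.
exact: linear0.
Qed.

(** The degree is shifted down to 0, where cocycles are functionals on the free
    module and become boundaries by exactness of the dual complex. *)
Lemma dual_exact_vanish i j : dual_exact (j + i.+1) -> rel_vanish delta (@im_d j) i.+1.
Proof.
elim: i j => [|i IH] j Dj phi phiZ.
  have [psi psiE] := proj_lift (@projective_row _ _) phiZ.1.
  have [dpsi Upsi] := syzygy_closed phiZ psiE.
  have [u uE] := proj_lift0 (@projective_row _ _) dpsi.
  rewrite addn1 in Dj.
  have [x|_ [r ->] rE] := dual_functional (u := u) _ Dj.
    by apply: iota_inj; rewrite uE linear0 /= free_dd linear0.
  exists (psi \- (iota \o dot r)).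
    move=> _ [y <-]; rewrite /=; have /= <- := uE y.
    by rewrite rE dot_mul mul_rV_lin1 subrr.
  move=> x; rewrite /= linearB /= psiE.
  by have -> : delta 0 (iota (dot r x)) = 0 by [apply/ker0; exists (dot r x)];
      rewrite subr0.
have [psi psiE] := proj_lift (@projective_row _ _) phiZ.1.
apply: (rel_boundary_ext (phi := delta _ \o psi) psiE); apply: syzygy_boundary; apply: IH.
  by rewrite addSnnS.
exact: syzygy_closed psiE.
Qed.

(** If the dual complex is exact before degree [j], it provides a free resolution
    of length [j] of its cokernel in that degree. *)
Lemma dual_vanish j : (forall i, (i < j)%N -> dual_exact i) ->
  forall i, (j < i)%N -> rel_vanish delta (@dual_im j) i.
Proof.
elim: j => [|j IH] Dj [|i] // ji phi [dphi Uphi].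
  have [psi psiE] := proj_lift (@projective_row _ _) dphi.
  by exists psi => // u ->; rewrite linear0.
have [psi psiE] := proj_lift (@projective_row _ _) dphi.
pose t := mulmxr (lin1_mx (d j))^T : {linear 'rV[S]_(g j) -> 'rV[S]_(g j.+1)}.
have tt w : dual_im w -> t w = 0.
  by case: (j) w @t => [|j'] w t;
      [move=> ->; rewrite linear0 | move=> [v ->]; apply: dual_dd].
have [||chi Uchi chiE] := IH _ i ji (psi \o t).
- by move=> k kj; apply: Dj; apply: leqW.
- split=> [x|u /tt tu0]; last exact: etrans (congr1 psi tu0) (linear0 psi).
  by rewrite /= psiE Uphi //; exists x.
have [|chi' chi'E] := factor_through (p := t) (phi := chi) (injective_prev injI (k := i)).
  by move=> u tu0; apply/Uchi/(Dj j (leqnn _)).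
exists (psi \- (dprev delta i \o chi')).
  move=> _ [w ->]; have /= := chiE w; rewrite -chi'E /= => ->.
  by rewrite subrr.
by move=> x; rewrite /= linearB /= psiE delta_dprev ?subr0 //; apply: exact_deltaK.
Qed.

End FreeComplex.
End ExactComplex.

(** * Finite generation of Ext *)

Section FiniteGeneration.
Variables (S : comNzRingType) (I : nat -> lmodType S).
Variable delta : forall k, {linear I k -> I k.+1}.
Hypothesis injI : forall k, injective_module (I k).
Variable iota : {linear S^o -> I 0%N}.
Hypothesis iota_inj : injective iota.
Hypothesis ker0 : forall x, delta 0%N x = 0 <-> exists y, iota y = x.
Hypothesis kerS : forall k x, delta k.+1 x = 0 <-> exists y, delta k y = x.
Hypothesis noeth : noetherian_ring S.

Section FreeComplex.
Variables (g : nat -> nat) (d : forall j, {linear 'rV[S]_(g j.+1) -> 'rV[S]_(g j)}).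
Hypothesis exact_d : forall j x, d j x = 0 <-> exists y, d j.+1 y = x.
Notation closed j phi := (rel_closed delta (@im_d _ _ d j) phi).
Notation boundary j phi := (rel_boundary delta (@im_d _ _ d j) phi).

Lemma rel_closed_submodule (P : lmodType S) (U : P -> Prop) i :
  submodule (fun phi : lin_hom P (I i) => rel_closed delta U (hom_fun phi)).
Proof.
split; first by split=> [x|u _]; rewrite -?[hom_fun 0 _]/(0 : I i) ?linear0.
move=> a phi psi [dphi Uphi] [dpsi Upsi]; split=> [x|u Uu].
  rewrite -[LHS]/(delta i (a *: hom_fun phi x + hom_fun psi x)).
  by rewrite linearP dphi dpsi scaler0 addr0.
rewrite -[LHS]/(a *: hom_fun phi u + hom_fun psi u).
by rewrite Uphi // Upsi // scaler0 addr0.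
Qed.

(** Dimension shifting reduces to degree 0, where the cocycles form a submodule of
    the finitely generated dual of a free module. *)
Lemma rel_cohomology_fg i j : exists2 L : seq (lin_hom 'rV[S]_(g j) (I i)),
  (forall phi, phi \in L -> closed j (hom_fun phi)) &
  forall phi : lin_hom 'rV[S]_(g j) (I i), closed j (hom_fun phi) ->
    exists2 psi, lspan L psi & boundary j (hom_fun (phi - psi)).
Proof.
elim: i j => [|i IH] j.
  pose H : lmodType S := lin_hom 'rV[S]_(g j) (I 0%N).
  pose c k : H := to_hom (iota \o dot (delta_mx 0 k : 'rV_(g j))).
  pose e : seq H := [seq c k | k <- enum 'I_(g j)].
  have [|L LE] := fg_submodule noeth (s := e) (@rel_closed_submodule _ (@im_d _ _ d j) 0).
    move=> phi [dphi _].
    have [u uE] := proj_lift0 ker0 (@projective_row _ _) dphi.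
    have -> : phi = \sum_k (u (delta_mx 0 k) : S) *: c k :> H.
      apply/val_inj/funext => x.
      have -> : val phi x = iota (u x) by rewrite uE.
      rewrite raddf_sum fct_sumE row_homE linear_sum; apply: eq_bigr => k _.
      rewrite linearZ -[RHS]/(u (delta_mx 0 k) *: iota (dot (delta_mx 0 k) x)).
      rewrite -linearZ -[in RHS]linearZ /=; congr (iota _).
      rewrite trmx_delta -colE !mxE.
      by rewrite -[LHS]/(x 0 k * u (delta_mx 0 k)) mulrC.
    apply: (submod_sum (lspan_sub _)) => k; apply: (submodZ (lspan_sub _)); apply:
        lspan_mem.
    by apply: map_f; rewrite mem_enum.
  exists L; first by move=> phi /lspan_mem /LE.
  move=> phi /LE Lphi; exists phi => //; apply: rel_boundary_eq0 => x.
  by rewrite subrr.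
have [L' L'Z L'E] := IH j.+1.
have {L'Z} L'span : forall psi, lspan L' psi -> closed j.+1 (hom_fun psi).
  exact: lspan_min (@rel_closed_submodule _ _ i) L'Z.
have [L LZ LE] : exists2 L : seq (lin_hom 'rV[S]_(g j) (I i.+1)),
    (forall phi, phi \in L -> closed j (hom_fun phi)) &
    forall psi, lspan L' psi -> exists chi : lin_hom 'rV[S]_(g j) (I i),
      (forall x, hom_fun chi (d j x) = hom_fun psi x) /\ lspan L (to_hom (delta i \o hom_fun chi)).
  elim: L' L'span {L'E} => [|eta L' IHL] L'span.
    exists [::] => // psi ->; exists 0; split=> // /=.
    by apply/val_inj/funext => x; rewrite /= linear0.
  have [psi sp|L LZ LE] := IHL; first exact/L'span/lspan_tail.
  have [deta Ueta] := L'span _ (lspan_head eta L').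
  have [|chi chiE] := factor_through (p := d j) (phi := hom_fun eta) (injI (k := i)).
    by move=> u /exact_d du; apply: Ueta.
  exists (to_hom (delta i \o chi) :: L).
    move=> phi; rewrite inE => /predU1P[->|]; last exact: LZ.
    split=> [x|_ [y <-]] /=; first exact: (exact_deltaK kerS).
    by rewrite -[LHS]/(delta i (chi (d j y))) chiE deta.
  move=> _ [c [psi /LE[chi' [chi'E Lchi'] ->]]].
  exists (c *: to_hom chi + chi'); split.
    by move=> x; rewrite -[LHS]/(c *: chi (d j x) + hom_fun chi' (d j x)) chiE chi'E.
  exists c, (to_hom (delta i \o hom_fun chi')) => //.
  by apply/val_inj/funext => x; apply: (linearP (delta i) c (chi x) (hom_fun chi' x)).
exists L => // phi phiZ.
have [psi psiE] := proj_lift kerS (@projective_row _ _) phiZ.1.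
have psiZ := syzygy_closed exact_d phiZ psiE.
have [eta Leta Beta] := L'E (to_hom (psi \o d j)) psiZ.
have [chi [chiE Lchi]] := LE _ Leta.
exists (to_hom (delta i \o hom_fun chi)) => //.
have := @syzygy_boundary _ _ _ injI kerS _ _ exact_d j i (psi \- hom_fun chi).
case.
  apply: rel_boundary_ext Beta => x.
  by rewrite -[LHS]/(psi (d j x) - hom_fun eta x) -chiE.
move=> rho Urho rhoE; exists rho => // x; rewrite rhoE /= linearB /= psiE.
by [].
Qed.
End FreeComplex.

Variable m : S -> Prop.
Hypothesis m_loc : nonunits m.

(** A free resolution of [S/a] that starts with [S]. *)
Lemma cyclic_resolution a : ideal a -> exists (b : nat -> nat)
  (d : forall j, {linear 'rV[S]_(extend_rank 1 b j.+1) -> 'rV[S]_(extend_rank 1 b j)}),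
  (forall x : 'rV_1, im_d d (j := 0) x <-> a (x 0 0)) /\
  forall j x, d j x = 0 <-> exists y, d j.+1 y = x.
Proof.
move=> ia.
have [|b [d [dE d_ex _]]] :=
    minimal_resolution m_loc noeth (g := 1) (U := fun x => a (x 0 0)).
  split; first by rewrite mxE; apply: submod0 ia.
  by move=> c x y ax ay; rewrite !mxE; apply: (submodP ia).
by exists b, d; split=> // x; split=> /dE.
Qed.

Lemma rel_closed_cyclic a (U : 'rV[S]_1 -> Prop) k (y : I k) :
    (forall x, U x -> a (x 0 0)) ->
  cocycle delta a y -> rel_closed delta U (row_hom (fun=> y)).
Proof.
move=> Ua [ay dy]; split=> [x|u /Ua au]; rewrite /= big_ord1 ?linearZ /= ?dy ?scaler0 //.
exact: ay.
Qed.

Lemma rel_boundary_cyclic a (U : 'rV[S]_1 -> Prop) k (phi : {linear 'rV[S]_1 -> I k}) :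
  (forall x : 'rV_1, a (x 0 0) -> U x) ->
  rel_boundary delta U phi -> coboundary delta a (phi (delta_mx 0 0)).
Proof.
move=> aU [chi Uchi chiE]; exists (chi (delta_mx 0 0)); last exact: chiE.
by move=> c ac; rewrite -linearZ Uchi //; apply: aU; rewrite !mxE mulr1.
Qed.

Lemma ideal_fg_ext a k : ideal a -> fg_ext delta a k.
Proof.
move=> ia; have [b [d [dE d_ex]]] := cyclic_resolution ia.
have [L LZ LE] := rel_cohomology_fg d_ex k 0.
pose ev (phi : lin_hom 'rV[S]_1 (I k)) := hom_fun phi (delta_mx 0 0).
have ev_lin psi : lspan L psi -> lspan (map ev L) (ev psi).
  elim: {LZ LE} L psi => [|f L IH] psi; first by move=> ->.
  by move=> [c [f' /IH Lf' ->]]; exists c, (ev f').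
exists (map ev L).
  move=> _ /mapP[phi /LZ[dphi Uphi] ->]; split; last exact: dphi.
  by move=> c ac; rewrite -linearZ Uphi //; apply/dE; rewrite !mxE mulr1.
move=> y yZ; have [|psi Lpsi Bpsi] := LE (to_hom (row_hom (fun=> y))).
  by apply: rel_closed_cyclic yZ => x /dE.
exists (ev psi); first exact: ev_lin.
have := rel_boundary_cyclic (fun x ax => (dE x).2 ax) Bpsi.
rewrite -[X in coboundary _ _ X]/(row_hom (fun=> y) (delta_mx 0 0) - ev psi).
by rewrite row_hom_delta.
Qed.

Lemma rel_vanish_cyclic a (U : 'rV[S]_1 -> Prop) k :
    (forall x : 'rV_1, U x <-> a (x 0 0)) ->
  rel_vanish delta U k -> Ext_killed delta 1 a k.
Proof.
move=> Ua H y yZ; rewrite scale1r -[y](row_hom_delta (fun _ : 'I_1 => y) 0).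
apply: (rel_boundary_cyclic (fun x => (Ua x).2)); apply: H.
by apply: rel_closed_cyclic yZ => x /Ua.
Qed.
End FiniteGeneration.

(** * The residue field of a Gorenstein local ring *)

Section Gorenstein.
Variables (S : comNzRingType) (I : nat -> lmodType S).
Variable delta : forall k, {linear I k -> I k.+1}.
Hypothesis injI : forall k, injective_module (I k).
Variable iota : {linear S^o -> I 0%N}.
Hypothesis iota_inj : injective iota.
Hypothesis ker0 : forall x, delta 0%N x = 0 <-> exists y, iota y = x.
Hypothesis kerS : forall k x, delta k.+1 x = 0 <-> exists y, delta k y = x.
Hypothesis noeth : noetherian_ring S.
Variable m : S -> Prop.
Hypothesis m_loc : nonunits m.

Lemma gorenstein_fg a k : ideal a -> fg_ext delta a k.
Proof. exact: (ideal_fg_ext injI ker0 kerS noeth m_loc). Qed.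

Lemma dual_im_submodule g (d : forall j, {linear 'rV[S]_(g j.+1) -> 'rV[S]_(g j)}) j :
  submodule (@dual_im S g d j).
Proof.
case: j => [|j]; first by split=> // a x y -> ->; rewrite scaler0 addr0.
split; first by exists 0; rewrite mul0mx.
by move=> a _ _ [w ->] [w' ->]; exists (a *: w + w'); rewrite mulmxDl scalemxAl.
Qed.

(** Multiplication by [c] is zero on the resolved module, hence null homotopic on
    its resolution and on the dual complex. *)
Lemma dual_cocycle_m g (d : forall j, {linear 'rV[S]_(g j.+1) -> 'rV[S]_(g j)}) t u c :
  (forall j x, d j x = 0 <-> exists y, d j.+1 y = x) ->
  (forall x, exists y, d 0%N y = c *: x) ->
  u *m (lin1_mx (d t))^T = 0 -> dual_im d (c *: u).
Proof.
move=> d_ex dc ut0.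
have udt y : dot u (d t y) = 0.
  by have := dot_mul (lin1_mx (d t)) u y; rewrite ut0 mul_rV_lin1 => <-;
      rewrite dotE trmx0 mulmx0 mxE.
have dotZ x : dot (c *: u) x = dot u (c *: x).
  by rewrite !dotE -scalemxAl [(c *: u)^T]linearZ /= -scalemxAr.
pose gam j : {linear 'rV[S]_(g j) -> 'rV[S]_(g j)} := *:%R c.
have gamd j x : gam j (d j x) = d j (gam j.+1 x) by rewrite /= linearZ.
case: t u ut0 udt dotZ => [|t] u ut0 udt dotZ.
  have [h hE] := homotopy0 (fun j => @projective_row S (g j)) (gam := gam) dc.
  apply: dot_inj => x; rewrite dotZ -[c *: x]hE udt.
  by rewrite dotE trmx0 mulmx0 mxE.
have [h [h' hE]] := homotopyS (fun j => @projective_row S (g j)) d_ex gamd dc t.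
have [w wE] := functionalE (dot u \o h); exists w; apply: dot_inj => x.
by rewrite dotZ -[c *: x]/(gam _ x) hE linearD udt add0r dot_mul mul_rV_lin1 -wE.
Qed.

(** Depth equals injective dimension. Here [t] is the least and [n] the largest
    degree with nonzero Ext, and [X] in the comments below is the cokernel of the
    dual of a free resolution of the residue field in degree [t]; it has
    projective dimension at most [t]. *)
Lemma Ext_residue_single s N : ~ Ext_killed delta 1 m s ->
    (forall k, (N < k)%N -> forall x : I k, x = 0) ->
  forall i, i != s -> Ext_killed delta 1 m i.
Proof.
move=> Ts IN.
have deltaK := exact_deltaK kerS.
have im := nonunits_ideal m_loc.
have [b [d [dE d_ex]]] := cyclic_resolution noeth m_loc im.
set g := extend_rank 1 b in d dE d_ex.
have D_killed i : dual_exact d i -> Ext_killed delta 1 m i.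
  case: i => [|i] Di; apply: (rel_vanish_cyclic dE).
    exact: (dual_exact_vanish0 iota_inj ker0).
  exact: (dual_exact_vanish injI iota_inj ker0 kerS d_ex (j := 0)).
have ex_n : exists n, `[<~ Ext_killed delta 1 m n>] by exists s; apply/asboolP.
have bound_n n : `[<~ Ext_killed delta 1 m n>] -> (n <= N)%N.
  move=> /asboolP Tn; rewrite leqNgt; apply/negP => Nn; apply: Tn => y _.
  by rewrite [y]IN // scaler0; apply: submod0 (coboundary_submodule _ _ _).
case: (ex_maxnP ex_n bound_n) => n /asboolP Tn n_max.
have above i : (n < i)%N -> Ext_killed delta 1 m i.
  by move=> ni; apply: contrapT => /asboolP /n_max; rewrite leqNgt ni.
have ex_t : exists t, `[<~ dual_exact d t>].
  by exists n; apply/asboolP => /D_killed.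
case: (ex_minnP ex_t) => t /asboolP Tot_d t_min.
have below i : (i < t)%N -> dual_exact d i.
  by move=> it; apply: contrapT => /asboolP /t_min; rewrite leqNgt it.
have s_n : (s <= n)%N by apply: n_max; apply/asboolP.
have t_s : (t <= s)%N by rewrite leqNgt; apply/negP => /below /D_killed.
suff n_t : (n <= t)%N.
  move=> i; rewrite neq_ltn => /orP[i_s|i_s].
    by apply/D_killed/below/(leq_trans i_s)/(leq_trans s_n).
  by apply: above; apply: leq_ltn_trans n_t _; apply: leq_ltn_trans t_s i_s.
rewrite leqNgt; apply/negP => tn; apply: Tn => y [my dy]; rewrite scale1r.
(* [u] spans a copy of the residue field in [X]. *)
have [u [ut0 u_im]] : exists u, u *m (lin1_mx (d t))^T = 0 /\ ~ dual_im d u.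
  by apply: contrapT => H; apply: Tot_d => u ut0; apply: contrapT => nu; apply: H; exists u.
have sD := dual_im_submodule d t.
have mu c : m c -> dual_im d (c *: u).
  move=> mc; apply: dual_cocycle_m => // x.
  by have /dE[z zE] : m ((c *: x : 'rV_1) 0 0) by [rewrite mxE; apply: ideal_mulr];
      exists z.
have cu_m c : dual_im d (c *: u) -> m c.
  move=> cu; apply: contrapT => mc; have [_ _ m_unit] := m_loc.
  have [e ec] := m_unit _ mc.
  by apply: u_im; rewrite -[u]scale1r -ec -scalerA; apply: (submodZ sD).
(* [phi] extends to [X] the map from the residue field that [y] defines. *)
have [||phi phiE] := @inj_rel S 'rV[S]_(g t) (I n)
    (fun v x => exists c z, [/\ dual_im d z, v = z + c *: u & x = c *: y]) (@injI n).
- split; first by exists 0, 0; rewrite !scale0r addr0; split=> //; apply: submod0 sD.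
  move=> e _ _ _ _ [c [z [Nz -> ->]]] [c' [z' [Nz' -> ->]]].
  exists (e * c + c'), (e *: z + z'); split; first exact: (submodP sD).
    by rewrite scalerDr scalerA scalerDl addrACA.
  by rewrite scalerA scalerDl.
- move=> x [c [z [Nz /esym/eqP]]]; rewrite addr_eq0 => /eqP zE ->.
  by apply/my/cu_m; rewrite -[c *: u]opprK -zE; apply: (submodN sD).
pose U v := exists c z, dual_im d z /\ v = z + c *: u.
have sU : submodule U.
  split; first by exists 0, 0; rewrite scale0r addr0; split=> //; apply: submod0 sD.
  move=> e _ _ [c [z [Nz ->]]] [c' [z' [Nz' ->]]].
  exists (e * c + c'), (e *: z + z'); split; first exact: (submodP sD).
  by rewrite scalerDr scalerA scalerDl addrACA.
have basis x : lspan [seq delta_mx 0 i | i <- enum 'I_(g t)] (x : 'rV[S]_(g t)).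
  rewrite [x]row_sum_delta; apply: (submod_sum (lspan_sub _)) => i.
  by apply/(submodZ (lspan_sub _))/lspan_mem/map_f; rewrite mem_enum.
(* Ext^(n+1) of [X] modulo [u] vanishes, so a correction that is zero at [u]
   makes [phi] a cocycle; as n > t it is then a coboundary on [X]. *)
have vanU : rel_vanish delta U n.+1.
  apply: (rel_vanish_fg injI deltaK sU basis) => a ia _.
  exact: (Ext_killed_above injI deltaK noeth m_loc gorenstein_fg above).
have [|psi Upsi psiE] := vanU (delta n \o phi).
  split=> [x|_ [c [z [Nz ->]]]] /=; first exact: deltaK.
  by rewrite (phiE _ (c *: y)) ?linearZ /= ?dy ?scaler0 //; exists c, z.
pose psi' : {linear 'rV[S]_(g t) -> I n} := psi.
have [|chi Uchi chiE] := dual_vanish injI kerS d_ex below tn (phi := phi \- psi').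
  split=> [x|z Nz]; first by rewrite linearB /= psiE subrr.
  rewrite /= (phiE z 0) ?Upsi ?subrr //; last by exists 0, z; rewrite !scale0r addr0.
  by exists 0, z; rewrite scale0r addr0.
exists (chi u); first by move=> c mc; rewrite -linearZ Uchi //; apply: mu.
rewrite chiE /= (phiE u y) ?Upsi ?subr0 //.
  by exists 1, 0; rewrite scale1r add0r; split=> //; apply: submod0 sD.
by exists 1, 0; rewrite !scale1r add0r; split=> //; apply: submod0 sD.
Qed.

(** ** Bass numbers along a maximal chain of primes *)
Variable s : nat.
Hypothesis dim_S : krull_dim S s.

(** Bass's argument: along a saturated chain of primes p_0 < ... < p_s starting at
    a minimal prime, [Ext^i(S/p_i, S)] stays nonzero after localisation at p_i.
    Otherwise Ext in degree i + 1 would vanish locally at p_(i+1) for all larger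
    ideals than p_i, and Nakayama's lemma would kill degree i. For i = 0 the
    vanishing would pass to [Ext^0(S, S)]. *)
Lemma Ext_residue_neq0 : ~ Ext_killed delta 1 m s.
Proof.
have [[P [_ PS]] P_max] := dim_S.
pose p i x := x \in P i.
have pp i : is_prime (p i) := prime_mem (P i).
have p_sub i : (i < s)%N -> forall x, p i x -> p i.+1 x by move=> /PS[].
have p_str i : (i < s)%N -> exists2 x, p i.+1 x & ~ p i x.
  by move=> /PS[_ [x xp xnp]]; exists x => //; apply/negP.
(* Inserting a further prime would give a chain that is too long. *)
have no_insert i q : is_prime q -> (i <= s.+1)%N ->
    ((0 < i)%N -> (forall x, p i.-1 x -> q x) /\ exists2 x, q x & ~ p i.-1 x) ->
    ((i <= s)%N -> (forall x, q x -> p i x) /\ exists2 x, p i x & ~ q x) -> False.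
  move=> pq is_ lo hi; have [Q QE] := prime_idealr_of pq.
  suff /P_max : prime_chain (pred1 (0 : S)) s.+1 by rewrite ltnn.
  exists (fun k => if (k < i)%N then P k else if k == i then Q else P k.-1); split.
    by move=> x /eqP ->; case: ifP => _; [|case: ifP => _]; apply: rpred0.
  move=> k ks; case: (ltngtP k.+1 i) => [ki|ki|ki].
  - by apply: PS; have := leq_trans ki is_.
  - case: eqP => [ki'|/eqP kni].
      have [|hi1 [x px qx]] := hi; first by rewrite -ki'; move: ks; rewrite ltnS.
      move: px hi1; rewrite -ki' => px hi1.
      by split=> [z /QE|]; [apply: hi1 | exists x => //; apply/negP => /QE].
    case: k ks ki kni => [|k] ks ki kni; last exact: PS.
    by move: ki kni; rewrite ltnS leqn0 => /eqP ->.
  - have [|lo1 [x qx px]] := lo; first by rewrite -ki.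
    move: lo1 px; rewrite -ki /= => lo1 px.
    by split=> [z /lo1 /QE //|]; exists x; [apply/QE | apply/negP].
have p0_min q : is_prime q -> (forall x, q x -> p 0%N x) -> forall x, p 0%N x -> q x.
  move=> pq qp x px; apply: contrapT => qx; apply: (no_insert 0%N q) => // _.
  by split=> //; exists x.
have p_sat i q : (i < s)%N -> is_prime q -> (forall x, p i x -> q x) ->
    (exists2 x, q x & ~ p i x) -> (forall x, q x -> p i.+1 x) -> forall x, p i.+1 x -> q x.
  move=> is_ pq pi_q q_str qp x px; apply: contrapT => qx.
  apply: (no_insert i.+1 q) => // [|_]; first exact: ltnW.
  by split=> //; exists x.
have p_top x : p s x <-> m x.
  have [ip p1 _] := pp s; split; first exact: (proper_nonunits m_loc ip p1).
  move=> mx; apply: contrapT => px.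
  apply: (no_insert s.+1 m) => //; [exact: nonunits_prime | | by rewrite ltnn].
  by move=> _; split; [exact: (proper_nonunits m_loc ip p1) | exists x].
have deltaK := exact_deltaK kerS.
(* Ext^i(S/p_i, S) does not vanish locally at p_i. *)
suff bass_i i : (i <= s)%N -> forall u, ~ p i u -> ~ Ext_killed delta u (p i) i.
  move=> ks; have [_ p1 _] := pp s; apply: (bass_i s (leqnn s) 1 p1).
  by apply: Ext_killed_ext ks => x; split=> /p_top.
elim: i => [|i IH] is_ u pu ku.
  have [ip0 p01 p0M] := pp 0%N.
  have all_killed a : ideal a -> exists2 v, ~ p 0%N v & Ext_killed delta v a 0.
    move: a; apply: (devissage noeth) => [a ia a1|a x ia [v pv kv] [v' pv' kv']|q pq _].
    - by exists 1 => //; apply: Ext_killed_mem.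
    - exists (v' * v); first by move=> /p0M[].
      exact: (Ext_killed_mid injI deltaK ia kv kv').
    have [H|H] := pselect (exists2 v, q v & ~ p 0%N v).
      by have [v qv pv] := H; exists v => //; apply: Ext_killed_mem.
    have qp x : q x -> p 0%N x.
      by move=> qx; apply: contrapT => px; apply: H; exists x.
    exists u => //; apply: Ext_killed_ext ku => x; split; first exact: p0_min.
    exact: qp.
  have img0 : ideal (fun x : S => x = 0).
    by split=> // c x y -> ->; rewrite scaler0 addr0.
  have [v pv kv] := all_killed _ img0; apply: pv.
  have [|w _] := kv (iota 1); last first.
    rewrite /= => /esym v1; suff -> : v = 0 by apply: submod0 ip0.
    apply: iota_inj; rewrite linear0 -[RHS]v1 -linearZ.
    by rewrite -[v *: (1 : S^o)]/(v * 1) mulr1.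
  by split; [move=> c ->; rewrite scale0r | apply/ker0; exists 1].
have [iq q1 qM] := pp i.+1; have [ip _ _] := pp i.
have above a : ideal a -> (forall x, p i x -> a x) -> (exists2 x, a x & ~ p i x) ->
    exists2 v, ~ p i.+1 v & Ext_killed delta v a i.+1.
  move: a; apply: (devissage noeth) => [a ia a1 _ _|a x ia H1 H2 pa pa'|q pq _ pq' q_str].
  - by exists 1 => //; apply: Ext_killed_mem.
  - have [z az pz] := pa'.
    have [||v pv kv] := H1; first by move=> c /pa; apply: sub_colon.
      by exists z => //; apply: sub_colon.
    have [||v' pv' kv'] := H2; first by move=> c /pa; apply: sub_adjoin.
      by exists z => //; apply: sub_adjoin.
    exists (v' * v); first by move=> /qM[].
    exact: (Ext_killed_mid injI deltaK ia kv kv').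
  have [[v qv pv]|H] := pselect (exists2 v, q v & ~ p i.+1 v).
    by exists v => //; apply: Ext_killed_mem.
  have qp x : q x -> p i.+1 x.
    by move=> qx; apply: contrapT => px; apply: H; exists x.
  exists u => //; apply: Ext_killed_ext ku => x; split; last exact: qp.
  exact: p_sat.
have [x qx px] := p_str i is_.
have [||v pv kv] := above (adjoin (p i) x) (adjoin_ideal x ip).
- by move=> z pz; apply: sub_adjoin.
- by exists x => //; apply: mem_adjoin.
have [v' pv' kv'] := Ext_killed_prime_step injI deltaK (pp i) (pp i.+1) qx px pv (gorenstein_fg i ip) kv.
by apply: (IH (ltnW is_) v') => // /(p_sub i is_).
Qed.

End Gorenstein.

(** * The total complex of Hom(F, J) *)

Section PairMaps.
Variables (A : comNzRingType) (X Y Z W : lmodType A).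

Lemma pair_map_linear (f : {linear X -> Y}) (h : {linear X -> Z}) :
  linear (fun x => (f x, h x)).
Proof. by move=> a x y; rewrite !linearP. Qed.
Definition pair_map f h : {linear X -> (Y * Z)%type} := linear_of (@pair_map_linear f h).

Lemma cone_map_linear (f : {linear X -> Y}) (h : {linear X -> Z}) (k : {linear W -> Z}) :
  linear (fun x : (X * W)%type => (f x.1, h x.1 - k x.2)).
Proof.
move=> a [x w] [y v]; congr pair; rewrite /= !linearP //.
by rewrite addrACA -scalerDr.
Qed.
Definition cone_map f h k : {linear (X * W)%type -> (Y * Z)%type} :=
  linear_of (@cone_map_linear f h k).

Lemma in_left_linear : linear (fun x : X => (x, 0) : (X * Y)%type).
Proof. by move=> a x y; congr pair; rewrite /= scaler0 addr0. Qed.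
Definition in_left : {linear X -> (X * Y)%type} := linear_of in_left_linear.
Lemma in_right_linear : linear (fun y : Y => (0, y) : (X * Y)%type).
Proof. by move=> a x y; congr pair; rewrite /= scaler0 addr0. Qed.
Definition in_right : {linear Y -> (X * Y)%type} := linear_of in_right_linear.

Lemma postcomp_linear (h : {linear Y -> Z}) :
  linear (fun f : lin_hom X Y => to_hom (h \o hom_fun f) : lin_hom X Z).
Proof. by move=> a f k; apply/val_inj/funext => x; apply: (linearP h). Qed.
Definition postcomp (h : {linear Y -> Z}) : {linear lin_hom X Y -> lin_hom X Z} :=
  linear_of (@postcomp_linear h).
End PairMaps.

Lemma injective_pair (A : comNzRingType) (X Y : lmodType A) : injective_module X ->
    injective_module Y ->
  injective_module (X * Y)%type.
Proof.
move=> injX injY U V i g i_inj.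
have [h hE] := injX _ _ i (fst \o g) i_inj.
have [h' h'E] := injY _ _ i (snd \o g) i_inj.
exists (pair_map h h') => a /=.
by rewrite hE h'E -surjective_pairing.
Qed.

Lemma lin_hom_eq (A : comNzRingType) (U V : lmodType A) (f h : lin_hom U V) :
  (forall x, hom_fun f x = hom_fun h x) -> f = h.
Proof. by move=> e; apply/val_inj/funext. Qed.

Lemma injective_hom_row (A : comNzRingType) n (V : lmodType A) : injective_module V ->
  injective_module (lin_hom 'rV[A]_n V).
Proof.
move=> injV X Y i g i_inj.
have ev_lin k : linear (fun x => hom_fun (g x) (delta_mx 0 k)).
  by move=> a x y; rewrite linearP.
have ext k : exists h : {linear Y -> V}, forall x, h (i x) = hom_fun (g x) (delta_mx 0 k).
  exact: (injV _ _ i (linear_of (ev_lin k)) i_inj).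
have [h hE] := choice ext.
have h_lin : linear (fun y => to_hom (row_hom (fun k => h k y)) : lin_hom 'rV[A]_n V).
  move=> a x y; apply: lin_hom_eq => w.
  rewrite -[RHS]/(a *: row_hom (fun k => h k x) w + row_hom (fun k => h k y) w) /=.
  rewrite scaler_sumr -big_split; apply: eq_bigr => k _ /=.
  by rewrite linearP scalerDr !scalerA mulrC.
exists (linear_of h_lin) => x; apply: lin_hom_eq => w.
by rewrite (row_homE (hom_fun (g x))); apply: eq_bigr => k _; rewrite hE.
Qed.

Section TotalComplex.
Variables (A : comNzRingType) (F : nat -> lmodType A) (d : forall i, {linear F i.+1 -> F i}).
Hypothesis ddK : forall i x, d i (d i.+1 x) = 0.

(** The part of total degree [i] of the double complex Hom(F_p, J^q) consists of
    Hom(F_i, J^0) and the part of total degree [i - 1] for the complex [J] shifted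
    by one. With this recursion all indices agree by computation. *)
Fixpoint Tot (i : nat) (J : nat -> lmodType A) : lmodType A :=
  match i with
  | 0 => lin_hom (F 0%N) (J 0%N)
  | i'.+1 => (lin_hom (F i'.+1) (J 0%N) * Tot i' (fun k => J k.+1))%type
  end.

(** The component with q = 0. *)
Definition edgeF i : forall J, {linear lin_hom (F i) (J 0%N) -> Tot i J} :=
  match i with
  | 0 => fun J => idfun
  | i'.+1 => fun J => in_left _ _
  end.

Definition pre_d (V : lmodType A) i : {linear lin_hom (F i) V -> lin_hom (F i.+1) V} :=
  precomp (V := V) (d i).

(** The minus sign in [cone_map] makes the two differentials anticommute. *)
Fixpoint Tot_d (i : nat) :
    forall (J : nat -> lmodType A) (delta : forall k, {linear J k -> J k.+1}),
    {linear Tot i J -> Tot i.+1 J} :=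
  match i with
  | 0 => fun J delta => pair_map (pre_d _ 0) (postcomp _ (delta 0%N))
  | i'.+1 => fun J delta =>
      cone_map (pre_d _ i'.+1) (edgeF i'.+1 (fun k => J k.+1) \o postcomp _ (delta 0%N))
        (@Tot_d i' (fun k => J k.+1) (fun k => delta k.+1))
  end.
Arguments Tot_d i [J].

Definition complex (J : nat -> lmodType A) (delta : forall k, {linear J k -> J k.+1}) :=
  forall k x, delta k.+1 (delta k x) = 0.

Lemma pre_d_pre_d V i (c : lin_hom (F i) V) : pre_d V i.+1 (pre_d V i c) = 0.
Proof.
by apply: lin_hom_eq => x; rewrite -[LHS]/(hom_fun c (d i (d i.+1 x))) ddK linear0.
Qed.

Lemma Tot_d_edgeF i (J : nat -> lmodType A) (delta : forall k, {linear J k -> J k.+1})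
    (c : lin_hom (F i) (J 0%N)) :
  Tot_d i delta (edgeF i J c) = (pre_d _ i c, edgeF i (fun k => J k.+1) (postcomp _ (delta 0%N) c)).
Proof.
case: i c => [|i] c //;
    rewrite -[LHS]/(pre_d _ i.+1 c,
      edgeF i.+1 (fun k => J k.+1) (postcomp _ (delta 0%N) c) -
      Tot_d i (fun k => delta k.+1) 0).
by rewrite linear0 subr0.
Qed.

Lemma postcomp_complex (J : nat -> lmodType A) (delta : forall k, {linear J k -> J k.+1}) k
    (U : lmodType A) (c : lin_hom U (J k)) : complex delta ->
  postcomp _ (delta k.+1) (postcomp _ (delta k) c) = 0.
Proof.
by move=> dK; apply: lin_hom_eq => x; rewrite -[LHS]/(delta _ (delta k (hom_fun c x))) dK.
Qed.

Lemma Tot_dd i (J : nat -> lmodType A) (delta : forall k, {linear J k -> J k.+1}) w :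
    complex delta ->
  Tot_d i.+1 delta (Tot_d i delta w) = 0.
Proof.
elim: i J delta w => [|i IH] J delta w dK.
  rewrite -[LHS]/(pre_d _ 1 (pre_d _ 0 w),
     edgeF 1 (fun k => J k.+1) (postcomp _ (delta 0%N) (pre_d _ 0 w)) -
     Tot_d 0 (fun k => delta k.+1) (edgeF 0 (fun k => J k.+1) (postcomp _ (delta 0%N) w))).
  rewrite pre_d_pre_d Tot_d_edgeF; congr pair; apply/eqP; rewrite subr_eq0; apply/eqP.
  by congr pair; [apply: lin_hom_eq | apply/esym/(postcomp_complex _ dK)].
case: w => w0 w'.
rewrite -[LHS]/(pre_d _ i.+2 (pre_d _ i.+1 w0),
   edgeF i.+2 (fun k => J k.+1) (postcomp _ (delta 0%N) (pre_d _ i.+1 w0)) -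
   Tot_d i.+1 (fun k => delta k.+1) (edgeF i.+1 (fun k => J k.+1) (postcomp _ (delta 0%N) w0) -
     Tot_d i (fun k => delta k.+1) w')).
rewrite pre_d_pre_d linearB IH ?subr0; last by move=> k; apply: dK.
rewrite Tot_d_edgeF; congr pair; apply/eqP; rewrite subr_eq0; apply/eqP.
by rewrite postcomp_complex // linear0; congr pair; apply: lin_hom_eq.
Qed.

Lemma Tot_d_right i (J : nat -> lmodType A) (delta : forall k, {linear J k -> J k.+1})
    (u : Tot i (fun k => J k.+1)) :
  Tot_d i.+1 delta (in_right _ _ u) = - in_right _ _ (Tot_d i (fun k => delta k.+1) u).
Proof.
rewrite -[LHS]/(pre_d _ i.+1 0, edgeF i.+1 (fun k => J k.+1) (postcomp _ (delta 0%N) 0) -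
  Tot_d i (fun k => delta k.+1) u).
by rewrite !linear0 sub0r; congr pair; rewrite /= oppr0.
Qed.

(** ** The edge Hom(M, J) *)
Section Top.
Variables (M : lmodType A) (cov : {linear F 0%N -> M}).
Hypothesis cov_surj : forall x, exists y, cov y = x.
Hypothesis ker_cov : forall x, cov x = 0 <-> exists y, d 0%N y = x.
Hypothesis exact_d : forall i x, d i x = 0 <-> exists y, d i.+1 y = x.

(** The augmentation of the resolution embeds Hom(M, J^i) into the component
    Hom(F_0, J^i). *)
Fixpoint edgeM (i : nat) : forall J : nat ->
    lmodType A, {linear lin_hom M (J i) -> Tot i J} :=
  match i with
  | 0 => fun J => precomp (V := J 0%N) cov
  | i'.+1 => fun J => in_right _ _ \o edgeM i' (fun k => J k.+1)
  end.

Lemma Tot_d_edgeM i (J : nat -> lmodType A) (delta : forall k, {linear J k -> J k.+1}) phi :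
  Tot_d i delta (edgeM i J phi) = (-1) ^+ i *: edgeM i.+1 J (postcomp _ (delta i) phi).
Proof.
elim: i J delta phi => [|i IH] J delta phi.
  rewrite expr0 scale1r; congr pair; apply: lin_hom_eq => x //.
  rewrite -[LHS]/(hom_fun phi (cov (d 0%N x))).
  by have -> : cov (d 0%N x) = 0; [apply/ker_cov; exists x | rewrite linear0].
rewrite -[LHS]/(pre_d _ i.+1 0,
  edgeF i.+1 (fun k => J k.+1) (postcomp _ (delta 0%N) 0) -
  Tot_d i (fun k => delta k.+1) (edgeM i (fun k => J k.+1) phi)).
rewrite IH !linear0 sub0r exprS mulN1r -scaleNr.
by congr pair; rewrite /= scaler0.
Qed.

Lemma edgeM_inj i J phi : edgeM i J phi = 0 -> phi = 0.
Proof.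
elim: i J phi => [|i IH] J phi; last by move=> /(congr1 snd) /= /IH.
move=> e; apply: lin_hom_eq => x; have [y <-] := cov_surj x.
exact: (congr1 (fun f => hom_fun f y) e).
Qed.

Lemma edgeM_exact i (J : nat -> lmodType A) (delta : forall k, {linear J k -> J k.+1}) phi
    (psi : {linear M -> prev J i}) : (forall x, dprev delta i (psi x) = hom_fun phi x) ->
  exists v, edgeM i J phi = dprev (fun k => Tot_d k delta) i v.
Proof.
case: i phi psi => [|i] phi psi psiE.
  by exists 0; have -> : phi = 0 by [apply: lin_hom_eq => x; rewrite -psiE];
      rewrite !linear0.
exists ((-1) ^+ i *: edgeM i J (to_hom psi)).
rewrite -[RHS]/(Tot_d i delta _) linearZZ Tot_d_edgeM scalerA -expr2 sqrr_sign scale1r.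
by congr (edgeM _ _ _); apply: lin_hom_eq => x; rewrite -psiE.
Qed.

Lemma factor_cov (V : lmodType A) (w : lin_hom (F 0%N) V) : injective_module V ->
  pre_d V 0 w = 0 -> exists phi : lin_hom M V, precomp cov phi = w.
Proof.
move=> injV w0.
have [u /ker_cov[y <-]|phi phiE] := factor_through (p := cov) (phi := hom_fun w) injV.
  exact: (congr1 (fun f => hom_fun f y) w0).
by exists (to_hom phi); apply: lin_hom_eq => x; apply: phiE.
Qed.

Lemma factor_d (V : lmodType A) i (w : lin_hom (F i.+1) V) : injective_module V ->
  pre_d V i.+1 w = 0 -> exists v : lin_hom (F i) V, pre_d V i v = w.
Proof.
move=> injV w0.
have [u /exact_d[y <-]|phi phiE] := factor_through (p := d i) (phi := hom_fun w) injV.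
  exact: (congr1 (fun f => hom_fun f y) w0).
by exists (to_hom phi); apply: lin_hom_eq => x; apply: phiE.
Qed.

Notation dprevTot J delta i := (dprev (fun k => Tot_d k delta) i).

(** The rows Hom(F, J^q) are exact because [J^q] is injective. A boundary removes
    the component of [w] in Hom(F_i, J^0), and the rest lives in the total complex
    of the shifted [J]. *)
Lemma edgeM_onto i (J : nat -> lmodType A) (delta : forall k, {linear J k -> J k.+1}) w :
  (forall k, injective_module (J k)) -> complex delta -> Tot_d i delta w = 0 ->
  exists2 phi, postcomp _ (delta i) phi = 0 & exists v, w = edgeM i J phi + dprevTot J delta i v.
Proof.
elim: i J delta w => [|i IH] J delta w injJ dK Dw.
  have [phi phiE] := factor_cov (injJ 0%N) (congr1 fst Dw).
  exists phi; last by exists 0; rewrite linear0 addr0.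
  apply: lin_hom_eq => x; have [y <-] := cov_surj x.
  have := congr1 (fun f => hom_fun f y) (congr1 snd Dw).
  by rewrite -phiE.
case: w Dw => w0 w' Dw.
have [v0 v0E] := factor_d (injJ 0%N) (congr1 fst Dw).
pose J' k := J k.+1; pose delta' k := delta k.+1.
pose u : Tot i J' := w' - edgeF i J' (postcomp _ (delta 0%N) v0).
have wE : (w0, w') = Tot_d i delta (edgeF i J v0) + in_right _ _ u.
  by rewrite Tot_d_edgeF; congr pair; [rewrite /= addr0 | rewrite /= addrC subrK].
have Du : Tot_d i delta' u = 0.
  have := congr1 snd Dw; rewrite wE linearD Tot_dd // add0r.
  rewrite -[LHS]/(edgeF i.+1 J' (postcomp _ (delta 0%N) 0) - Tot_d i delta' u).
  by rewrite !linear0 sub0r => /eqP; rewrite oppr_eq0 => /eqP.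
have [|||phi dphi [v uE]] := IH J' delta' u.
- by move=> k; apply: injJ.
- by move=> k; apply: dK.
- exact: Du.
exists phi => //; rewrite wE {1}uE.
case: i {IH} w0 w' Dw v0 v0E @u wE Du phi dphi v uE => [|i] w0 w' Dw v0 v0E u wE Du phi dphi v uE.
  exists (edgeF 0 J v0); rewrite linearD addrC; congr (_ + _).
  by rewrite -[dprevTot _ _ 0 v]/0 linear0 addr0.
exists (edgeF i.+1 J v0 - in_right _ _ v).
have -> : dprevTot J delta i.+2 (edgeF i.+1 J v0 - in_right _ _ v) =
    Tot_d i.+1 delta (edgeF i.+1 J v0) + in_right _ _ (Tot_d i delta' v).
  by rewrite -[LHS]/(Tot_d i.+1 delta _) linearB Tot_d_right opprK.
by rewrite [in_right _ _ _]linearD addrCA.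
Qed.

Lemma edgeM_boundary i (J : nat -> lmodType A) (delta : forall k, {linear J k -> J k.+1}) phi v :
  (forall k, injective_module (J k)) -> complex delta ->
  edgeM i J phi = dprevTot J delta i v ->
  exists psi : {linear M -> prev J i}, forall x, dprev delta i (psi x) = hom_fun phi x.
Proof.
elim: i J delta phi v => [|i IH] J delta phi v injJ dK e.
  have -> : phi = 0 by apply: edgeM_inj e.
  by exists (\0 : {linear M -> prev J 0}).
case: i IH phi v e => [|i] IH phi v e.
  have [psi psiE] := factor_cov (injJ 0%N) (esym (congr1 fst e)).
  exists (hom_fun psi) => x; have [y <-] := cov_surj x.
  have := congr1 (fun f => hom_fun f y) (congr1 snd e).
  by rewrite -[RHS]/(delta 0%N (hom_fun v y)) -psiE.
case: v e => v0 v' e.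
have [u0 u0E] := factor_d (injJ 0%N) (esym (congr1 fst e)).
pose J' k := J k.+1; pose delta' k := delta k.+1.
apply: (IH J' delta' phi (edgeF i J' (postcomp _ (delta 0%N) u0) - v')).
- by move=> k; apply: injJ.
- by move=> k; apply: dK.
transitivity (edgeF i.+1 J' (postcomp _ (delta 0%N) v0) - Tot_d i delta' v').
  exact: (congr1 snd e).
rewrite -[RHS]/(Tot_d i delta' _) linearB Tot_d_edgeF postcomp_complex // linear0.
have -> : v0 = pre_d _ i u0 by rewrite u0E.
congr (_ - _).
by congr pair; apply: lin_hom_eq.
Qed.
End Top.

(** ** The edge of Hom(F, N), for a resolution J of N *)
Section Bottom.
Hypothesis projF : forall i, projective (F i).
Notation dprevTot J delta i := (dprev (fun k => Tot_d k delta) i).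

Lemma edgeF_inj i (J : nat -> lmodType A) c : edgeF i J c = 0 -> c = 0.
Proof. by case: i c => [|i] c // /(congr1 fst). Qed.

Lemma Tot_d_dprev i (J : nat -> lmodType A) (delta : forall k, {linear J k -> J k.+1}) v :
  complex delta -> Tot_d i delta (dprevTot J delta i v) = 0.
Proof. by case: i v => [|k] v dK; [exact: linear0 | apply: Tot_dd]. Qed.

Lemma edgeF_closed i (J : nat -> lmodType A) (delta : forall k, {linear J k -> J k.+1}) w c v :
  complex delta -> w = edgeF i J c + dprevTot J delta i v -> (Tot_d i delta w).2 = 0 ->
  postcomp _ (delta 0%N) c = 0.
Proof. by move=> dK ->; rewrite linearD Tot_d_dprev // addr0 Tot_d_edgeF => /edgeF_inj. Qed.

(** The columns Hom(F_p, J) are exact in positive degrees because [F_p] is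
    projective. The components of [w] are removed beginning with the one of
    highest degree in [J]. *)
Lemma edgeF_onto i (J : nat -> lmodType A) (delta : forall k, {linear J k -> J k.+1}) w :
  complex delta -> (forall k x, delta k.+1 x = 0 -> exists y, delta k y = x) ->
  (Tot_d i delta w).2 = 0 ->
  exists2 c, postcomp _ (delta 0%N) c = 0 & exists v, w = edgeF i J c + dprevTot J delta i v.
Proof.
move=> dK exJ Dw.
suff [c [v wE]] : exists c v, w = edgeF i J c + dprevTot J delta i v.
  by exists c; [apply: edgeF_closed wE Dw | exists v].
elim: i J delta dK exJ w Dw => [|i IH] J delta dK exJ w Dw.
  by exists w, 0; rewrite linear0 addr0.
case: w Dw => w0 w' Dw.
pose J' k := J k.+1; pose delta' k := delta k.+1.
have dK' : complex delta' by move=> k; apply: dK.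
have Dw' : Tot_d i delta' w' = edgeF i.+1 J' (postcomp _ (delta 0%N) w0).
  by apply/esym/eqP; rewrite -subr_eq0; apply/eqP.
have [|c' [v' w'E]] := IH J' delta' dK' (fun k => exJ k.+1) w'.
  by rewrite Dw'.
have dc' : postcomp _ (delta' 0%N) c' = 0 by apply: edgeF_closed w'E _ => //; rewrite Dw'.
have [u uE] : exists u : lin_hom (F i) (J 0%N), postcomp _ (delta 0%N) u = c'.
  have [x|u uE] := @projF i _ _ (delta 0%N) (hom_fun c').
    exact/exJ/(congr1 (fun f => hom_fun f x) dc').
  by exists (to_hom u); apply: lin_hom_eq.
have wE : (w0, w') = edgeF i.+1 J (w0 - pre_d _ i u) +
    (Tot_d i delta (edgeF i J u) + in_right _ _ (dprevTot J' delta' i v')).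
  rewrite Tot_d_edgeF uE; congr pair; rewrite /= ?addr0 ?subrK //.
  by rewrite add0r w'E.
exists (w0 - pre_d _ i u); rewrite {1}wE.
case: i {IH} w0 w' Dw Dw' c' v' w'E dc' u uE wE => [|i] w0 w' Dw Dw' c' v' w'E dc' u uE wE.
  exists (edgeF 0 J u); congr (_ + _).
  by rewrite -[dprevTot _ _ 0 _]/0 linear0 addr0.
exists (edgeF i.+1 J u - in_right _ _ v'); congr (_ + _).
by rewrite -[RHS]/(Tot_d i.+1 delta _) linearB Tot_d_right opprK.
Qed.

Lemma edgeF_boundary i (J : nat -> lmodType A) (delta : forall k, {linear J k -> J k.+1}) c v :
  complex delta -> (forall k x, delta k.+1 x = 0 -> exists y, delta k y = x) ->
  edgeF i.+1 J c = Tot_d i delta v ->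
  exists2 b, postcomp _ (delta 0%N) b = 0 & c = pre_d _ i b.
Proof.
move=> dK exJ e.
have [|b db [v' vE]] := edgeF_onto dK exJ (w := v) (i := i); first by rewrite -e.
exists b => //; have := congr1 fst e; rewrite vE linearD Tot_d_dprev // addr0 Tot_d_edgeF.
by [].
Qed.
End Bottom.
End TotalComplex.

Lemma injective_Tot (A : comNzRingType) (F : nat -> lmodType A) i (J : nat -> lmodType A) :
  (forall k (V : lmodType A), injective_module V -> injective_module (lin_hom (F k) V)) ->
  (forall k, injective_module (J k)) -> injective_module (Tot F i J).
Proof.
move=> injF; elim: i J => [|i IH] J injJ; first exact: injF.
by apply: injective_pair; [apply: injF | apply: IH => k; apply: injJ].
Qed.

(** * Ext by projective and by injective resolutions *)

Section ExtRelation.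
Variables (A : comNzRingType) (M N : lmodType A).

(** The class of a cocycle, uniformly in the degree. *)
Definition Ext_pi j : {linear ker_mod (precomp (V := N) (res_d M j)) -> Ext j M N} :=
  match j with
  | 0 => quot_pi (in_im_submod (\0 : {linear lin_hom (res_mod M 0) N -> lin_hom (res_mod M 0) N})
                   (precomp (V := N) (res_d M 0)))
  | j'.+1 => quot_pi (in_im_submod (precomp (V := N) (res_d M j')) (precomp (V := N) (res_d M j'.+1)))
  end.

Lemma Ext_pi_surj j (e : Ext j M N) : exists z, Ext_pi j z = e.
Proof. by case: j e => [|j] e; have [z ->] := quot_pi_surj e; exists z. Qed.

Lemma Ext_pi_eq0 j z : Ext_pi j z = 0 <->
  exists b, dprev (fun i => pre_d (res_d M) N i) j b = val z.
Proof.
by case: j z => [|j] z; rewrite -(linear0 (Ext_pi _)); (split=> [/quot_piP|[b bE]];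
  [rewrite subr0 unfold_in => /asboolP[x xE] |
   apply/quot_piP; rewrite subr0 unfold_in; apply/asboolP]);
  [exists 0; rewrite linear0 -xE | exists 0; rewrite -bE | exists x | exists b].
Qed.

Variables (I : nat -> lmodType A) (delta : forall k, {linear I k -> I k.+1}).
Hypothesis injI : forall k, injective_module (I k).
Variable iota : {linear N -> I 0%N}.
Hypothesis iota_inj : injective iota.
Hypothesis ker0 : forall x, delta 0%N x = 0 <-> exists y, iota y = x.
Hypothesis kerS : forall k x, delta k.+1 x = 0 <-> exists y, delta k y = x.

Let F := res_mod M.
Let d := res_d M.
Let cov : {linear F 0%N -> M} := free_cover M.
Notation dprevTot := (dprev (fun k => Tot_d d k delta)).

Lemma res_exact i x : d i x = 0 <-> exists y, d i.+1 y = x.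
Proof.
split=> [dx|[y <-]]; last exact: res_dd.
have kx : free_cover (syzygy i.+1 M) x = 0 by apply: val_inj.
have kx' : in_ker (free_cover (syzygy i.+1 M)) x by apply/eqP.
pose u : syzygy i.+2 M := exist _ x kx'.
by exists << u >>; rewrite /d /res_d /= free_cover_surj.
Qed.

Lemma res_ker_cov x : cov x = 0 <-> exists y, d 0%N y = x.
Proof.
split=> [dx|[y <-]]; last exact: (res_dK (M := M) (n := 0)).
have kx' : in_ker (free_cover (syzygy 0 M)) x by apply/eqP.
pose u : syzygy 1 M := exist _ x kx'.
by exists << u >>; rewrite /d /res_d /= free_cover_surj.
Qed.

Lemma res_cov_surj (x : M) : exists y, cov y = x.
Proof. by exists << x >>; apply: free_cover_surj. Qed.

Let ddK := @res_dd A M.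
Let projF i : projective (F i) := @projective_freeg A _.
Let delta_complex : complex delta.
Proof. by move=> k x; apply/kerS; exists x. Qed.
Let exI k x : delta k.+1 x = 0 -> exists y, delta k y = x := (kerS x).1.

(** [e] and [phi] have the same class in the cohomology of the total complex of
    Hom(P, I), where P is the standard resolution of [M]. This is the balancing of
    Ext. *)
Definition ext_rel j (e : Ext j M N) (phi : lin_hom M (I j)) : Prop :=
  exists z v, Ext_pi j z = e /\
    edgeF F j I (postcomp _ iota (val z)) = edgeM cov j I phi + dprevTot j v.

Lemma ext_rel_linear j : linear_rel (@ext_rel j).
Proof.
split; first by exists 0, 0; rewrite !linear0 addr0.
move=> a e phi e' phi' [z [v [<- zE]]] [z' [v' [<- zE']]].
exists (a *: z + z'), (a *: v + v'); split; first by rewrite linearP.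
transitivity (a *: edgeF F j I (postcomp _ iota (val z)) + edgeF F j I (postcomp _ iota (val z'))).
  by rewrite -linearP; congr (edgeF _ _ _ _); apply: lin_hom_eq => x; apply: (linearP iota).
by rewrite zE zE' !linearP scalerDr addrACA.
Qed.

Lemma postcomp_iota i (c : lin_hom (F i) (I 0%N)) : postcomp _ (delta 0%N) c = 0 ->
  exists c0, postcomp _ iota c0 = c.
Proof.
move=> dc; have [x|u uE] := @projF i _ _ iota (hom_fun c).
  exact/ker0/(congr1 (fun f => hom_fun f x) dc).
by exists (to_hom u); apply: lin_hom_eq.
Qed.

Lemma postcomp_iota_inj (U : lmodType A) (c c' : lin_hom U N) :
  postcomp _ iota c = postcomp _ iota c' -> c = c'.
Proof.
move=> e; apply: lin_hom_eq => x; apply: iota_inj.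
exact: (congr1 (fun f => hom_fun f x) e).
Qed.

Lemma ext_rel_total j phi : postcomp _ (delta j) phi = 0 -> exists e, @ext_rel j e phi.
Proof.
move=> dphi.
have Dtop : Tot_d d j delta (edgeM cov j I phi) = 0.
  by rewrite (Tot_d_edgeM res_ker_cov) dphi linear0 scaler0.
have [|c dc [v vE]] := edgeF_onto ddK projF (delta := delta) delta_complex exI
    (w := edgeM cov j I phi) (i := j).
  by rewrite Dtop.
have [c0 c0E] := postcomp_iota dc.
have prec : pre_d d _ j c = 0.
  move: Dtop; rewrite vE linearD Tot_d_dprev // addr0 Tot_d_edgeF.
  by move/(congr1 fst).
have zP : in_ker (precomp (V := N) (res_d M j)) c0.
  by apply/eqP/postcomp_iota_inj; rewrite linear0 -prec -c0E; apply: lin_hom_eq.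
exists (Ext_pi j (exist _ c0 zP)), (exist _ c0 zP), (- v); split=> //.
by rewrite c0E linearN vE addrK.
Qed.

Lemma ext_rel_onto j e : exists2 phi, postcomp _ (delta j) phi = 0 & @ext_rel j e phi.
Proof.
have [z <-] := Ext_pi_surj e.
have Dbot : Tot_d d j delta (edgeF F j I (postcomp _ iota (val z))) = 0.
  have dz : postcomp _ (delta 0%N) (postcomp _ iota (val z)) = 0.
    by apply: lin_hom_eq => x; apply/ker0; exists (hom_fun (val z) x).
  rewrite Tot_d_edgeF dz linear0; congr pair; apply: lin_hom_eq => x.
  rewrite -[RHS](linear0 iota).
  exact: (congr1 (fun f => iota (hom_fun f x)) (kerP z)).
have [phi dphi [v vE]] :=
    edgeM_onto ddK res_cov_surj res_ker_cov res_exact injI delta_complex Dbot.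
by exists phi => //; exists z, v.
Qed.

Lemma ext_rel0 j phi : @ext_rel j 0 phi ->
  exists psi : {linear M -> prev I j}, forall x, dprev delta j (psi x) = hom_fun phi x.
Proof.
move=> [z [v [/Ext_pi_eq0[b bE] zE]]].
suff [v' v'E] : exists v', edgeF F j I (postcomp _ iota (val z)) = dprevTot j v'.
  have tE : edgeM cov j I phi = dprevTot j (v' - v) by rewrite linearB -v'E zE addrK.
  exact: (edgeM_boundary res_cov_surj res_ker_cov res_exact injI delta_complex tE).
rewrite -bE; case: j {phi z v zE bE} b => [|j] b.
  by exists 0; rewrite !linear0.
exists (edgeF F j I (postcomp _ iota b)); rewrite -[RHS]/(Tot_d d j delta _) Tot_d_edgeF.
have -> : postcomp _ (delta 0%N) (postcomp _ iota b) = 0.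
  by apply: lin_hom_eq => x; apply/ker0; exists (hom_fun b x).
by rewrite linear0; congr pair; apply: lin_hom_eq.
Qed.

Lemma ext_rel_boundary j e phi (psi : {linear M -> prev I j}) : @ext_rel j e phi ->
  (forall x, dprev delta j (psi x) = hom_fun phi x) -> e = 0.
Proof.
move=> [z [v [<- zE]]] psiE; apply/Ext_pi_eq0.
have [v' v'E] : exists v', edgeF F j I (postcomp _ iota (val z)) = dprevTot j v'.
  by have [v0 v0E] := edgeM_exact res_ker_cov psiE; exists (v0 + v); rewrite linearD -v0E.
case: j e phi psi psiE z {v zE} v' v'E => [|j] e phi psi psiE z v' v'E.
  exists 0; rewrite linear0; apply/esym/postcomp_iota_inj.
  by rewrite linear0; apply: v'E.
have [b db cE] := edgeF_boundary ddK projF delta_complex exI v'E.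
have [b0 b0E] := postcomp_iota db.
exists b0; apply: postcomp_iota_inj; rewrite cE -b0E.
exact: lin_hom_eq.
Qed.
End ExtRelation.

(** * Injective modules over a quotient ring *)

Section Restriction.
Variables (S R : comNzRingType) (f : {rmorphism S -> R}).
Hypothesis f_surj : forall r, exists a, f a = r.

(** [J] is Hom_S(R, V), realised as the part of [V] killed by the kernel of [f].
    A map into [J] from a submodule extends over [S] with values in [V], and the
    kernel of [f] kills the values. *)
Lemma coinduced_exists (V : lmodType S) : injective_module V ->
  exists (J : lmodType R) (i : J -> V), [/\ injective_module J,
    injective i, forall a x y, i (f a *: x + y) = a *: i x + i y &
    forall v, (forall a, f a = 0 -> a *: v = 0) <-> exists x, i x = v].
Proof.
move=> injV.
pose P (v : V) := forall a, f a = 0 -> a *: v = 0.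
have sP : submodule P.
  split=> [a _|c x y Px Py a fa]; first by rewrite scaler0.
  by rewrite scalerDr scalerA mulrC -scalerA Px // Py // scaler0 addr0.
have [U [i [i_inj iP]]] := submodule_exists sP.
have U_ker a : f a = 0 -> forall x : U, a *: x = 0.
  move=> fa x; apply: i_inj; rewrite linearZ linear0 /=.
  by have Pix : P (i x) by [apply/iP; exists x]; apply: Pix.
pose J : lmodType R := descend f_surj U_ker.
have iE a (x y : J) : i (f a *: x + y) = a *: i x + i y.
  rewrite -[f a *: x]/(descend_scale (f a) x) descend_scaleE.
  exact: (linearP i).
exists J, i; split=> // A B j g j_inj.
have j_lin : linear (j : restrict_scalars f A -> restrict_scalars f B).
  by move=> a x y; apply: (linearP j (f a)).
have g_lin : linear ((i : J -> V) \o g : restrict_scalars f A -> V).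
  move=> a x y; rewrite -[LHS]/(i (g (f a *: (x : A) + y))) linearP; exact: iE.
have [h hE] := injV _ _ (linear_of j_lin) (linear_of g_lin) j_inj.
have Ph b : exists x : J, i x = h b.
  apply/iP => a fa; rewrite -linearZ /= -[a *: b]/(f a *: (b : B)) fa scale0r.
  exact: (linear0 h).
have [k kE] := choice Ph.
have k_lin : linear (k : B -> J).
  move=> r x y; have [a <-] := f_surj r; apply: i_inj; rewrite iE !kE.
  exact: (linearP h a).
by exists (linear_of k_lin) => a; apply: i_inj; rewrite /= kE hE.
Qed.
End Restriction.

(** * Ext and injective dimension *)

Section Vanishing.
Variables (A : comNzRingType) (Q : nat -> lmodType A) (d : forall j, {linear Q j.+1 -> Q j}).
Hypothesis projQ : forall j, projective (Q j).
Hypothesis exact_Q : forall j x, d j x = 0 <-> exists y, d j.+1 y = x.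

Let ddQ j x : d j (d j.+1 x) = 0.
Proof. by apply/exact_Q; exists x. Qed.

(** [Ext^(j+1)(X, Z) = 0] for the module [X] resolved by [Q] and the
    submodule [Z] of [V]. *)
Definition Ext_vanish j (V : lmodType A) (Z : V -> Prop) : Prop :=
  forall x : {linear Q j.+1 -> V}, (forall q, Z (x q)) -> (forall q, x (d j.+1 q) = 0) ->
  exists2 y : {linear Q j -> V}, (forall q, Z (y q)) & forall q, y (d j q) = x q.

Lemma Ext_vanish_eq j (V : lmodType A) (Z Z' : V -> Prop) :
  (forall x, Z x <-> Z' x) -> Ext_vanish j Z -> Ext_vanish j Z'.
Proof.
move=> ZZ' vZ x Zx xd; have [|y Zy yE] := vZ x _ xd; first by move=> q; apply/ZZ'.
by exists y => // q; apply/ZZ'.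
Qed.

Lemma Ext_vanish0 j (V : lmodType A) (Z : V -> Prop) : (forall x, Z x <-> x = 0) ->
    Ext_vanish j Z.
Proof.
move=> Z0 x Zx _; exists (\0 : {linear Q j -> V}) => q; first exact/Z0.
by apply/esym/Z0.
Qed.

(** Dimension shifting along 0 -> ker D -> V -> im D -> 0. *)
Lemma Ext_vanish_coker j (V W : lmodType A) (D : {linear V -> W}) : injective_module V ->
  Ext_vanish j.+1 (fun x => D x = 0) -> Ext_vanish j (fun y => exists x, D x = y).
Proof.
move=> injV vK x Zx xd.
have [x1 x1E] := projQ Zx.
have [||y Dy yE] := vK (x1 \o d j.+1); first by move=> q; rewrite /= x1E xd.
  by move=> q; rewrite /= ddQ linear0.
have [|z zE] := factor_through (p := d j) (phi := x1 \- y) injV.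
  by move=> u /exact_Q[q <-]; rewrite /= yE subrr.
exists (D \o z) => q; first by exists (z q).
by rewrite /= zE linearB /= Dy subr0 x1E.
Qed.

(** The same sequence, with the vanishing shifted the other way. *)
Lemma Ext_vanish_kernel j (V W : lmodType A) (D : {linear V -> W}) : injective_module V ->
  Ext_vanish j (fun y => exists x, D x = y) -> Ext_vanish j.+1 (fun x => D x = 0).
Proof.
move=> injV vI x Dx xd.
have [|z zE] := factor_through (p := d j.+1) (phi := x) injV.
  by move=> u /exact_Q[q <-].
have [||y Dy yE] := vI (D \o z); first by move=> q; exists (z q).
  by move=> q; rewrite /= zE Dx.
have [y1 y1E] := projQ Dy.
exists (z \- (y1 \o d j)) => q; first by rewrite linearB /= y1E yE subrr.
by rewrite /= ddQ linear0 subr0 zE.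
Qed.

(** [rho] encodes an isomorphism of [Z/B] onto [E]; this is the long exact sequence
    of 0 -> B -> Z -> E -> 0. *)
Lemma Ext_vanish_extension j (V E : lmodType A) (B Z : V -> Prop) (rho : V -> E -> Prop) :
  submodule Z -> linear_rel rho -> (forall z, B z -> Z z) ->
  (forall z, Z z -> exists e, rho z e) -> (forall e, exists2 z, Z z & rho z e) ->
  (forall z, Z z -> rho z 0 -> B z) -> (forall z e, B z -> rho z e -> e = 0) ->
  Ext_vanish j B -> Ext_vanish j (fun _ : E => True) -> Ext_vanish j Z.
Proof.
move=> sZ rl BZ tot onto ker0 fun0 vB vE x Zx xd.
have r0 : rho 0 0 := rl.1.
have B0 : B 0 by apply: ker0 r0; apply: submod0 sZ.
have [x' x'E] := proj_rel (@projQ _) rl (fun q => tot _ (Zx q)).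
have [||y' _ y'E] := vE x'; first by [].
  by move=> q; apply: fun0 B0 _; rewrite -(xd q).
have rl' : linear_rel (fun e z => Z z /\ rho z e).
  split; first by split=> //; apply: submod0 sZ.
  move=> a e z e' z' [Zz rz] [Zz' rz'].
  by split; [apply: (submodP sZ) | apply: rl.2].
have [|y yE] := proj_rel (@projQ _) rl' (x := y').
  by move=> q; have [z Zz rz] := onto (y' q); exists z.
have [||y2 By2 y2E] := vB (x \- (y \o d j)).
- move=> q; apply: ker0.
    by apply: (submodB sZ) => //; apply: (yE _).1.
  have := rl.2 (-1) _ _ _ _ (yE (d j q)).2 (x'E q).
  by rewrite y'E !scaleN1r addNr addrC.
- by move=> q; rewrite /= xd ddQ linear0 subrr.
exists (y \+ y2) => q; first by apply: (submodD sZ); [apply: (yE q).1 | apply: BZ].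
by rewrite /= y2E /= addrC subrK.
Qed.

(** Dimension shifting along the injective resolution, from the zero module at its
    end down to [E]. *)
Lemma finite_injdim_vanish (E : lmodType A) : finite_injdim E ->
  exists N, forall j, (N <= j)%N -> Ext_vanish j (fun _ : E => True).
Proof.
move=> [n [I [e [D [injI e_inj ker0 kerS I0]]]]].
have step k : (k <= n.+1)%N ->
    forall j, Ext_vanish (j + k) (fun x : I (n.+1 - k)%N => D _ x = 0).
  elim: k => [|k IH] kn j.
    apply: Ext_vanish0 => x; rewrite (I0 _ _ x) ?subn0 //.
    by split=> // _; apply: linear0.
  rewrite addnS; apply: Ext_vanish_kernel => //.
  have vk := IH (ltnW kn) j.
  rewrite subSn // in vk.
  exact: Ext_vanish_eq (fun x => kerS _ x) vk.
exists n.+1 => j nj x _ xd.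
have := step n.+1 (leqnn _) (j - n.+1)%N; rewrite subnK // subnn => vK.
have [||y Dy yE] := vK (e \o x); first by move=> q; apply/ker0; exists (x q).
  by move=> q; rewrite /= xd linear0.
have [|y' y'E] := @projQ j _ _ e y; first by move=> q; apply/ker0.
by exists y' => // q; apply: e_inj; rewrite y'E yE.
Qed.
End Vanishing.

(** * Socles in the total complex *)

Section Socle.
Variables (A : comNzRingType) (m : A -> Prop).
Variables (b : nat -> nat) (d : forall i, {linear 'rV[A]_(b i.+1) -> 'rV[A]_(b i)}).
Hypothesis d_min : forall i x j, m ((d i x) 0 j).
Notation free := (fun i => 'rV[A]_(b i) : lmodType A).
Notation Tot := (Tot free).
Notation edgeF := (edgeF free).
Notation Tot_d := (Tot_d (F := free) d).

(** The rank of F_(i - s), or 0 if i < s. The recursion is that of the total complex,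
    so that the component in Hom(F_(i - s), J^s) can be projected out and put in
    without transporting along equalities of indices. *)
Fixpoint Tot_rank (i s : nat) : nat :=
  match i, s with
  | _, 0 => b i
  | 0, _.+1 => 0%N
  | i'.+1, s'.+1 => Tot_rank i' s'
  end.

Lemma Tot_rankE i s : (s <= i)%N -> Tot_rank i s = b (i - s).
Proof. by elim: i s => [|i IH] [|s] //= /IH. Qed.

Fixpoint Tot_proj (i : nat) : forall (s : nat) (J : nat -> lmodType A),
    {linear Tot i J -> lin_hom 'rV[A]_(Tot_rank i s) (J s)} :=
  match i with
  | 0 => fun s => match s with
    | 0 => fun J => idfun
    | s'.+1 => fun J => \0 end
  | i'.+1 => fun s => match s with
    | 0 => fun J => fst
    | s'.+1 => fun J => Tot_proj i' s' (fun k => J k.+1) \o snd end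
  end.

Fixpoint Tot_in (i : nat) : forall (s : nat) (J : nat -> lmodType A),
    {linear lin_hom 'rV[A]_(Tot_rank i s) (J s) -> Tot i J} :=
  match i with
  | 0 => fun s => match s with
    | 0 => fun J => idfun
    | s'.+1 => fun J => \0 end
  | i'.+1 => fun s => match s with
    | 0 => fun J => in_left _ _
    | s'.+1 => fun J => in_right _ _ \o Tot_in i' s' (fun k => J k.+1) end
  end.

Lemma Tot_proj_in i s J phi : Tot_proj i s J (Tot_in i s J phi) = phi.
Proof.
elim: i s J phi => [|i IH] [|s] J phi //; last exact: IH.
by apply: lin_hom_eq => x; rewrite [x]thinmx0 !linear0.
Qed.

Lemma kills_linear (V W : lmodType A) (h : {linear V -> W}) x : kills m x -> kills m (h x).
Proof. by move=> mx c mc; rewrite -linearZ /= mx // linear0. Qed.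

Lemma kills_hom (V : lmodType A) n (c : lin_hom 'rV[A]_n V) x : kills m c ->
    kills m (hom_fun c x).
Proof. by move=> mc e me; apply: (congr1 (fun f => hom_fun f x) (mc e me)). Qed.

Lemma pre_d_kills (V : lmodType A) i (c : lin_hom 'rV[A]_(b i) V) :
  kills m c -> pre_d (F := free) d V i c = 0.
Proof.
move=> mc; apply: lin_hom_eq => x; rewrite -[LHS]/(hom_fun c (d i x)) row_homE.
by apply: big1 => j _; apply: kills_hom => //; apply: d_min.
Qed.

Lemma Tot_d_in i s (J : nat -> lmodType A) (delta : forall k, {linear J k -> J k.+1}) phi :
  kills m phi -> postcomp _ (delta s) phi = 0 -> Tot_d i delta (Tot_in i s J phi) = 0.
Proof.
elim: i s J delta phi => [|i IH] [|s] J delta phi mphi dphi.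
- by congr pair; [apply: pre_d_kills | exact: dphi].
- exact: linear0.
- by rewrite [LHS](Tot_d_edgeF (F := free) d (i := i.+1)) pre_d_kills // dphi linear0.
- rewrite [LHS](Tot_d_right (F := free) d).
  by rewrite (IH s (fun k => J k.+1) (fun k => delta k.+1)) // [in_right _ _ _]linear0 oppr0.
Qed.

Lemma Tot_d_fst i (J : nat -> lmodType A) (delta : forall k, {linear J k -> J k.+1}) w :
  kills m w -> (Tot_d i delta w).1 = 0.
Proof.
case: i w => [|i] w mw; first exact: pre_d_kills.
by apply: pre_d_kills; apply: (kills_linear fst).
Qed.

(** By minimality the differential of the resolution is zero on elements killed by
    [m]; only that of [J] remains. *)
Lemma Tot_proj_d i s (J : nat -> lmodType A) (delta : forall k, {linear J k -> J k.+1}) w :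
  kills m w ->
  Tot_proj i.+1 s.+1 J (Tot_d i delta w) = (-1) ^+ s *:
      postcomp _ (delta s) (Tot_proj i s J w).
Proof.
elim: i s J delta w => [|i IH] s J delta w mw.
  case: s => [|s]; first by rewrite expr0 scale1r.
  by apply: lin_hom_eq => x; rewrite [x]thinmx0 !linear0.
case: w mw => w0 w' mw.
have mw' : kills m w' := kills_linear snd mw.
rewrite -[LHS]/(Tot_proj i.+1 s (fun k => J k.+1) (edgeF i.+1 (fun k => J k.+1)
   (postcomp _ (delta 0%N) w0) -
     Tot_d i (fun k => delta k.+1) w')).
rewrite linearB; case: s => [|s].
  by rewrite -[X in _ - X]/((Tot_d i (fun k => delta k.+1) w').1) Tot_d_fst // subr0 expr0 scale1r.
rewrite IH // -[X in X - _]/(Tot_proj i s _ 0) linear0 sub0r exprS mulN1r scaleNr.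
by [].
Qed.

Variables (J : nat -> lmodType A) (delta : forall k, {linear J k -> J k.+1}).

Lemma Tot_proj_dprev i s (w : Tot i J) (x : 'rV[A]_(Tot_rank i.+1 s)) : kills m w ->
  exists2 u, kills m u & dprev delta s u = hom_fun (Tot_proj i.+1 s J (Tot_d i delta w)) x.
Proof.
move=> mw; case: s x => [|s] x.
  exists 0; first by move=> c _; rewrite scaler0.
  by rewrite linear0 -[Tot_proj i.+1 0 _ _]/((Tot_d i delta w).1) Tot_d_fst.
exists ((-1) ^+ s *: hom_fun (Tot_proj i s J w) x).
  apply: (submodZ (kills_submodule _ _)); apply: kills_hom; exact: kills_linear.
by rewrite Tot_proj_d // linearZ.
Qed.

(** Otherwise [y], which represents a nonzero class of [Ext^s(k, S)], can be
    placed on a basis element of F_(i + 1 - s). By minimality this is a cycle of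
    the total complex, and minimality again turns a primitive of it that is killed
    by [m] into one of [y]. *)
Lemma rank_zero i s (y : J s) :
  kills m y -> delta s y = 0 ->
  (forall w, kills m w -> dprev delta s w <> y) ->
  (forall z : Tot i.+1 J, kills m z -> Tot_d i.+1 delta z = 0 ->
     exists2 w, kills m w & Tot_d i delta w = z) ->
  Tot_rank i.+1 s = 0%N.
Proof.
move=> my dy ny soc; case rkE': (Tot_rank i.+1 s) => [//|n]; exfalso.
have k0 : 'I_(Tot_rank i.+1 s) by rewrite rkE'; exact: ord0.
have phi_lin : linear (fun x : 'rV[A]_(Tot_rank i.+1 s) => x 0 k0 *: y).
  by move=> a u v; rewrite !mxE scalerDl scalerA.
pose phi : lin_hom 'rV[A]_(Tot_rank i.+1 s) (J s) := to_hom (linear_of phi_lin).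
have phi_y : hom_fun phi (delta_mx 0 k0) = y.
  by rewrite -[LHS]/((delta_mx 0 k0 : 'rV[A]_(Tot_rank i.+1 s)) 0 k0 *: y) mxE !eqxx scale1r.
have mphi : kills m phi.
  by move=> c mc; apply: lin_hom_eq => x;
      rewrite -[LHS]/(c *: (x 0 k0 *: y)) scalerA mulrC -scalerA my // scaler0.
have dphi : postcomp _ (delta s) phi = 0.
  by apply: lin_hom_eq => x; rewrite -[LHS]/(delta s (x 0 k0 *: y)) linearZ /= dy scaler0.
have [||w mw wE] := soc (Tot_in i.+1 s J phi).
- exact: kills_linear.
- exact: Tot_d_in.
have [u mu uE] := Tot_proj_dprev (delta_mx 0 k0) mw.
by apply: (ny u mu); rewrite uE wE Tot_proj_in phi_y.
Qed.
End Socle.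

(** * Finite projective dimension *)

Lemma finite_injdim0 (A : comNzRingType) : finite_injdim ('rV[A]_0 : lmodType A).
Proof.
have e (x y : 'rV[A]_0) : x = y by rewrite [x]thinmx0 [y]thinmx0.
exists 0%N, (fun=> 'rV[A]_0 : lmodType A), idfun, (fun=> idfun).
by split=> [k|x y _|x|k x|k _ x]; [exact: injective_zero | exact: e | | | exact: e];
  split=> _; [exists x | | exists x |]; exact: e.
Qed.

Section Cycles.
Variables (A : comNzRingType) (m : A -> Prop).
Variables (q : nat -> nat)
  (dq : forall j, {linear 'rV[A]_(extend_rank 1 q j.+1) -> 'rV[A]_(extend_rank 1 q j)}).
Hypothesis dq0 : forall x : 'rV_1, im_d dq (j := 0) x <-> m (x 0 0).
Hypothesis dq_exact : forall j x, dq j x = 0 <-> exists y, dq j.+1 y = x.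
Notation freeQ := (fun j => 'rV[A]_(extend_rank 1 q j) : lmodType A).
Notation vanishQ := (Ext_vanish (Q := freeQ) dq).
Let projQ j : projective 'rV[A]_(extend_rank 1 q j) := @projective_row A _.

(** Scaling the preimage [w] of an element killed by [m] maps [m] to the kernel
    of [D]. As [Ext^1(k, ker D) = 0], this map extends to the ring, and its value
    at 1 corrects [w]. *)
Lemma socle_lift (V W : lmodType A) (D : {linear V -> W}) w :
  vanishQ 0 (fun x => D x = 0) -> kills m (D w) -> exists2 w', kills m w' & D w' = D w.
Proof.
move=> vK mDw.
pose x : {linear 'rV[A]_(extend_rank 1 q 1) -> V} := row_hom (fun _ : 'I_1 => w) \o dq 0%N.
have xE u : x u = (dq 0%N u : 'rV_1) 0 0 *: w by rewrite /= big_ord1.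
have md u : m ((dq 0%N u : 'rV_1) 0 0) by apply/dq0; exists u.
have [u|u|y Dy yE] := vK x.
- by rewrite xE linearZ /= mDw.
- rewrite xE; have -> : dq 0%N (dq 1%N u) = 0 by apply/dq_exact; exists u.
  by rewrite mxE scale0r.
exists (w - y (delta_mx 0 0 : 'rV_1)); last by rewrite linearB /= Dy subr0.
move=> c mc; have /dq0[u uE] : m ((c *: delta_mx 0 0 : 'rV[A]_1) 0 0) by rewrite !mxE mulr1.
by rewrite scalerBr -linearZ -uE yE xE uE !mxE mulr1 subrr.
Qed.

Variables (M : lmodType A) (b : nat -> nat) (d : forall i, {linear 'rV[A]_(b i.+1) -> 'rV[A]_(b i)}).
Variable cov : {linear 'rV[A]_(b 0%N) -> M}.
Hypothesis cov_surj : forall x, exists y, cov y = x.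
Hypothesis ker_cov : forall x, cov x = 0 <-> exists y, d 0%N y = x.
Hypothesis d_exact : forall i x, d i x = 0 <-> exists y, d i.+1 y = x.
Variables (J : nat -> lmodType A) (delta : forall k, {linear J k -> J k.+1}).
Hypothesis injJ : forall k, injective_module (J k).
Hypothesis dK : complex delta.

Notation free := (fun i => 'rV[A]_(b i) : lmodType A).
Notation Tot i := (Tot free i J).
Notation Tot_d i := (Tot_d (F := free) d i delta).
Notation edgeM i := (edgeM (F := free) cov i J).
Notation dprevTot i := (dprev (I := fun k => Tot k) (fun k => Tot_d k) i).

Definition cochain_closed i (phi : lin_hom M (J i)) : Prop := postcomp _ (delta i) phi = 0.
Definition cochain_exact i (phi : lin_hom M (J i)) : Prop :=
  exists psi : {linear M -> prev J i}, forall x, dprev delta i (psi x) = hom_fun phi x.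

(** [sigma] identifies [E] with the [i]-th cohomology of [Hom(M, J)]. *)
Definition represents_cohomology i (E : lmodType A) (sigma : E -> lin_hom M (J i) -> Prop) :=
  [/\ linear_rel sigma,
      forall phi, cochain_closed phi -> exists e, sigma e phi,
      forall e, exists2 phi, cochain_closed phi & sigma e phi,
      forall phi, sigma 0 phi -> cochain_exact phi
    & forall e phi, sigma e phi -> cochain_exact phi -> e = 0].

Let ddK i x : d i (d i.+1 x) = 0.
Proof. by apply/d_exact; exists x. Qed.

Lemma boundary_cycle i v : Tot_d i (dprevTot i v) = 0.
Proof. exact: (Tot_d_dprev (F := free) ddK v dK). Qed.

Lemma injective_total i : injective_module (Tot i).
Proof. by apply: injective_Tot => // k V; apply: injective_hom_row. Qed.

(** The cycles are an extension of the cohomology by the boundaries. *)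
Lemma cycles_vanish_step i E sigma : @represents_cohomology i E sigma -> finite_injdim E ->
  (exists N, forall j, (N <= j)%N -> vanishQ j (fun w => exists v, dprevTot i v = w)) ->
  exists N, forall j, (N <= j)%N -> vanishQ j (fun w => Tot_d i w = 0).
Proof.
move=> [sl tot onto ker0 fun0] fE [N NE].
have [N' N'E] := finite_injdim_vanish (Q := freeQ) projQ dq_exact fE.
exists (maxn N N') => j; rewrite geq_max => /andP[Nj N'j].
pose rho (w : Tot i) (e : E) := exists phi v,
  [/\ cochain_closed phi, w = edgeM i phi + dprevTot i v & sigma e phi].
apply: (Ext_vanish_extension (Q := freeQ) projQ dq_exact
  (B := fun w => exists v, dprevTot i v = w) (rho := rho)).
- split; first exact: linear0.
  by move=> a x y Dx Dy; rewrite linearP Dx Dy scaler0 addr0.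
- split; first by exists 0, 0; split;
    [exact: linear0 | rewrite !linear0 addr0 | exact: sl.1].
  move=> a w e w' e' [phi [v [cphi -> sphi]]] [phi' [v' [cphi' -> sphi']]].
  exists (a *: phi + phi'), (a *: v + v'); split.
  + by rewrite /cochain_closed linearP cphi cphi' scaler0 addr0.
  + by rewrite !linearP scalerDr addrACA.
  + exact: sl.2.
- by move=> _ [v <-]; apply: boundary_cycle.
- move=> w Dw; have [phi cphi [v wE]] :=
    edgeM_onto (F := free) ddK cov_surj ker_cov d_exact injJ dK Dw.
  by have [e sphi] := tot phi cphi; exists e, phi, v.
- move=> e; have [phi cphi sphi] := onto e; exists (edgeM i phi).
    by rewrite (Tot_d_edgeM (F := free) ker_cov) cphi linear0 scaler0.
  by exists phi, 0; rewrite linear0 addr0.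
- move=> w _ [phi [v [cphi -> /ker0[psi psiE]]]].
  have [v' ->] := edgeM_exact (F := free) (d := d) ker_cov psiE.
  by exists (v' + v); rewrite linearD.
- move=> w e [v' <-] [phi [v [cphi wE sphi]]]; apply: fun0 sphi _.
  have tE : edgeM i phi = dprevTot i (v' - v) by rewrite linearB wE addrK.
  exact: (edgeM_boundary (F := free) cov_surj ker_cov d_exact injJ dK tE).
- exact: NE.
- exact: N'E.
Qed.

Variable s : nat.
Hypothesis coh_low : forall i, (i <= s)%N -> exists E sigma,
  @represents_cohomology i E sigma /\ finite_injdim E.
Hypothesis coh_high : forall i, (s < i)%N -> forall phi : lin_hom M (J i),
  cochain_closed phi -> cochain_exact phi.

Lemma cycles_vanish i : (i <= s)%N ->
  exists N, forall j, (N <= j)%N -> vanishQ j (fun w => Tot_d i w = 0).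
Proof.
elim: i => [|i IH] is_; have [E [sigma [sE fE]]] := coh_low is_.
  apply: (cycles_vanish_step sE fE); exists 0%N => j _.
  by apply: Ext_vanish0 => x; split=> [[v <-]|->]; [|exists 0].
apply: (cycles_vanish_step sE fE); have [N NE] := IH (ltnW is_).
exists N => j Nj; apply: (Ext_vanish_coker (Q := freeQ) projQ dq_exact); first exact:
    injective_total.
by apply: NE; apply: leqW.
Qed.

Lemma cycle_boundary i w : (s < i)%N -> Tot_d i w = 0 -> exists v, dprevTot i v = w.
Proof.
move=> si Dw; have [phi cphi [v wE]] :=
    edgeM_onto (F := free) ddK cov_surj ker_cov d_exact injJ dK Dw.
have [psi psiE] := coh_high si cphi.
have [v' v'E] := edgeM_exact (F := free) (d := d) ker_cov psiE.
by exists (v' + v); rewrite linearD wE -v'E.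
Qed.

(** Above degree [s] the cycles are the cokernels of the cycles one degree below,
    so with each degree Ext vanishes from one degree earlier on, until even
    [Ext^1] does. *)
Lemma cycles_vanish_high : exists N, forall i, (s + N <= i)%N ->
    vanishQ 0 (fun w => Tot_d i w = 0).
Proof.
have [N NE] := cycles_vanish (leqnn s); exists N.
have step k j : (N <= j + k)%N -> vanishQ j (fun w => Tot_d (k + s) w = 0).
  elim: k j => [|k IH] j; first by rewrite addn0; apply: NE.
  rewrite addnS -addSn => /IH vk.
  apply: Ext_vanish_eq (Ext_vanish_coker (Q := freeQ) projQ dq_exact (@injective_total (k + s)) vk) => w.
  split=> [[v <-]|]; first exact: (boundary_cycle (i := (k + s).+1)).
  by apply: (cycle_boundary (i := (k + s).+1)); rewrite ltnS leq_addl.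
move=> i si; have := step (i - s)%N 0%N; rewrite subnK; last exact:
    leq_trans (leq_addr _ _) si.
by apply; rewrite add0n leq_subRL ?(leq_trans _ si) ?leq_addr.
Qed.

Hypothesis d_min : forall i x j, m ((d i x) 0 j).
Variable y : J s.
Hypothesis my : kills m y.
Hypothesis dy : delta s y = 0.
Hypothesis ny : forall w, kills m w -> dprev delta s w <> y.

Lemma betti_zero : exists2 p, (0 < p)%N & b p = 0%N.
Proof.
have [N NE] := cycles_vanish_high.
exists ((s + N).+1 - s)%N; first by rewrite subSn ?leq_addr.
rewrite -Tot_rankE; last by rewrite leqW // leq_addr.
apply: (rank_zero d_min my dy ny) => z mz Dz.
have [w wE] := cycle_boundary (i := (s + N).+1) (leq_addr _ _ : (s < (s + N).+1)%N) Dz.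
have [|w' mw' w'E] := socle_lift (NE _ (leqnn _)) (w := w).
  by rewrite -[Tot_d _ w]/(dprevTot _ w) wE.
by exists w' => //; rewrite w'E.
Qed.
End Cycles.

(** * Comparison of projective resolutions *)

Section ChainMaps.
Variables (A : comNzRingType) (M : lmodType A).
Variables (F P : nat -> lmodType A) (dF : forall i, {linear F i.+1 -> F i})
  (dP : forall i, {linear P i.+1 -> P i}).
Variables (covF : {linear F 0%N -> M}) (covP : {linear P 0%N -> M}).
Hypothesis projF : forall i, projective (F i).
Hypothesis covFd : forall x, covF (dF 0%N x) = 0.
Hypothesis dFd : forall i x, dF i (dF i.+1 x) = 0.
Hypothesis covP_surj : forall x, exists y, covP y = x.
Hypothesis ker_covP : forall x, covP x = 0 -> exists y, dP 0%N y = x.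
Hypothesis exactP : forall i x, dP i x = 0 -> exists y, dP i.+1 y = x.

Lemma chain_map_exists : exists alpha : forall i, {linear F i -> P i},
  (forall x, covP (alpha 0%N x) = covF x) /\
  forall i x, dP i (alpha i.+1 x) = alpha i (dF i x).
Proof.
have [|a0 a0E] := @projF 0%N _ _ covP covF; first by move=> x; apply: covP_surj.
pose good i (a : {linear F i -> P i}) := forall x, exists y, dP i y = a (dF i x).
have ex i (a : {linear F i -> P i}) : exists a' : {linear F i.+1 -> P i.+1},
    good i a -> forall x, dP i (a' x) = a (dF i x).
  have [ga|nga] := pselect (good i a); last by exists (\0 : {linear F i.+1 -> P i.+1}).
  by have [a' a'E] := @projF i.+1 _ _ (dP i) (a \o dF i) ga; exists a'.
pose alpha := fix alpha i : {linear F i -> P i} :=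
  if i is i'.+1 then sval (cid (ex i' (alpha i'))) else a0.
have alphaE i : good i (alpha i) -> forall x, dP i (alpha i.+1 x) = alpha i (dF i x).
  exact: svalP (cid (ex i (alpha i))).
have alpha_good i : good i (alpha i).
  elim: i => [|i IH] x; first by apply: ker_covP; rewrite a0E covFd.
  by apply: exactP; rewrite alphaE // dFd linear0.
by exists alpha; split=> // i; apply: alphaE.
Qed.
End ChainMaps.

Section Comparison.
Variables (A : comNzRingType) (M N : lmodType A).
Variables (F : nat -> lmodType A) (d : forall i, {linear F i.+1 -> F i}).
Variable cov : {linear F 0%N -> M}.
Hypothesis projF : forall i, projective (F i).
Hypothesis cov_surj : forall x, exists y, cov y = x.
Hypothesis ker_cov : forall x, cov x = 0 <-> exists y, d 0%N y = x.
Hypothesis exact_d : forall i x, d i x = 0 <-> exists y, d i.+1 y = x.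

(** [F] and the standard resolution of [M] map to each other, and the composite on
    [F] is homotopic to the identity: a cocycle on [F] is pulled back to the
    standard resolution, where it is a coboundary. *)
Lemma Ext0_resolution j (c : {linear F j.+1 -> N}) :
  (forall e : Ext j.+1 M N, e = 0) -> (forall x, c (d j.+1 x) = 0) ->
  exists c' : {linear F j -> N}, forall x, c x = c' (d j x).
Proof.
move=> Ext0 cd.
have ddK i x : d i (d i.+1 x) = 0 by apply/exact_d; exists x.
have covd x : cov (d 0%N x) = 0 by apply/ker_cov; exists x.
pose P := res_mod M; pose dP := res_d M; pose covP : {linear P 0%N -> M} := free_cover M.
have projP i : projective (P i) by exact: projective_freeg.
have covPd x : covP (dP 0%N x) = 0 by apply/res_ker_cov; exists x.
have [alpha [alpha0 alphaE]] := @chain_map_exists A M F P d dP cov covP projF covd ddK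
  (@res_cov_surj A M) (fun x => (@res_ker_cov A M x).1) (fun i x => (@res_exact A M i x).1).
have [beta [beta0 betaE]] :=
    @chain_map_exists A M P F dP d covP cov projP covPd (@res_dd A M)
  cov_surj (fun x => (ker_cov x).1) (fun i x => (@exact_d i x).1).
pose z := to_hom (c \o beta j.+1) : lin_hom (res_mod M j.+1) N.
have zP : in_ker (precomp (V := N) (res_d M j.+1)) z.
  apply/eqP/lin_hom_eq => x; rewrite -[LHS]/(c (beta j.+1 (dP j.+1 x))) -betaE.
  exact: cd.
have /Ext_pi_eq0[b bE] := Ext0 (Ext_pi M N j.+1 (exist _ z zP)).
have bd x : c (beta j.+1 x) = hom_fun b (dP j x).
  by apply/esym; apply: (congr1 (fun f => hom_fun f x) bE).
pose gam i : {linear F i -> F i} := (beta i \o alpha i) \- idfun.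
have gamd i x : gam i (d i x) = d i (gam i.+1 x).
  by rewrite /= linearB /= betaE alphaE.
have [|h [h' hE]] := homotopyS projF exact_d gamd _ j.
  by move=> x; apply/ker_cov; rewrite /= linearB /= beta0 alpha0 subrr.
exists ((hom_fun b \o alpha j) \- (c \o h)) => x.
rewrite /= -alphaE -bd; have /(congr1 c) := hE x.
rewrite /= linearB linearD /= cd add0r => <-.
by rewrite opprB addrC subrK.
Qed.
End Comparison.

(** * Minimal resolutions with exact dual *)

Lemma row0_eq0 (R : comNzRingType) n (x : 'rV[R]_n) : n = 0%N -> x = 0.
Proof. by move=> n0; move: x; rewrite n0 => x; rewrite thinmx0. Qed.

Section Freeness.
Variables (R : comNzRingType) (m : R -> Prop) (M : lmodType R).
Hypothesis m_loc : nonunits m.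
Variables (b : nat -> nat) (d : forall i, {linear 'rV[R]_(b i.+1) -> 'rV[R]_(b i)}).
Variable cov : {linear 'rV[R]_(b 0%N) -> M}.
Hypothesis cov_surj : forall x, exists y, cov y = x.
Hypothesis ker_cov : forall x, cov x = 0 <-> exists y, d 0%N y = x.
Hypothesis exact_d : forall i x, d i x = 0 <-> exists y, d i.+1 y = x.
Hypothesis d_min : forall i x j, m ((d i x) 0 j).
Hypothesis Ext_R : forall j (c : {linear 'rV[R]_(b j.+1) -> R^o}),
  (forall x, c (d j.+1 x) = 0) ->
  exists c' : {linear 'rV[R]_(b j) -> R^o}, forall x, c x = c' (d j x).

(** A minimal free resolution whose dual is exact cannot stop after a nonzero
    term of positive degree: the coordinate functionals of its last term
    would take values in the maximal ideal. *)
Lemma resolution_trivial p : (0 < p)%N -> b p = 0%N -> b 1%N = 0%N.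
Proof.
case: p => // p _; elim: p => [//|p IH] bp; apply: IH.
case bE : (b p.+1) => [//|n]; exfalso.
have k : 'I_(b p.+1) by rewrite bE; exact: ord0.
have [x|c' c'E] := @Ext_R p (dot (delta_mx 0 k)).
  have -> : x = 0; last by rewrite !linear0.
  exact: row0_eq0.
have [im m1 _] := m_loc; apply: m1.
have := c'E (delta_mx 0 k); rewrite dot_delta mxE !eqxx /= mulr1n => ->.
rewrite row_homE; apply: (submod_sum im) => l; rewrite -[_ *: _]/(_ * _).
exact: ideal_mulr.
Qed.

Lemma free_of_trivial : b 1%N = 0%N -> free_module M.
Proof.
move=> b1.
have cov_inj x : cov x = 0 -> x = 0.
  move=> /ker_cov[y <-]; have -> : y = 0; last by rewrite linear0.
  exact: row0_eq0.
pose K : choiceType := 'I_(b 0%N).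
pose g : {linear {freeg K / R} -> M} := fglift (fun k : K => cov (delta_mx 0 k)) :
    {freeg K / R} -> M.
pose h : {linear 'rV[R]_(b 0%N) -> {freeg K / R}} :=
    row_hom (fun k : K => << k >> : {freeg K / R}).
have gk (k : K) : g << k >> = cov (delta_mx 0 k) by rewrite /g /= liftU scale1r.
have hk (k : K) : h (delta_mx 0 k) = << k >> by apply: row_hom_delta.
have gh u : g (h u) = cov u.
  rewrite [RHS]row_homE (row_homE h u) linear_sum; apply: eq_bigr => k _.
  by rewrite linearZZ; congr (_ *: _); apply: etrans (congr1 g (hk k)) (gk k).
pose y : {linear {freeg K / R} -> 'rV[R]_(b 0%N)} :=
  fglift (fun k : K => delta_mx 0 k : 'rV[R]_(b 0%N)) : {freeg K / R} -> 'rV[R]_(b 0%N).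
have yk (k : K) : y << k >> = delta_mx 0 k by rewrite /y /= liftU scale1r.
have h_surj (D : {freeg K / R}) : exists u, h u = D.
  exists (y D); apply: (@freeg_linear_eq R K _ (h \o y) idfun) => k.
  exact: etrans (congr1 h (yk k)) (hk k).
have g_inj D : g D = 0 -> D = 0.
  have [u <-] := h_surj D; rewrite gh => /cov_inj ->; exact: linear0.
have g_surj x : exists D, g D = x.
  by have [u <-] := cov_surj x; exists (h u).
have [k kE] := choice g_surj.
exists K, g, k => D; last exact: kE.
by apply/eqP; rewrite -subr_eq0; apply/eqP/g_inj; rewrite linearB kE subrr.
Qed.
End Freeness.

(** * Deficiency modules *)

Section ChangeOfRings.
Variables (S R : comNzRingType) (f : {rmorphism S -> R}).
Hypothesis f_surj : forall r, exists a, f a = r.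
Variables (I : nat -> lmodType S) (delta : forall k, {linear I k -> I k.+1}).
Hypothesis injI : forall k, injective_module (I k).
Variable iota : {linear S^o -> I 0%N}.
Hypothesis iota_inj : injective iota.
Hypothesis ker0 : forall x, delta 0%N x = 0 <-> exists y, iota y = x.
Hypothesis kerS : forall k x, delta k.+1 x = 0 <-> exists y, delta k y = x.

Variables (J : nat -> lmodType R) (i : forall k, J k -> I k).
Hypothesis i_inj : forall k, injective (@i k).
Hypothesis iD : forall k a x y, i (f a *: x + y) = a *: i x + i y :> I k.
Hypothesis i_im : forall k (v : I k), (forall a, f a = 0 -> a *: v = 0) <-> exists x, i x = v.
Variable deltaJ : forall k, {linear J k -> J k.+1}.
Hypothesis iJ : forall k x, i (deltaJ k x) = delta k (i x).

Lemma img0 k : i (0 : J k) = 0.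
Proof. by have := iD (1 : S) (0 : J k) 0; rewrite scaler0 add0r scale1r => /eqP;
    rewrite -subr_eq subrr => /eqP <-. Qed.

Lemma imgZ k a (x : J k) : i (f a *: x) = a *: i x.
Proof. by have := iD a x 0; rewrite img0 !addr0. Qed.

Variable M : lmodType R.
Notation MS := (restrict_scalars f M).

Lemma restrict_linear k (phi : {linear M -> J k}) : linear (fun x : MS => i (phi x)).
Proof.
by move=> a x y; rewrite -[a *: x + y]/(f a *: (x : M) + (y : M)) linearP iD.
Qed.
(** Hom_R(M, J^k) is Hom_S(M, I^k), since the kernel of [f] kills [M]. *)
Definition to_S k (phi : lin_hom M (J k)) : lin_hom MS (I k) :=
  to_hom (linear_of (restrict_linear (hom_fun phi))).

Lemma from_S k (phi : {linear MS -> I k}) :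
  exists psi : {linear M -> J k}, forall x, i (psi x) = phi x.
Proof.
have im x : exists y, i y = phi x.
  apply/i_im => a fa; rewrite -linearZ -[a *: x]/(f a *: (x : M)) fa scale0r.
  exact: (linear0 phi).
have [g gE] := choice im.
have g_lin : linear (g : M -> J k).
  by move=> r x y; have [a <-] := f_surj r; apply: i_inj; rewrite iD !gE; apply:
      (linearP phi a).
by exists (linear_of g_lin).
Qed.

Lemma to_S_surj k (phi : lin_hom MS (I k)) : exists psi, to_S psi = phi.
Proof. by have [psi psiE] := from_S (hom_fun phi); exists (to_hom psi); apply:
    lin_hom_eq. Qed.

Lemma to_S_linear k a (phi psi : lin_hom M (J k)) :
  to_S (f a *: phi + psi) = a *: to_S phi + to_S psi.
Proof. by apply: lin_hom_eq => x; apply: iD. Qed.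

Lemma to_S_closed k (phi : lin_hom M (J k)) :
  cochain_closed deltaJ phi <-> postcomp _ (delta k) (to_S phi) = 0.
Proof.
split=> [|e]; first (rewrite /cochain_closed => e); apply: lin_hom_eq => x.
  by rewrite -[LHS]/(delta k (i (hom_fun phi x))) -iJ [deltaJ _ _](congr1 (fun h => hom_fun h (x : M)) e) img0.
apply: i_inj; rewrite img0 [LHS]iJ; exact: (congr1 (fun h => hom_fun h (x : MS)) e).
Qed.

Lemma to_S_exact k (phi : lin_hom M (J k)) : cochain_exact deltaJ phi <->
  exists psi : {linear MS -> prev I k}, forall x, dprev delta k (psi x) = hom_fun (to_S phi) x.
Proof.
case: k phi => [|k] phi; split=> -[psi psiE].
- by exists (\0 : {linear MS -> prev I 0}) => x;
    rewrite linear0 -[RHS]/(i (hom_fun phi x)) -psiE img0.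
- by exists (\0 : {linear M -> prev J 0}) => x; rewrite linear0; apply: i_inj; rewrite img0;
    apply: (psiE x).
- exists (hom_fun (to_S (to_hom psi))) => x.
  by rewrite -[LHS]/(delta k (i (psi x))) -iJ -[RHS]/(i (hom_fun phi x)) -psiE.
have [psi' psi'E] := from_S psi.
by exists psi' => x; apply: i_inj; rewrite -[LHS]/(i (deltaJ k (psi' x))) iJ psi'E; apply:
    psiE.
Qed.

(** A cocycle of Hom_S(M, I) takes its values in [J], and the balancing of Ext
    identifies its class with one computed from the standard resolution of [M]. *)
Lemma deficiency_represents n : exists sigma,
  @represents_cohomology R M J deltaJ n
    (descend f_surj (@Ext_restrict_ker S R f n M S^o)) sigma.
Proof.
pose E := descend f_surj (@Ext_restrict_ker S R f n M S^o).
exists (fun (e : E) phi => ext_rel delta iota (e : Ext n MS S^o) (to_S phi)); split.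
- have [r0 rD] := ext_rel_linear (MS : lmodType S) delta iota n; split.
    by have -> : to_S (0 : lin_hom M (J n)) = 0 by apply: lin_hom_eq => x; apply: img0.
  move=> r e phi e' phi' re re'; have [a <-] := f_surj r.
  rewrite to_S_linear; have := rD a _ _ _ _ re re'.
  by rewrite -[a *: (e : Ext n MS S^o)](descend_scaleE f_surj (@Ext_restrict_ker S R f n M S^o)).
- move=> phi /to_S_closed cphi.
  by have [e er] := ext_rel_total iota_inj ker0 kerS cphi; exists e.
- move=> e; have [phi cphi er] := ext_rel_onto injI ker0 kerS (e : Ext n MS S^o).
  by have [psi psiE] := to_S_surj phi; exists psi; [apply/to_S_closed|]; rewrite psiE.
- by move=> phi er; apply/to_S_exact; apply: (ext_rel0 injI ker0 kerS er).
- move=> e phi er /to_S_exact[psi psiE].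
  exact: (ext_rel_boundary iota_inj ker0 kerS er psiE).
Qed.

Lemma rel_vanish_exact n : rel_vanish delta (fun x : MS => x = 0) n ->
  forall phi : lin_hom M (J n), cochain_closed deltaJ phi -> cochain_exact deltaJ phi.
Proof.
move=> Ext_vanish phi /to_S_closed cphi; apply/to_S_exact.
have [|chi _ chiE] := Ext_vanish (hom_fun (to_S phi)); last by exists chi.
split=> [x|x ->]; last exact: linear0.
exact: (congr1 (fun f => hom_fun f x) cphi).
Qed.

Lemma lspan_restrict (t : seq M) x : lspan t x -> lspan (t : seq MS) (x : MS).
Proof.
elim: t x => [|e t IH] x //= [c [y /IH ty ->]].
by have [a <-] := f_surj c; exists a, y.
Qed.

(** The primes of the chain contain the kernel of [f], so their images are primes
    of [R]. *)
Lemma le_dim_restrict j (a : S -> Prop) : (forall c, f c = 0 -> a c) ->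
  (forall c, (forall x : M, f c *: x = 0) -> a c) ->
  prime_chain (fun x => `[<a x>]) j -> le_dim j M.
Proof.
move=> fa Ma [P [aP PS]].
have mono k : (k <= j)%N -> forall x, x \in P 0%N -> x \in P k.
  elim: k => [|k IH] kj x // /(IH (ltnW kj)); exact: (PS k kj).1.
(* Only the first [j + 1] members of the chain are known to contain [a]. *)
pose P' k := P (minn k j).
have fP k c : f c = 0 -> c \in P' k.
  by move=> /fa ac; apply: mono; [exact: geq_minr | apply/aP/asboolP].
have fP' k x y : x \in P' k -> f x = f y -> y \in P' k.
  move=> xP xy; have [[s0 sD] _ _] := prime_mem (P' k).
  have /= := sD (-1) (x - y) x (fP k _ _) xP;
      rewrite -[_ *: _]/(-1 * (x - y)) mulN1r opprB subrK.
  by apply; rewrite rmorphB /= xy subrr.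
have Q k : exists Q : prime_idealr R, forall r, r \in Q <-> exists2 x, x \in P' k & f x = r.
  have [iP P1 PM] := prime_mem (P' k).
  apply: prime_idealr_of; split.
  - split; first by exists 0; [exact: iP.1 | rewrite rmorph0].
    move=> c _ _ [x xP <-] [y yP <-]; have [e <-] := f_surj c.
    exists (e * x + y); first exact: iP.2.
    by rewrite rmorphD rmorphM.
  - by move=> [x xP x1]; apply: P1; apply: fP' xP _; rewrite x1 rmorph1.
  - move=> r r' [x xP xE]; have [e eE] := f_surj r; have [e' eE'] := f_surj r'.
    have [|eP|eP] := PM e e'; [|left; by exists e|right; by exists e'].
    by apply: fP' xP _; rewrite xE rmorphM eE eE'.
have [Q' QE] := choice Q.
exists Q'; split.
  move=> r /asboolP rM; have [e eE] := f_surj r; apply/QE; exists e => //.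
  by rewrite /P' min0n; apply/aP/asboolP/Ma => x; rewrite eE.
move=> k kj; have [PSk [x xP xnP]] := PS k kj.
have Pk : P' k = P k by rewrite /P' (minn_idPl (ltnW kj)).
have Pk1 : P' k.+1 = P k.+1 by rewrite /P' (minn_idPl kj).
split.
  by move=> r /QE[e eP eE]; apply/QE; exists e => //; rewrite Pk1; apply: PSk; rewrite -Pk.
exists (f x); first by apply/QE; exists x => //; rewrite Pk1.
apply/negP => /QE[e eP /(fP' k _ _ eP)]; rewrite Pk.
exact/negP.
Qed.
End ChangeOfRings.

(** * The Auslander-Reiten conjecture *)

Lemma nonunits_restrict (S R : comNzRingType) (f : {rmorphism S -> R}) (mS : S -> Prop)
    (mR : R -> Prop) : (forall r, exists a, f a = r) -> nonunits mS -> nonunits mR ->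
  forall a, mR (f a) <-> mS a.
Proof.
move=> f_surj [iS S1 unitS] [iR R1 unitR] a; split=> [mfa|ma].
  apply: contrapT => /unitS[u ua]; apply: R1.
  by rewrite -(rmorph1 f) -ua rmorphM; apply: ideal_mull.
apply: contrapT => /unitR[v va]; have [b bE] := f_surj v.
have [u uE] : exists u, u * (1 - b * a) = 1.
  apply: unitS => m1; apply: S1; rewrite -[1](subrK (b * a)).
  by apply: (submodD iS) => //; apply: ideal_mull.
have := oner_eq0 R; rewrite -(rmorph1 f) -uE rmorphM rmorphB rmorphM rmorph1 bE va.
by rewrite subrr mulr0 eqxx.
Qed.

Theorem corollary4p10 (R S : comNzRingType)
    (R_noetherian : noetherian_ring R) (R_local : local_ring R)
    (S_gorenstein : gorenstein_local_ring S) (s : nat) (dim_S : krull_dim S s)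
    (f : {rmorphism S -> R}) (f_surj : forall r, exists a, f a = r)
    (M : lmodType R) (M_finite : finite_module M)
    (id_K : forall i, le_dim i M -> finite_injdim (deficiency f_surj s i M))
    (Ext_M : forall j, (0 < j)%N ->
       forall e : Ext j M (M * R^o)%type, e = 0) :
  free_module M.
Proof.
have [S_noetherian S_local [N [I [iota [delta [injI iota_inj ker0 kerS I0]]]]]] :=
    S_gorenstein.
have [mS mS_loc] := local_nonunits S_noetherian S_local.
have [mR mR_loc] := local_nonunits R_noetherian R_local.
have m_iff := nonunits_restrict f_surj mS_loc mR_loc.
have [t0 t0E] := M_finite.
have tE x : lspan t0 x by apply/lspan_sum/t0E.
(* [J k] is Hom_S(R, I k), and [i k] its inclusion into [I k]. *)
pose J k := sval (cid (coinduced_exists f_surj (injI k))).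
pose i k : J k -> I k := sval (cid (svalP (cid (coinduced_exists f_surj (injI k))))).
have iP k : [/\ injective_module (J k), injective (@i k),
    forall a x y, i k (f a *: x + y) = a *: i k x + i k y &
    forall v, (forall a, f a = 0 -> a *: v = 0) <-> exists x, i k x = v].
  exact: svalP (cid (svalP (cid (coinduced_exists f_surj (injI k))))).
have injJ k : injective_module (J k) by have [] := iP k.
have i_inj k : injective (@i k) by have [] := iP k.
have iD k a x y : i k (f a *: x + y) = a *: i k x + i k y by have [] := iP k.
have i_im k v : (forall a, f a = 0 -> a *: v = 0) <-> exists x, i k x = v by have [] :=
    iP k.
have deltaJ_ex k : exists D :
    {linear J k -> J k.+1}, forall x, i k.+1 (D x) = delta k (i k x).
  have im x : exists y, i k.+1 y = delta k (i k x).
    apply/i_im => a fa; rewrite -linearZ /=.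
    have -> : a *: i k x = 0; last exact: linear0.
    by move: a fa; apply/i_im; exists x.
  have [g gE] := choice im.
  have g_lin : linear g.
    move=> r x y; have [a <-] := f_surj r; apply: i_inj; rewrite iD !gE iD.
    exact: linearP.
  by exists (linear_of g_lin).
pose deltaJ k := sval (cid (deltaJ_ex k)).
have iJ k x : i k.+1 (deltaJ k x) = delta k (i k x) := svalP (cid (deltaJ_ex k)) x.
have i00 k : i k 0 = 0 := img0 iD k.
have deltaJK : complex deltaJ.
  by move=> k x; apply: i_inj; rewrite !iJ i00; apply: (exact_deltaK kerS).
(* Over [S] the residue field has Ext in degree [s] only; [y0] is a nonzero class. *)
have Ts := Ext_residue_neq0 injI iota_inj ker0 kerS S_noetherian mS_loc dim_S.
have single := Ext_residue_single injI iota_inj ker0 kerS S_noetherian mS_loc Ts I0.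
have fg := gorenstein_fg injI ker0 kerS S_noetherian mS_loc.
have [y0 [my0 dy0] ny0] : exists2 y0 : I s, cocycle delta mS y0 & ~ coboundary delta mS y0.
  apply: contrapT => H; apply: Ts => y0 yZ; rewrite scale1r.
  by apply: contrapT => nB; apply: H; exists y0.
have [y yE] : exists y, i s y = y0.
  by apply/i_im => a fa; apply/my0/m_iff; rewrite fa; apply:
      submod0 (nonunits_ideal mR_loc).
have my : kills mR y.
  move=> r mr; have [a aE] := f_surj r; apply: i_inj.
  by rewrite -aE (imgZ iD) yE i00 my0 //; apply/m_iff; rewrite aE.
have dy : deltaJ s y = 0 by apply: i_inj; rewrite iJ yE i00.
have cob k (w : prev J k) : kills mR w -> coboundary delta mS (i k (dprev deltaJ k w)).
  case: k w => [|k] w mw; first by exists 0; [move=> c _; rewrite scaler0 | rewrite i00].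
  exists (i k w); last exact/esym/iJ.
  by move=> c mc; rewrite -(imgZ iD) mw ?i00 //; apply/m_iff.
have ny w : kills mR w -> dprev deltaJ s w <> y.
  by move=> /cob mw wE; apply: ny0; rewrite -yE -wE.
have [q [dq [dq0 dq_exact]]] :=
    cyclic_resolution R_noetherian mR_loc (nonunits_ideal mR_loc).
have [n [p [pE p_min]]] := minimal_cover mR_loc t0.
have ker_sub : submodule (fun w => p w = 0).
  split; first exact: linear0.
  by move=> a u v pu pv; rewrite linearP pu pv scaler0 addr0.
have [b' [d [d0E d_exact d_min]]] := minimal_resolution mR_loc R_noetherian ker_sub.
pose b := extend_rank n b'.
have p_surj x : exists u, p u = x by apply/pE/tE.
have d_m k x j : mR ((d k x) 0 j).
  case: k x j => [|k] x j.
    by apply: p_min; apply/d0E; exists x.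
  by apply: d_min; apply/d_exact; exists x.
have vanish_exact k :
    (forall a, ideal a -> (forall c, (forall x : M, f c *: x = 0) -> a c) ->
       Ext_killed delta 1 a k) ->
    forall phi : lin_hom M (J k), cochain_closed deltaJ phi -> cochain_exact deltaJ phi.
  move=> Hk; apply: (rel_vanish_exact f_surj i_inj iD i_im iJ).
  apply: (@rel_vanish_fg S I delta injI (exact_deltaK kerS) (restrict_scalars f M) _ t0).
  - by split=> // a x z -> ->; rewrite scaler0 addr0.
  - by move=> x; apply: lspan_restrict.
  - by move=> a ia aM; apply: Hk => // c cM; apply: aM => x; apply: cM.
(* [Ext^k_S(M, S)] is a deficiency module if s - k <= dim M, and otherwise zero. *)
have coh_low k : (k <= s)%N -> exists E sigma,
    @represents_cohomology R M J deltaJ k E sigma /\ finite_injdim E.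
  move=> ks; have [dimM|dimM] := pselect (le_dim (s - k) M).
    have [sigma sigmaP] := deficiency_represents f_surj injI iota_inj ker0 kerS i_inj iD i_im iJ M k.
    eexists; exists sigma; split; first exact: sigmaP.
    by have := id_K _ dimM; rewrite /deficiency leq_subr subKn.
  exists ('rV[R]_0 : lmodType R), (fun _ phi => cochain_closed deltaJ phi).
  split; last exact: finite_injdim0.
  have vk : forall phi : lin_hom M (J k), cochain_closed deltaJ phi ->
      cochain_exact deltaJ phi.
    apply: vanish_exact => a ia aM.
    have below j : (j < s)%N -> Ext_killed delta 1 mS j by move=> js; apply: single;
        rewrite neq_ltn js.
    have sk : (s - k + k <= s)%N by rewrite subnK.
    apply: (Ext_killed_below injI (exact_deltaK kerS) S_noetherian mS_loc fg below ia sk) => ch.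
    apply: dimM; apply: (le_dim_restrict f_surj _ aM ch).
    by move=> c fc; apply: aM => x; rewrite fc scale0r.
  split=> //.
  - split; first exact: linear0.
    by move=> a _ phi _ psi cphi cpsi;
        rewrite /cochain_closed linearP cphi cpsi scaler0 addr0.
  - by exists 0.
  - by move=> e; exists 0 => //; apply: linear0.
  - by move=> e _ _ _; apply: row0_eq0.
have coh_high k : (s < k)%N -> forall phi : lin_hom M (J k),
    cochain_closed deltaJ phi -> cochain_exact deltaJ phi.
  move=> sk; apply: vanish_exact => a ia _.
  have above j : (s < j)%N -> Ext_killed delta 1 mS j.
    by move=> sj; apply: single; rewrite neq_ltn sj orbT.
  exact: (Ext_killed_above injI (exact_deltaK kerS) S_noetherian mS_loc fg above ia sk).
have [l l_gt0 bl] := betti_zero (M := M) (b := b) (cov := p) dq0 dq_exact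
  p_surj d0E d_exact injJ deltaJK coh_low coh_high d_m my dy ny.
apply: (free_of_trivial (b := b) (cov := p) p_surj d0E).
apply: (resolution_trivial mR_loc (d := d) d_m _ l_gt0 bl) => j c cd.
have [|x|c' c'E] := Ext0_resolution (N := (M * R^o)%type) (F := fun k => 'rV[R]_(b k) : lmodType R)
  (fun k => @projective_row R (b k)) p_surj d0E d_exact (c := in_right M R^o \o c).
- exact: Ext_M.
- by rewrite /= cd.
by exists (snd \o c') => x; rewrite /= -c'E.
Qed.
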